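(* Let $d\ge2$. There is a constant $C=C(d)$ such that the following holds. Let $R>0$, let $h$ be harmonic in $B(0,R)\subset\mathbb{R}^d$, and suppose $N\ge1$ satisfies $N_h(0,\rho)\le N$ for all $\rho<R$. Then for every $r<R/2$ and every $p\in[1,\infty]$, $$\|\nabla h\|_{L^p(B(0,r))}\le C\frac{N}{r}\|h\|_{L^p(B(0,r))}.$$
   Context: For a function $h$ harmonic in a neighbourhood of $\overline{B(x,r)}$, the frequency is $N_h(x,r)=\frac{r\int_{B(x,r)}|\nabla h|^2}{2\int_{\partial B(x,r)}|h|^2}$. *)

(* Defs.v *)
From HB Require Import structures.
From mathcomp Require Import all_boot all_order all_algebra.
From mathcomp Require Import all_classical all_reals all_analysis.
Set Implicit Arguments. Unset Strict Implicit. Unset Printing Implicit Defensive.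
Import Order.TTheory GRing.Theory Num.Theory.
Import numFieldNormedType.Exports.
Local Open Scope classical_set_scope.
Local Open Scope ring_scope.

Section Defs.
Variable R : realType.

(* Lebesgue integral of a nonnegative function on R^n, as the iterated
   one-dimensional Lebesgue integral (Tonelli). *)
Fixpoint iint (n : nat) : ('rV[R]_n -> \bar R) -> \bar R :=
  match n with
  | 0 => fun f => f 0
  | n'.+1 => fun f =>
      (\int[@lebesgue_measure R]_(x in setT)
          iint (fun v : 'rV[R]_n' => f (row_mx (\row_(_ < 1) x) v)))%E
  end.

Definition enorm (n : nat) (v : 'rV[R]_n) : R :=
  Num.sqrt (\sum_(i < n) v ord0 i ^+ 2).

Definition eball (n : nat) (c : 'rV[R]_n) (r : R) : set 'rV[R]_n :=
  [set x | enorm (x - c) < r].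

Definition evec (n : nat) (i : 'I_n) : 'rV[R]_n := \row_j (i == j)%:R.

Definition pd (n : nat) (i : 'I_n) (f : 'rV[R]_n -> R) : 'rV[R]_n -> R :=
  fun x => derive f x (evec i).

Definition grad_norm (n : nat) (f : 'rV[R]_n -> R) (x : 'rV[R]_n) : R :=
  Num.sqrt (\sum_(i < n) pd i f x ^+ 2).

Definition harmonic_on (n : nat) (U : set 'rV[R]_n) (h : 'rV[R]_n -> R) :=
  forall x, U x ->
    [/\ differentiable h x,
        (forall i, differentiable (pd i h) x),
        (forall i j, {for x, continuous (pd j (pd i h))}) &
        \sum_(i < n) pd i (pd i h) x = 0].

(* integral of a nonnegative g over the sphere dB(x,r) w.r.t. surface measure,
   with the surface measure on the unit sphere defined as the cone measure
   sigma(A) = n * lambda({t y | y in A, 0 < t <= 1}), so that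
   int_{S} g dsigma = n * int_{B(0,1)} g(y/|y|) dy. *)
Definition sphere_int (n : nat) (g : 'rV[R]_n -> R) (x : 'rV[R]_n) (r : R)
  : \bar R :=
  ((r ^+ n.-1 * n%:R)%:E *
   iint (fun y => (\1_(eball 0 1) y * g (x + (r / enorm y) *: y))%:E))%E.

Definition frequency (n : nat) (h : 'rV[R]_n -> R) (x : 'rV[R]_n) (r : R) : R :=
  (r * fine (iint (fun y => (\1_(eball x r) y * grad_norm h y ^+ 2)%:E)))
  / (2 * fine (sphere_int (fun y => h y ^+ 2) x r)).

Definition Lp_ball (n : nat) (f : 'rV[R]_n -> R) (c : 'rV[R]_n) (r : R)
  (p : \bar R) : \bar R :=
  match p with
  | EFin q => poweR (iint (fun y => (\1_(eball c r) y * (`|f y| `^ q))%:E)) q^-1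
  | +oo%E => ereal_inf [set M : \bar R |
       iint (fun y => (\1_(eball c r `&` [set z | (M < (`|f z|)%:E)%E]) y)%:E)
       = 0%E]
  | -oo%E => 0%E
  end.

End Defs.

(* Main.v *)
(** Let [V(rho)] be the integral of [h^2] over [B(0,rho)]. Integrating along rays and using the frequency bound
    on the Dirichlet integral gives [rho V'(rho) <= 2 (d + 4 N) V(rho)], so that the mean of [|h|] over [B(0,3r/2)]
    is at most [B^N] times its mean over [B(0,r)].

    By the mean value property, [h] is a superposition of translates of the bump [(1 - |y|^2)_+^k] with [k ~ 2 N].
    As a function of the angle of a rotation, such a translate is a power of the positive part of a trigonometric
    polynomial of degree one, with derivatives of order [j < k] of size [(C N)^j]. A difference scheme that is exact
    on polynomials of degree [< 2 N], with nodes in a small fixed interval and total weight [O(N)], therefore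
    computes the first two angular derivatives of [h] up to an error [eps^N], where [eps] is as small as we like:
    it absorbs [B^N]. So the angular derivatives of order one and two are bounded by [O(N)] and
    [O(N^2)] times averages of [|h|] over rotated points, plus the mean of [|h|].

    The radial derivative is then obtained by integrating, over the last [1/(2N)]-th part of each ray, a quantity whose
    derivative contains only [h] and second angular derivatives, because [h] is harmonic.

    Rotations, dilations, means and averages along rays are bounded on all [L^q] at once by Jensen's inequality. *)
Require Import Defs.
From HB Require Import structures.
From mathcomp Require Import all_boot all_order all_algebra.
From mathcomp Require Import all_classical all_reals all_analysis.
From mathcomp Require Import measurable_realfun lebesgue_integral_under.
From mathcomp Require Import ring lra zify.
Import Order.TTheory GRing.Theory Num.Theory.
Import numFieldNormedType.Exports.
Local Open Scope classical_set_scope.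
Local Open Scope ring_scope.
Set Implicit Arguments. Unset Strict Implicit. Unset Printing Implicit Defensive.

(** * Lebesgue measure on row vectors *)

(** Both norms are taken over the same ball, so no main term may move outwards. This is why
    derivatives are taken along rotations, which preserve [B(0,r)], and along the outer end of a ray
    towards the centre, where dilations by factors in [[1/2,1]] cost at most [2^d]. Only the error
    of the difference scheme sees [B(0,3r/2)]: there the mean of [|h|] may be exponentially larger
    in [N], but the error is exponentially small, at a rate set by the step of the scheme, which is
    a free constant. The scheme is justified on the kernel and not on [h], whose high derivatives
    are out of control: once [h] is written with one kernel of radius [r/2], the angle enters only
    through an explicit function. The exponent of the kernel must grow with [N] to provide
    smoothness of order [2N]; its mass is then only known to be at least a multiple of [(3/4)^(2N)],
    a loss that the step absorbs as well. The frequency serves only to control the growth of the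
    integral of [h^2]. [N] is replaced by an integer [m] with [N < m <= 2N]. *)

Fact rV_display : measure_display.
Proof. exact: default_measure_display. Qed.

Section measurable_rV.
Context {R : realType}.
Variable n : nat.

Let coors : 'I_n -> 'rV[R]_n -> R := fun i x => x ord0 i.

Let rV_set0 : g_sigma_preimage coors set0.
Proof. exact: sigma_algebra0. Qed.

Let rV_setC A : g_sigma_preimage coors A -> g_sigma_preimage coors (~` A).
Proof. exact: sigma_algebraC. Qed.

Let rV_bigcup (F : _^nat) : (forall i, g_sigma_preimage coors (F i)) ->
  g_sigma_preimage coors (\bigcup_i (F i)).
Proof. exact: sigma_algebra_bigcup. Qed.

(** Generating by the coordinates makes measurability of vector-valued maps a coordinatewise
    question; that open sets belong to this sigma-algebra is [open_measurable_rV]. *)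
HB.instance Definition _ := @isMeasurable.Build rV_display
  ('rV[R]_n) (g_sigma_preimage coors) rV_set0 rV_setC rV_bigcup.

End measurable_rV.

Section rV_measurability.
Context {R : realType}.

Lemma measurable_coord n (i : 'I_n) :
  measurable_fun [set: 'rV[R]_n] (fun x : 'rV[R]_n => x ord0 i).
Proof.
move=> _ Y mY; rewrite setTI; apply: sub_sigma_algebra => /=.
rewrite -bigcup_seq/=; exists i => /=; first by rewrite mem_index_enum.
by exists Y => //; rewrite setTI.
Qed.

Lemma measurable_rVP d (T : measurableType d) n (f : T -> 'rV[R]_n) :
  (forall i, measurable_fun [set: T] (fun x => f x ord0 i)) ->
  measurable_fun [set: T] f.
Proof.
pose co := fun i (x : 'rV[R]_n) => x ord0 i.
move=> mf.
have : g_sigma_preimage (fun i => co i \o f) `<=` measurable.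
  apply: smallest_sub; first exact: sigma_algebra_measurable.
  case: n => [|n] in f co mf *; first by rewrite big_ord0.
  rewrite -bigcup_mkord_ord; apply: bigcup_sub => i Ii.
  by move=> A [B mB <-]; exact: mf.
rewrite g_sigma_preimage_comp => sub _ A mA; apply: sub; by exists A.
Qed.

Lemma measurable_rV_box n (c : 'rV[R]_n) (e : R) : measurable (ball c e).
Proof.
have [e0|e0] := ltP 0 e; last first.
  rewrite (_ : ball c e = set0); first exact: measurable0.
  by apply/seteqP; split=> x //= [e0']; rewrite ltNge e0 in e0'.
rewrite (_ : ball c e = \bigcap_(i in [set: 'I_n]) [set x : 'rV[R]_n | ball (c ord0 i) e (x ord0 i)]).
  apply: fin_bigcap_measurable => // i _.
  rewrite -[X in measurable X]setTI; apply: measurable_coord => //.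
  by apply: open_measurable; exact: ball_open.
apply/seteqP; split=> x /=.
  by move=> [_ H] i _ /=; apply: H.
by move=> H; split => // i j; rewrite ord1; apply: H.
Qed.

(** An open set is the union of the countably many boxes with rational centre and radius [1/(k+1)]
    that it contains; [ball] is a sup-norm ball, hence a box. *)
Lemma open_measurable_rV n (U : set 'rV[R]_n) : open U -> measurable U.
Proof.
move=> oU.
pose e k : R := k.+1%:R^-1.
pose c (q : 'rV[rat]_n) : 'rV[R]_n := \row_i ratr (q ord0 i).
pose F (qk : 'rV[rat]_n * nat) : set 'rV[R]_n :=
  if pselect (ball (c qk.1) (e qk.2) `<=` U) then ball (c qk.1) (e qk.2) else set0.
rewrite (_ : U = \bigcup_qk F qk).
  apply: countable_bigcupT_measurable; first exact: countableP.
  move=> qk; rewrite /F; case: pselect => ?; [exact: measurable_rV_box|exact: measurable0].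
apply/seteqP; split=> x; last first.
  by move=> [[q k] _]; rewrite /F; case: pselect => // H /H.
move=> Ux.
have /nbhs_ballP[eps eps0 epsU] : nbhs x U by exact: open_nbhs_nbhs.
have [k ke] : exists k, e k < eps / 2.
  have : 0 < eps / 2 by rewrite divr_gt0.
  by move/(cvgr0_norm_lt _ (@cvg_harmonic R)) => [k _ /(_ k (leqnn k))]; rewrite /e /= ger0_norm ?invr_ge0 //; exists k.
have ek0 : 0 < e k by rewrite invr_gt0.
have /choice[q Hq] : forall i : 'I_n, exists q : rat, `|x ord0 i - ratr q| < e k.
  move=> i; have [q] := @rat_in_itvoo R (x ord0 i - e k) (x ord0 i + e k) ltac:(lra).
  rewrite in_itv/= => /andP[a b]; exists q; rewrite ltr_norml; lra.
exists ((\row_i q i), k) => //; rewrite /F /=; case: pselect.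
  by move=> ?; split=> // i j; rewrite ord1 !mxE /ball/= distrC.
case=> y [_ Hy]; apply: epsU; split=> // i j; rewrite ord1.
have := Hq j; have := Hy ord0 j; rewrite !mxE /ball/= => H1 H2.
have -> : x ord0 j - y ord0 j = (x ord0 j - ratr (q j)) + (ratr (q j) - y ord0 j) by ring.
by apply: le_lt_trans (ler_normD _ _) _; lra.
Qed.

Lemma continuous_measurable_rV n (D : set 'rV[R]_n) (f : 'rV[R]_n -> R) :
  open D -> (forall x, D x -> {for x, continuous f}) -> measurable_fun D f.
Proof.
move=> oD cf; apply: (measurability _ (RGenOpens.measurableE R)).
move=> _ [_ [a [b ->] <-]]; apply: open_measurable_rV.
rewrite openE => x /= [Dx fx].
have nx : nbhs (f x) `]a, b[%classic by apply: open_nbhs_nbhs; split => //; exact: interval_open.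
rewrite /interior; apply: filterI; first exact: open_nbhs_nbhs.
exact: cf.
Qed.

End rV_measurability.

(** * Sigma-finite measures by transport and product *)

Section sigma_finite_pack.
Context d (T : measurableType d) (R : realType) (m : {measure set T -> \bar R}).
Hypothesis sf : sigma_finite setT m.
(** The measures below come with a separate proof of sigma-finiteness; this copy carries the proof
    as a structure, the form in which Tonelli takes it. *)
Definition sigma_finite_pack (_ : sigma_finite setT m) : set T -> \bar R := m.
HB.instance Definition _ := Measure.copy (sigma_finite_pack sf) m.
HB.instance Definition _ := @Measure_isSigmaFinite.Build d T R (sigma_finite_pack sf) sf.
End sigma_finite_pack.

Lemma exists_sigma_finite_measure d (T : measurableType d) (R : realType) (nu : set T -> \bar R) :
  (exists m : {measure set T -> \bar R}, (m : set T -> \bar R) = nu) -> sigma_finite setT nu ->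
  exists m : {sigma_finite_measure set T -> \bar R}, (m : set T -> \bar R) = nu.
Proof. by move=> [m <-] sf; exists (sigma_finite_pack sf). Qed.

Section push.
Context d d' (T1 : measurableType d) (T2 : measurableType d') (R : realType).
Variables (m : {sigma_finite_measure set T1 -> \bar R}) (f : T1 -> T2) (g : T2 -> T1).
Hypothesis mf : measurable_fun [set: T1] f.
Hypothesis mg : measurable_fun [set: T2] g.
Hypothesis fK : cancel f g.
Lemma pushforward_sigma_finite : exists nu : {sigma_finite_measure set T2 -> \bar R}, (nu : set T2 -> \bar R) = pushforward m f.
Proof.
apply: exists_sigma_finite_measure.
  pose mm : measure _ _ := HB.pack (pushforward m f).
  by exists (mm mf).
have [F FT mF] := sigma_finiteT m.
exists (fun n => g @^-1` F n).
  by rewrite -preimage_bigcup -FT.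
move=> n; have [mFn Fn] := mF n; split; first by rewrite -[X in measurable X]setTI; exact: mg.
rewrite /pushforward (_ : f @^-1` (g @^-1` F n) = F n) //.
by apply/seteqP; split=> x /=; rewrite fK.
Qed.

End push.

Lemma product_sigma_finite d d' (T1 : measurableType d) (T2 : measurableType d') (R : realType)
  (m1 : {sigma_finite_measure set T1 -> \bar R}) (m2 : {sigma_finite_measure set T2 -> \bar R}) :
  exists m : {sigma_finite_measure set (T1 * T2)%type -> \bar R},
    (m : set _ -> \bar R) = (m1 \x m2)%E.
Proof.
apply: exists_sigma_finite_measure.
  pose mm : measure _ _ := HB.pack (product_measure1 m1 m2).
  by exists mm.
have /sigma_finiteP[F [TF ndF Ffin]] := sigma_finiteT m1.
have /sigma_finiteP[G [TG ndG Gfin]] := sigma_finiteT m2.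
(* The diagonal rectangles cover the product because both sequences are nondecreasing. *)
exists (fun n => F n `*` G n).
  apply/seteqP; split=> // -[x y] _.
  have : setT x by []. rewrite TF => -[n _ Fx].
  have : setT y by []. rewrite TG => -[k _ Gy].
  exists (maxn n k) => //; split => /=.
    by have /subsetPset := ndF _ _ (leq_maxl n k); exact.
  by have /subsetPset := ndG _ _ (leq_maxr n k); exact.
move=> n; have [mF Fn] := Ffin n; have [mG Gn] := Gfin n.
split; first exact: measurableX.
by rewrite product_measure1E // lte_mul_pinfty // ge0_fin_numE.
Qed.

(** * The measure behind the iterated integral *)

Section lam.
Context {R : realType}.
Definition rcons0 n (xv : R * 'rV[R]_n) : 'rV[R]_n.+1 := row_mx (\row_(_ < 1) xv.1) xv.2.
Definition runcons n (v : 'rV[R]_n.+1) : R * 'rV[R]_n := (v ord0 ord0, \row_i v ord0 (lift ord0 i)).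

Lemma rcons00 n xv : (@rcons0 n xv) ord0 ord0 = xv.1.
Proof.
have := row_mxEl (\row_(_ < 1) xv.1) xv.2 ord0 ord0; rewrite mxE => <-.
by congr (fun_of_matrix _ _ _); exact: val_inj.
Qed.

Lemma rcons0l n xv i : (@rcons0 n xv) ord0 (lift ord0 i) = xv.2 ord0 i.
Proof.
have <- := row_mxEr (\row_(_ < 1) xv.1) xv.2 ord0 i.
by congr (fun_of_matrix _ _ _); exact: val_inj.
Qed.

Lemma rcons0K n : cancel (@rcons0 n) (@runcons n).
Proof.
move=> [x v]; rewrite /runcons rcons00; congr pair.
by apply/rowP => i; rewrite mxE rcons0l.
Qed.

Lemma measurable_rcons0 n : measurable_fun setT (@rcons0 n).
Proof.
apply: measurable_rVP => i; case: (unliftP ord0 i) => [j|] ->.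
  under eq_fun do rewrite rcons0l.
  apply: (measurableT_comp (measurable_coord j)); exact: measurable_snd.
under eq_fun do rewrite rcons00; exact: measurable_fst.
Qed.

Lemma measurable_runcons n : measurable_fun setT (@runcons n).
Proof.
apply/measurable_fun_pairP; split; first exact: measurable_coord.
apply: measurable_rVP => i /=; under eq_fun do rewrite mxE; exact: measurable_coord.
Qed.

(** By induction: a point mass in dimension zero, then the image of the product with Lebesgue
    measure under [rcons0]; Tonelli identifies its integral with the iterated one. Convergence
    theorems and Fubini thereby become available for [iint]. *)
Lemma iint_measure n : exists lam : {sigma_finite_measure set 'rV[R]_n -> \bar R},
  forall f : 'rV[R]_n -> \bar R, measurable_fun setT f -> (forall x, (0 <= f x)%E) ->
   iint f = (\int[lam]_x f x)%E.
Proof.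
elim: n => [|n [lam IH]].
  exists (dirac (0 : 'rV[R]_0)) => f mf f0.
  by rewrite integral_dirac //= diracT mul1e.
have [m mE] := product_sigma_finite (@lebesgue_measure R) lam.
have [nu nuE] := pushforward_sigma_finite m (@measurable_rcons0 n) (@measurable_runcons n) (@rcons0K n).
have mI g : (\int[m]_x g x = \int[(@lebesgue_measure R \x lam)%E]_x g x)%E by rewrite -mE.
exists nu => f mf f0; rewrite nuE ge0_integral_pushforward //; last exact: measurable_rcons0.
rewrite preimage_setT mI fubini_tonelli1; first last.
  - by move=> x; exact: f0.
- by apply: (measurableT_comp mf); exact: measurable_rcons0.
transitivity (\int[@lebesgue_measure R]_x iint (fun v => f (rcons0 (x, v))))%E; first by [].
apply: eq_integral => x _; rewrite IH; [by []| |by move=> v; exact: f0].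
apply: (measurableT_comp mf); apply: (measurableT_comp (@measurable_rcons0 n)).
exact: measurable_pair1.
Qed.

End lam.

Section lebesgue1.
Context {R : realType}.
Notation mu := (@lebesgue_measure R).

(** The image of Lebesgue measure under the affine map, multiplied by [a], agrees with Lebesgue
    measure on half-open intervals, hence everywhere by uniqueness. *)
Lemma ge0_integral_affine (a : {posnum R}) (b : R) (f : R -> \bar R) : measurable_fun setT f ->
  (forall x, 0 <= f x)%E -> (a%:num%:E * \int[mu]_x f (a%:num * x + b)%R = \int[mu]_x f x)%E.
Proof.
move=> mf f0.
pose phi : measurableTypeR R -> measurableTypeR R := fun x : R => a%:num * x + b.
have mphi : measurable_fun [set: R] phi by apply: measurable_funD => //; exact: measurable_funM.
have mE A : measurable A -> mscale (NngNum (ltW [gt0 of a%:num])) (pushforward mu phi) A = mu A.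
  move=> mA; apply/esym/lebesgue_measure_unique => //= _ [[u v]] _ <-.
  rewrite /mscale /=.
  have -> : pushforward mu phi `]u, v]%classic = mu `](u - b) / a%:num, (v - b) / a%:num]%classic.
    rewrite /pushforward; congr (mu _).
    apply/seteqP; split=> x /=; rewrite !in_itv /= /phi => /andP[h1 h2]; apply/andP; split.
    - by rewrite ltr_pdivrMr // mulrC ltrBlDr.
    - by rewrite ler_pdivlMr // mulrC lerBrDr.
    - by rewrite ltr_pdivrMr // mulrC ltrBlDr in h1.
    - by rewrite ler_pdivlMr // mulrC lerBrDr in h2.
  rewrite !lebesgue_measure_itv/= !lte_fin ltr_pM2r ?invr_gt0 // ltrD2r.
  case: ifPn => _; last by rewrite mule0.
  by rewrite -!EFinB -EFinM; congr EFin; field.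
rewrite -[RHS](eq_measure_integral _ (fun A mA _ => mE mphi A mA)).
by rewrite ge0_integral_mscale //= ge0_integral_pushforward.
Qed.

End lebesgue1.

Section lam.
Context {R : realType}.
Notation mu := (@lebesgue_measure R).
(** Apart from its sigma-finiteness, this measure is known only through [iintE]; scaling,
    translation and volumes are all deduced from iterated integration. *)
Definition lam n : {sigma_finite_measure set 'rV[R]_n -> \bar R} := sval (cid (iint_measure n)).

Lemma iintE n (f : 'rV[R]_n -> \bar R) : measurable_fun setT f -> (forall x, (0 <= f x)%E) ->
   iint f = (\int[lam n]_x f x)%E.
Proof. by rewrite /lam; case: cid => l /=; exact. Qed.

Lemma measurable_slice n (f : 'rV[R]_n.+1 -> \bar R) (x : R) : measurable_fun setT f ->
  measurable_fun setT (fun v : 'rV[R]_n => f (rcons0 (x, v))).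
Proof.
move=> mf; apply: (measurableT_comp mf); apply: (measurableT_comp (@measurable_rcons0 R n)).
exact: measurable_pair1.
Qed.

Lemma ge0_lamS n (f : 'rV[R]_n.+1 -> \bar R) : measurable_fun setT f -> (forall x, (0 <= f x)%E) ->
  (\int[lam n.+1]_z f z = \int[mu]_x \int[lam n]_v f (rcons0 (x, v)))%E.
Proof.
move=> mf f0; rewrite -iintE //.
transitivity (\int[mu]_x iint (fun v => f (rcons0 (x, v))))%E; first by [].
apply: eq_integral => x _; rewrite iintE //; exact: measurable_slice.
Qed.

Lemma measurable_lamS n (f : 'rV[R]_n.+1 -> \bar R) : measurable_fun setT f -> (forall x, (0 <= f x)%E) ->
  measurable_fun setT (fun x : R => \int[lam n]_v f (rcons0 (x, v)))%E.
Proof.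
move=> mf f0.
apply: (@measurable_fun_fubini_tonelli_F _ _ _ _ _ (lam n) (f \o @rcons0 R n)) => [|x]; last exact: f0.
by apply: (measurableT_comp mf); exact: measurable_rcons0.
Qed.

Lemma measurable_rV_affine n (a : R) (b : 'rV[R]_n) : measurable_fun setT (fun x : 'rV[R]_n => a *: x + b).
Proof.
apply: measurable_rVP => i; under eq_fun do rewrite !mxE.
apply: measurable_funD => //; apply: measurable_funM => //; exact: measurable_coord.
Qed.

Lemma ge0_lam_affine n (a : {posnum R}) (b : 'rV[R]_n) (f : 'rV[R]_n -> \bar R) :
  measurable_fun setT f -> (forall x, (0 <= f x)%E) ->
  ((a%:num ^+ n)%:E * \int[lam n]_x f (a%:num *: x + b)%R = \int[lam n]_x f x)%E.
Proof.
elim: n b f => [|n IH] b f mf f0.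
  rewrite expr0 mul1e; apply: eq_integral => x _; congr f; by apply/rowP => -[].
have ma : measurable_fun setT (fun x : 'rV[R]_n.+1 => f (a%:num *: x + b)%R).
  by apply: (measurableT_comp mf); exact: measurable_rV_affine.
rewrite !ge0_lamS //.
pose b' : 'rV[R]_n := \row_i b ord0 (lift ord0 i).
have E x v : f (a%:num *: rcons0 (x, v) + b)%R = f (rcons0 (a%:num * x + b ord0 ord0, a%:num *: v + b')).
  congr f; apply/rowP => i; rewrite mxE [X in X + _]mxE; case: (unliftP ord0 i) => [j|] ->.
    by rewrite !rcons0l !mxE.
  by rewrite !rcons00.
rewrite -[RHS](ge0_integral_affine a (b ord0 ord0)); last 2 first.
- exact: measurable_lamS.
- by move=> x; apply: integral_ge0 => *; exact: f0.
rewrite exprS EFinM -muleA; congr mule.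
rewrite -ge0_integralZl //; last 2 first.
- by apply: (@measurable_lamS n (fun z => f (a%:num *: z + b))) => // x; exact: f0.
- by move=> x _; apply: integral_ge0 => *; exact: f0.
apply: eq_integral => x _.
under eq_integral do rewrite E.
by rewrite (IH b' (fun v => f (rcons0 (a%:num * x + b ord0 ord0, v)))) //; exact: measurable_slice.
Qed.

Lemma ge0_lam_shift n (b : 'rV[R]_n) (f : 'rV[R]_n -> \bar R) :
  measurable_fun setT f -> (forall x, (0 <= f x)%E) ->
  (\int[lam n]_x f (x + b)%R = \int[lam n]_x f x)%E.
Proof.
move=> mf f0; rewrite -[RHS](ge0_lam_affine 1%:pos b) //= expr1n mul1e.
by under [in RHS]eq_integral do rewrite scale1r.
Qed.

(** Cubes have a computable measure and bracket the unit ball in [lam_eball1]. *)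
Definition cube n (e : R) : set 'rV[R]_n := [set x | forall i, `|x ord0 i| < e].

Lemma measurable_cube n e : measurable (@cube n e).
Proof.
rewrite (_ : cube e = \bigcap_(i in [set: 'I_n]) [set x : 'rV[R]_n | `]-e, e[%classic (x ord0 i)]).
  apply: fin_bigcap_measurable => // i _.
  by rewrite -[X in measurable X]setTI; apply: measurable_coord.
apply/seteqP; split=> x /=.
  by move=> H i _ /=; rewrite in_itv /= -ltr_norml.
by move=> H i; have := H i I; rewrite /= in_itv /= -ltr_norml.
Qed.

Lemma lam_cube n (e : R) : 0 < e -> lam n (cube e) = ((2 * e) ^+ n)%:E.
Proof.
move=> e0; rewrite -[cube e]setIT -integral_indic //; last exact: measurable_cube.
elim: n => [|n IH].
  rewrite -iintE //=; last first.
    by apply/measurable_EFinP; apply: measurable_indic; exact: measurable_cube.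
  by rewrite indicE mem_set //; case.
rewrite ge0_lamS //; last first.
  by apply/measurable_EFinP; apply: measurable_indic; exact: measurable_cube.
transitivity (\int[mu]_x ((\1_(`]-e, e[%classic : set R) x)%:E * ((2 * e) ^+ n)%:E))%E.
  apply: eq_integral => x _; rewrite -IH.
  rewrite -ge0_integralZl //; last first.
    by apply/measurable_EFinP; apply: measurable_indic; exact: measurable_cube.
  apply: eq_integral => v _; rewrite -EFinM; congr EFin.
  rewrite !indicE -natrM mulnb; congr (_%:R); congr nat_of_bool.
  apply/idP/andP.
    rewrite inE => H; split; rewrite inE /=.
      by have := H ord0; rewrite rcons00 in_itv /= -ltr_norml.
    by move=> i; have := H (lift ord0 i); rewrite rcons0l.
  rewrite !inE /= in_itv /= -ltr_norml => -[H1 H2] i.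
  by case: (unliftP ord0 i) => [j|] ->; rewrite ?rcons00 ?rcons0l.
rewrite ge0_integralZr //; last 2 first.
- by apply/measurable_EFinP; exact: measurable_indic.
- by rewrite lee_fin exprn_ge0 // mulr_ge0 // ltW.
rewrite integral_indic // setIT.
have := @lebesgue_measure_itv R `]-e, e[; rewrite /= => ->.
rewrite lte_fin (_ : - e < e); last by lra.
by rewrite -EFinB -EFinM exprS; congr EFin; congr (_ * _); ring.
Qed.

End lam.

(** * Euclidean norm, volume of balls, invariance under isometries *)

Section enorm.
Context {R : realType}.
Implicit Types (n : nat).

Lemma enorm_ge0 n (x : 'rV[R]_n) : 0 <= enorm x.
Proof. exact: sqrtr_ge0. Qed.

Lemma sqr_enorm n (x : 'rV[R]_n) : enorm x ^+ 2 = \sum_i x ord0 i ^+ 2.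
Proof. by rewrite sqr_sqrtr // sumr_ge0 // => i _; exact: sqr_ge0. Qed.

Lemma enormZ n (a : R) (x : 'rV[R]_n) : enorm (a *: x) = `|a| * enorm x.
Proof.
apply/eqP; rewrite -(eqrXn2 (ltn0Sn 1)) ?mulr_ge0 ?enorm_ge0 //; apply/eqP.
rewrite exprMn !sqr_enorm real_normK ?num_real // mulr_sumr.
by apply: eq_bigr => i _; rewrite mxE exprMn.
Qed.

Lemma enormN n (x : 'rV[R]_n) : enorm (- x) = enorm x.
Proof. by rewrite -scaleN1r enormZ normrN1 mul1r. Qed.

Lemma enorm0 n : enorm (0 : 'rV[R]_n) = 0.
Proof. by rewrite -(scale0r 0) enormZ normr0 mul0r. Qed.

Definition edot n (x y : 'rV[R]_n) : R := \sum_i x ord0 i * y ord0 i.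

Lemma enorm_sqrD n (x y : 'rV[R]_n) : enorm (x + y) ^+ 2 = enorm x ^+ 2 + 2 * edot x y + enorm y ^+ 2.
Proof.
rewrite !sqr_enorm /edot mulr_sumr -!big_split /=; apply: eq_bigr => i _.
rewrite mxE; ring.
Qed.

Lemma edotNr n (x y : 'rV[R]_n) : edot x (- y) = - edot x y.
Proof. by rewrite /edot -sumrN; apply: eq_bigr => i _; rewrite mxE mulrN. Qed.

Lemma edotZr n (a : R) (x y : 'rV[R]_n) : edot x (a *: y) = a * edot x y.
Proof. by rewrite /edot mulr_sumr; apply: eq_bigr => i _; rewrite mxE; ring. Qed.

Lemma enorm_sqrB n (x y : 'rV[R]_n) : enorm (x - y) ^+ 2 = enorm x ^+ 2 - 2 * edot x y + enorm y ^+ 2.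
Proof. by rewrite enorm_sqrD edotNr enormN mulrN. Qed.

Lemma enorm_coord n (x : 'rV[R]_n) i : `|x ord0 i| <= enorm x.
Proof.
rewrite -(ler_pXn2r (ltn0Sn 1)) ?nnegrE ?enorm_ge0 // real_normK ?num_real // sqr_enorm.
rewrite (bigD1 i) //= lerDl sumr_ge0 // => j _; exact: sqr_ge0.
Qed.

Lemma cauchy_schwarz n (x y : 'rV[R]_n) : `|edot x y| <= enorm x * enorm y.
Proof.
have H (a b : R) : 0 <= a ^+ 2 * enorm x ^+ 2 + 2 * (a * b) * edot x y + b ^+ 2 * enorm y ^+ 2.
  have := sqr_ge0 (enorm (a *: x + b *: y)).
  rewrite enorm_sqrD !enormZ !exprMn !real_normK ?num_real // edotZr.
  suff -> : edot (a *: x) y = a * edot x y by rewrite !mulrA (mulrAC _ b a).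
  by rewrite /edot mulr_sumr; apply: eq_bigr => i _; rewrite mxE; ring.
have x0 := enorm_ge0 x; have y0 := enorm_ge0 y.
have [xz|xp] := eqVneq (enorm x) 0.
  rewrite xz mul0r normr_le0 /edot big1 // => i _.
  by have := enorm_coord x i; rewrite xz normr_le0 => /eqP ->; rewrite mul0r.
rewrite -(ler_pXn2r (ltn0Sn 1)) ?nnegrE ?mulr_ge0 //.
rewrite real_normK ?num_real // exprMn.
have xp2 : 0 < enorm x ^+ 2 by rewrite exprn_gt0 // lt_def xp.
(* The minimising direction of the nonnegative form [|a x + b y|^2]. *)
have := H (- edot x y) (enorm x ^+ 2).
have -> : (- edot x y) ^+ 2 * enorm x ^+ 2 + 2 * (- edot x y * enorm x ^+ 2) * edot x y + (enorm x ^+ 2) ^+ 2 * enorm y ^+ 2 = enorm x ^+ 2 * (enorm x ^+ 2 * enorm y ^+ 2 - edot x y ^+ 2) by ring.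
by rewrite pmulr_rge0 // subr_ge0.
Qed.

Lemma enormD n (x y : 'rV[R]_n) : enorm (x + y) <= enorm x + enorm y.
Proof.
rewrite -(ler_pXn2r (ltn0Sn 1)) ?nnegrE ?addr_ge0 ?enorm_ge0 //.
rewrite enorm_sqrD; have := cauchy_schwarz x y; have := ler_norm (edot x y); nra.
Qed.

Lemma enorm_le_sum n (x : 'rV[R]_n) : enorm x <= \sum_i `|x ord0 i|.
Proof.
have s0 : 0 <= \sum_i `|x ord0 i| by apply: sumr_ge0.
rewrite -(ler_pXn2r (ltn0Sn 1)) ?nnegrE ?enorm_ge0 // sqr_enorm expr2 mulr_suml.
apply: ler_sum => i _; rewrite -real_normK ?num_real // expr2 ler_wpM2l //.
by rewrite (bigD1 i) //= lerDl sumr_ge0.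
Qed.

Lemma continuous_sum (T : topologicalType) (I : Type) (r : seq I) (P : pred I) (F : I -> T -> R) (x : T) :
  (forall i, {for x, continuous (F i)}) -> {for x, continuous (fun y => \sum_(i <- r | P i) F i y)}.
Proof.
move=> cF; elim: r => [|i r IH].
  rewrite (_ : (fun y => _) = cst 0); first exact: cst_continuous.
  by apply/funext => y; rewrite big_nil.
rewrite (_ : (fun y => _) = fun y => (if P i then F i y else 0) + \sum_(j <- r | P j) F j y); last first.
  by apply/funext => y; rewrite big_cons; case: (P i); rewrite ?add0r.
apply: continuousD => //; case: (P i); [exact: cF|exact: cst_continuous].
Qed.

Lemma continuous_enorm n : continuous (@enorm R n).
Proof.
move=> x; apply: (@continuous_comp _ _ _ (fun x : 'rV[R]_n => \sum_i x ord0 i ^+ 2) Num.sqrt); last exact: sqrt_continuous.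
apply: continuous_sum => i.
apply: (@continuous_comp _ _ _ (fun x : 'rV[R]_n => x ord0 i) (fun t : R => t ^+ 2)).
  exact: coord_continuous.
exact: exprn_continuous.
Qed.

Lemma open_eball n (c : 'rV[R]_n) r : open (eball c r).
Proof.
rewrite (_ : eball c r = (fun x => enorm (x - c)) @^-1` [set t | t < r]) //.
apply: open_comp; last exact: open_lt.
move=> x _; apply: (@continuous_comp _ _ _ (fun x : 'rV[R]_n => x - c)); last exact: continuous_enorm.
by apply: continuousB => //; exact: cst_continuous.
Qed.

Lemma measurable_eball n (c : 'rV[R]_n) r : measurable (eball c r).
Proof. by apply: open_measurable_rV; exact: open_eball. Qed.

Lemma measurable_enorm n : measurable_fun setT (@enorm R n).
Proof. by apply: continuous_measurable_rV => [|x _]; [exact: openT|exact: continuous_enorm]. Qed.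

Definition vball n : R := fine (lam n (eball (0 : 'rV[R]_n) 1)).

Lemma lam_eball1 n : lam n (eball (0 : 'rV[R]_n) 1) = (vball n)%:E /\ 0 < vball n.
Proof.
have sub1 : eball 0 1 `<=` @cube R n 1.
  by move=> x; rewrite /eball /= subr0 => H i; exact: le_lt_trans (enorm_coord x i) H.
have sub2 : @cube R n (n.+1%:R^-1) `<=` eball 0 1.
  move=> x H; rewrite /eball /= subr0; apply: (le_lt_trans (enorm_le_sum x)).
  apply: (@le_lt_trans _ _ (\sum_(i < n) (n.+1%:R^-1 : R))).
    by apply: ler_sum => i _; exact: ltW.
  by rewrite sumr_const card_ord -[_ *+ n]mulr_natl ltr_pdivrMr // mul1r ltr_nat.
have le1 : (lam n (eball (0 : 'rV[R]_n) 1) <= lam n (@cube R n 1))%E.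
  by apply: le_measure => //; rewrite inE; [exact: measurable_eball|exact: measurable_cube].
have le2 : (lam n (@cube R n (n.+1%:R^-1)) <= lam n (eball (0 : 'rV[R]_n) 1))%E.
  by apply: le_measure => //; rewrite inE; [exact: measurable_cube|exact: measurable_eball].
have fin : lam n (eball (0 : 'rV[R]_n) 1) \is a fin_num.
  by rewrite ge0_fin_numE // (le_lt_trans le1) // lam_cube // ltry.
split; first by rewrite /vball fineK.
rewrite -lte_fin /vball fineK //; apply: lt_le_trans le2.
by rewrite lam_cube ?invr_gt0 // lte_fin exprn_gt0 // mulr_gt0 // invr_gt0.
Qed.

Lemma vball_gt0 n : 0 < vball n. Proof. by have [] := lam_eball1 n. Qed.

Lemma vballE_ge0 n : (0 <= (vball n)%:E)%E. Proof. by rewrite lee_fin ltW // vball_gt0. Qed.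

Global Opaque vball.

Lemma lam_eball n (c : 'rV[R]_n) r : 0 < r -> lam n (eball c r) = (r ^+ n * vball n)%:E.
Proof.
move=> r0; rewrite EFinM -(lam_eball1 n).1.
rewrite -[eball 0 1]setIT -[eball c r]setIT -!integral_indic //; try exact: measurable_eball.
rewrite -(ge0_lam_affine (PosNum r0) c) //; last first.
  by apply/measurable_EFinP; apply: measurable_indic; exact: measurable_eball.
congr mule; apply: eq_integral => x _; congr EFin; rewrite !indicE; congr (_%:R); congr nat_of_bool.
apply/idP/idP; rewrite !inE /eball /= addrK subr0 enormZ gtr0_norm // => H.
  by rewrite -(ltr_pM2l r0) mulr1.
by rewrite -[ltRHS]mulr1 ltr_pM2l.
Qed.

Lemma measurable_rV_sub n d (T : measurableType d) (f g : T -> 'rV[R]_n) :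
  measurable_fun setT f -> measurable_fun setT g -> measurable_fun setT (fun z => f z - g z).
Proof.
move=> mf mg; apply: measurable_rVP => i; under eq_fun do rewrite !mxE.
by apply: measurable_funB; apply: (measurableT_comp (measurable_coord i)).
Qed.

Lemma measurable_rV_add n d (T : measurableType d) (f g : T -> 'rV[R]_n) :
  measurable_fun setT f -> measurable_fun setT g -> measurable_fun setT (fun z => f z + g z).
Proof.
move=> mf mg; apply: measurable_rVP => i; under eq_fun do rewrite !mxE.
by apply: measurable_funD; apply: (measurableT_comp (measurable_coord i)).
Qed.

Lemma measurable_rV_shift n (b : 'rV[R]_n) : measurable_fun setT (fun x : 'rV[R]_n => x + b).
Proof.
have := measurable_rV_affine 1 b; rewrite (_ : (fun x => _) = (fun x => x + b)) //.
by apply/funext => x; rewrite scale1r.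
Qed.

Lemma lamZl n (k : \bar R) (f : 'rV[R]_n -> \bar R) : measurable_fun setT f ->
  (forall x, 0 <= f x)%E -> (0 <= k)%E -> (\int[lam n]_x (k * f x) = k * \int[lam n]_x f x)%E.
Proof. by move=> mf f0 k0; exact: (@ge0_integralZl _ _ _ (lam n) setT measurableT f mf k (fun x _ => f0 x) k0). Qed.

Lemma lamZr n (k : \bar R) (f : 'rV[R]_n -> \bar R) : measurable_fun setT f ->
  (forall x, 0 <= f x)%E -> (0 <= k)%E -> (\int[lam n]_x (f x * k) = \int[lam n]_x f x * k)%E.
Proof.
move=> mf f0 k0; rewrite muleC -(lamZl mf f0 k0).
by apply: eq_integral => x _; rewrite muleC.
Qed.

(* Both sides of the Fubini identity below are [lam (eball 0 1)] times an integral of [g], because an isometry maps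
   the unit ball to itself: this is the uniqueness of Haar measure, and no determinant is needed. *)
Lemma ge0_lam_isometry n (T S : 'rV[R]_n -> 'rV[R]_n) (g : 'rV[R]_n -> \bar R) :
  {morph T : x y / x + y} -> cancel T S -> cancel S T -> (forall x, enorm (T x) = enorm x) ->
  measurable_fun setT T -> measurable_fun setT g -> (forall x, (0 <= g x)%E) ->
  (\int[lam n]_x g (T x) = \int[lam n]_x g x)%E.
Proof.
move=> TD TK SK TN mT mg g0.
have TB x y : T (x - y) = T x - T y.
  by apply/eqP; rewrite eq_sym subr_eq -TD subrK.
pose B : set 'rV[R]_n := eball 0 1.
have mB : measurable_fun setT (fun x => (\1_B x)%:E : \bar R).
  by apply/measurable_EFinP; apply: measurable_indic; exact: measurable_eball.
have B0 x : (0 <= (\1_B x)%:E :> \bar R)%E by rewrite lee_fin.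
have IB : (\int[lam n]_x (\1_B x)%:E = (vball n)%:E)%E.
  by rewrite integral_indic ?setIT /B //; [exact: (lam_eball1 n).1|exact: measurable_eball].
have mgT : measurable_fun setT (fun x => g (T x)) by exact: measurableT_comp mg mT.
have cancelv (a b : \bar R) : ((vball n)%:E * a = (vball n)%:E * b)%E -> a = b.
  move=> H; have : ((vball n)^-1%:E * ((vball n)%:E * a) = (vball n)^-1%:E * ((vball n)%:E * b))%E by rewrite H.
  by rewrite !muleA -EFinM mulVf ?gt_eqF ?vball_gt0 // !mul1e.
apply: cancelv.
pose F (z : 'rV[R]_n * 'rV[R]_n) := ((\1_B z.1)%:E * g (z.1 + T z.2)%R)%E.
have mF : measurable_fun setT F.
  apply: emeasurable_funM; first exact: (measurableT_comp mB).
  apply: (measurableT_comp mg); apply: measurable_rV_add => //.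
  exact: (measurableT_comp mT).
have F0 z : (0 <= F z)%E by rewrite /F mule_ge0 // lee_fin.
have FT := @fubini_tonelli _ _ _ _ _ (lam n) (lam n) F mF F0.
transitivity (\int[lam n]_x \int[lam n]_y F (x, y))%E.
  have I0 : (0 <= \int[lam n]_x g (T x))%E by apply: integral_ge0 => *; exact: g0.
  transitivity (\int[lam n]_x ((\1_B x)%:E * \int[lam n]_x g (T x)))%E.
    by rewrite (lamZr mB _ I0) ?IB // => x; rewrite lee_fin.
  apply: eq_integral => x _; rewrite /F /=.
  transitivity ((\1_B x)%:E * \int[lam n]_y g (x + T y)%R)%E; last first.
    symmetry; apply: (lamZl (f := fun y => g (x + T y))).
    - by apply: (measurableT_comp mg); apply: measurable_rV_add.
    - by move=> y; exact: g0.
    - by rewrite lee_fin.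
  congr mule; rewrite -(ge0_lam_shift (S x) mgT (fun y => g0 (T y))).
  by apply: eq_integral => y _; rewrite TD SK addrC.
transitivity (\int[lam n]_y \int[lam n]_x F (x, y))%E; first exact: FT.
transitivity (\int[lam n]_y \int[lam n]_x ((\1_B (x - T y)%R)%:E * g x))%E.
  apply: eq_integral => y _.
  rewrite -(@ge0_lam_shift R n (T y) (fun x => ((\1_B (x - T y)%R)%:E * g x)%E)).
  - by apply: eq_integral => x _; rewrite /F /= addrK.
  - apply: emeasurable_funM; last exact: mg.
    exact: (measurableT_comp mB (measurable_rV_shift (- T y))).
  - by move=> x; rewrite mule_ge0 // lee_fin.
pose G (z : 'rV[R]_n * 'rV[R]_n) := ((\1_B (z.2 - T z.1)%R)%:E * g z.2)%E.
have mG : measurable_fun setT G.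
  apply: emeasurable_funM; last exact: (measurableT_comp mg measurable_snd).
  apply: (measurableT_comp mB).
  exact: (measurable_rV_sub measurable_snd (measurableT_comp mT measurable_fst)).
have G0 z : (0 <= G z)%E by rewrite /G mule_ge0 // lee_fin.
transitivity (\int[lam n]_y \int[lam n]_x G (x, y))%E.
  exact: (@fubini_tonelli _ _ _ _ _ (lam n) (lam n) G mG G0).
transitivity (\int[lam n]_x ((vball n)%:E * g x))%E; last first.
  exact: (lamZl mg g0 (vballE_ge0 n)).
apply: eq_integral => x _; rewrite /G /=.
transitivity ((\int[lam n]_y (\1_B (x - T y)%R)%:E) * g x)%E.
  apply: (lamZr (f := fun y => (\1_B (x - T y))%:E)).
  - apply: (measurableT_comp mB).
    exact: (measurable_rV_sub (measurable_cst x) mT).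
  - by move=> y; rewrite lee_fin.
  - exact: g0.
congr mule; rewrite -IB -(ge0_lam_shift (- S x) mB B0).
apply: eq_integral => y _; congr EFin; rewrite !indicE; congr (_%:R); congr nat_of_bool.
rewrite -(SK x) /B; apply/idP/idP; rewrite !inE /eball /= !subr0 -TB TN TK -(opprB (S x)) enormN //.
Qed.

End enorm.

(** * Difference schemes for trigonometric kernels *)

Section numdiff.
Context {R : realType}.

(** An [m]-th finite difference kills polynomials of degree below [m]. By Pascal's rule the
    difference of order [m+1] of [k^j] is the one of order [m] of [k^j - (k+1)^j], whose degree is
    below [j]. *)
Lemma alt_binomial_pow (m j : nat) : (j < m)%N ->
  \sum_(k < m.+1) (-1) ^+ k * 'C(m, k)%:R * k%:R ^+ j = 0 :> R.
Proof.
elim: m j => // m IH j jm.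
have E : \sum_(k < m.+2) (-1) ^+ k * 'C(m.+1, k)%:R * k%:R ^+ j =
   \sum_(k < m.+1) (-1) ^+ k * 'C(m, k)%:R * (k%:R ^+ j - k.+1%:R ^+ j) :> R.
  rewrite big_ord_recl /= bin0.
  under eq_bigr do rewrite /bump /= add1n binS natrD mulrDr mulrDl.
  rewrite big_split /= addrA.
  under [in RHS]eq_bigr do rewrite mulrBr.
  rewrite sumrB; congr (_ + _).
    rewrite [in RHS]big_ord_recl /= bin0; congr (_ + _).
    rewrite big_ord_recr /= bin_small // mulr0 mul0r addr0.
    by apply: eq_bigr => i _; rewrite /bump /= add1n.
  by rewrite -sumrN; apply: eq_bigr => i _; rewrite exprS; ring.
rewrite E {E}.
have E (k : 'I_m.+1) : (-1) ^+ k * 'C(m, k)%:R * (k%:R ^+ j - k.+1%:R ^+ j) =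
   - \sum_(i < j) 'C(j, i)%:R * ((-1) ^+ k * 'C(m, k)%:R * k%:R ^+ i) :> R.
  rewrite -natr1 (addrC _ 1) exprDn big_ord_recr /= subnn expr0 mul1r binn mulr1n.
  rewrite opprD addrCA subrr addr0 mulrN mulr_sumr; congr (- _).
  by apply: eq_bigr => i _; rewrite expr1n mul1r -mulr_natl; ring.
under eq_bigr do rewrite E.
rewrite sumrN exchange_big /= big1 ?oppr0 // => i _.
rewrite -mulr_sumr IH ?mulr0 //.
by rewrite (leq_trans (ltn_ord i)).
Qed.

Lemma alt_binomial_affine (m j : nat) (a b : R) : (j < m)%N ->
  \sum_(k < m.+1) (-1) ^+ k * 'C(m, k)%:R * (a * k%:R + b) ^+ j = 0 :> R.
Proof.
move=> jm.
under eq_bigr do rewrite addrC exprDn mulr_sumr.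
rewrite exchange_big /= big1 // => i _.
transitivity (\sum_(k < m.+1) (b ^+ (j - i) * a ^+ i *+ 'C(j, i)) * ((-1) ^+ k * 'C(m, k)%:R * k%:R ^+ i)).
  by apply: eq_bigr => k _; rewrite exprMn -[b ^+ (j - i) * (_ * _) *+ _]mulr_natr -[b ^+ (j - i) * a ^+ i *+ _]mulr_natr; ring.
rewrite -mulr_sumr alt_binomial_pow ?mulr0 //.
by rewrite (leq_trans _ jm) // ltnS -ltnS.
Qed.

Lemma sum_sym_half n (f : nat -> R) : (forall k, (k < n.*2)%N -> f (n.*2.-1 - k)%N = f k) ->
  \sum_(k < n.*2) f k = (\sum_(j < n) f (n + j)%N) *+ 2.
Proof.
move=> fs; rewrite -addnn -[LHS](big_mkord xpredT f).
rewrite (@big_cat_nat _ _ _ n) //= ?leq_addr // mulr2n; congr (_ + _).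
  rewrite big_mkord (reindex_inj rev_ord_inj) /=; apply: eq_bigr => i _.
  have := ltn_ord i => Hi.
  rewrite -(fs (n + i)%N); last by rewrite -addnn ltn_add2l.
  by congr f; rewrite -addnn; lia.
rewrite -{1}(add0n n) big_addn addnK big_mkord.
by apply: eq_bigr => i _; rewrite addnC.
Qed.

(** Leibniz's argument: what follows the leading term is the negative of a sum of the same kind,
    lying between [0] and [u 1]. *)
Lemma alternating_sum (u : nat -> R) n : (forall j, 0 <= u j) -> (forall j, u j.+1 <= u j) ->
  0 <= \sum_(j < n) (-1) ^+ j * u j <= u 0.
Proof.
elim: n u => [|n IH] u u0 ud; first by rewrite big_ord0 lexx u0.
rewrite big_ord_recl /= expr0 mul1r.
have := IH (fun j => u j.+1) (fun j => u0 j.+1) (fun j => ud j.+1).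
set S := \sum_(i < n) _ => /andP[S0 S1].
have -> : \sum_(i < n) (-1) ^+ bump 0 i * u (bump 0 i) = - S.
  by rewrite -sumrN; apply: eq_bigr => i _; rewrite /bump /= add1n exprS; ring.
have := ud 0; lra.
Qed.

Lemma bin_half_decr n j : ('C(n.*2.-1, n + j.+1) <= 'C(n.*2.-1, n + j))%N.
Proof.
rewrite addnS.
have [H|H] := leqP n.*2 (n + j).+1; first by rewrite bin_small //; lia.
rewrite -(@leq_pmul2l (n + j).+1) // mul_bin_left leq_mul2r; apply/orP; right.
lia.
Qed.

Lemma bin_half_le n j : ('C(n.*2.-1, n + j) <= 'C(n.*2.-1, n))%N.
Proof.
elim: j => [|j IH]; first by rewrite addn0.
exact: leq_trans (bin_half_decr _ _) IH.
Qed.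

Lemma sum_inv_odd_sq n : \sum_(j < n) (2 * j%:R + 1 : R)^-2 <= 2.
Proof.
(* The subtracted term makes the induction close: each new summand is at most a telescoping
   difference. *)
suff : \sum_(j < n.+1) (2 * j%:R + 1 : R)^-2 <= 2 - (2 * n%:R + 2)^-1.
  rewrite big_ord_recr /=.
  have : 0 <= (2 * n%:R + 1 : R)^-2 by rewrite invr_ge0 exprn_ge0 // addr_ge0 // mulr_ge0.
  have : 0 <= (2 * n%:R + 2 : R)^-1 by rewrite invr_ge0 addr_ge0 // mulr_ge0.
  lra.
elim: n => [|n IH]; first by rewrite big_ord1 mulr0 !add0r expr1n invr1; lra.
rewrite big_ord_recr /=; apply: (le_trans (lerD IH (lexx _))).
set x : R := n%:R; have x0 : 0 <= x by rewrite /x.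
rewrite -[n.+1%:R]natr1 -/x.
suff : (2 * (x + 1) + 1)^-2 <= (2 * x + 2)^-1 - (2 * (x + 1) + 2)^-1 by lra.
have -> : (2 * x + 2)^-1 - (2 * (x + 1) + 2)^-1 = 2 / ((2 * x + 2) * (2 * (x + 1) + 2)).
  by field; rewrite !gt_eqF //; lra.
rewrite -[leLHS]mul1r ler_pdivrMr; last by apply: exprn_gt0; lra.
rewrite mulrAC ler_pdivlMr; last by apply: mulr_gt0; lra.
nra.
Qed.

(** The point is that the total weight does not grow with [n]: the weights decay like the inverse
    squares of the nodes, which are odd integers. Up to normalisation their absolute values sum to
    at most [4 B], with [B] the central binomial coefficient, while the normalising constant is at
    least [(4/3) B]; whence the bound 3. After scaling the nodes by [c0/n] the formula costs only
    [3 n / c0]. *)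
Lemma numerical_differentiation n : (0 < n)%N ->
  exists c a : nat -> R,
  [/\ \sum_(k < n.*2) `|c k| <= 3,
      forall k, (k < n.*2)%N -> `|a k| <= n.*2%:R &
      forall j, (j < n.*2)%N -> \sum_(k < n.*2) c k * a k ^+ j = (j == 1%N)%:R].
Proof.
move=> n0.
pose m := n.*2.-1.
have mE : m.+1 = n.*2 by rewrite /m prednK // double_gt0.
(* The nodes are [a k = 2 k - m] and the weights are proportional to [(-1)^k C(m,k) / (a k)^2]: the moments of
   order [j >= 2] are [m]-th differences of polynomials of degree [j - 2 < m], and that of order [0] vanishes by
   symmetry. *)
pose a k : R := 2 * k%:R - m%:R.
have a_half j : a (n + j)%N = 2 * j%:R + 1.
  rewrite /a natrD mulrDr; have -> : m%:R = 2 * n%:R - 1 :> R.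
    by rewrite -[X in _ = X - _]natrM mul2n -mE -natr1 addrK.
  ring.
have a_sym k : (k < n.*2)%N -> a (m - k)%N = - a k.
  by rewrite -mE ltnS => km; rewrite /a natrB //; ring.
have a_neq0 k : a k != 0.
  rewrite /a subr_eq0 -natrM eqr_nat; apply/eqP => H.
  have : odd (2 * k) = odd m by rewrite H.
  by rewrite oddM /= /m; case: (n) n0 => // n'; rewrite doubleS /= odd_double.
have b_sym k : (k < n.*2)%N -> 'C(m, m - k) = 'C(m, k).
  by rewrite -mE ltnS => km; rewrite bin_sub.
have s_sym k : (k < n.*2)%N -> (-1) ^+ (m - k)%N = - (-1) ^+ k :> R.
  rewrite -mE ltnS => km; rewrite -signr_odd oddB // -[in RHS]signr_odd.
  have -> : odd m = true by rewrite /m; case: (n) n0 => // n'; rewrite doubleS /= odd_double.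
  by case: (odd k); rewrite ?expr0 ?expr1 ?opprK.
pose w k : R := (-1) ^+ k * 'C(m, k)%:R.
pose ka := \sum_(k < n.*2) w k / a k.
pose B : R := 'C(m, n)%:R.
have B0 : 0 < B by rewrite ltr0n bin_gt0 /m; lia.
(* By symmetry [ka] is, up to sign, twice an alternating sum with decreasing terms, of which the
   leading one is [B] and the next at most [B / 3]. *)
have kaB : (4/3) * B <= `|ka|.
  rewrite /ka (@sum_sym_half n (fun k => w k / a k)); last first.
    by move=> k kn; rewrite /w s_sym // b_sym // a_sym // invrN; ring.
  pose u j : R := 'C(m, n + j)%:R / (2 * j%:R + 1).
  have -> : \sum_(j < n) w (n + j)%N / a (n + j)%N = (-1) ^+ n * \sum_(j < n) (-1) ^+ j * u j.
    rewrite mulr_sumr; apply: eq_bigr => j _; rewrite a_half /w /u exprD; ring.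
  rewrite normrMn normrM normrX normrN1 expr1n mul1r.
  have u0 j : 0 <= u j by rewrite /u divr_ge0 // addr_ge0 // mulr_ge0.
  have ud j : u j.+1 <= u j.
    rewrite /u ler_pM // ?invr_ge0 ?addr_ge0 ?mulr_ge0 //.
      by rewrite ler_nat bin_half_decr.
    by rewrite lef_pV2 ?posrE ?ltr_wpDl ?mulr_ge0 // lerD2r ler_pM2l // ler_nat.
  have [n' nE] : exists n', n = n'.+1 by exists n.-1; rewrite prednK.
  have := @alternating_sum (fun j => u j.+1) n' (fun j => u0 j.+1) (fun j => ud j.+1).
  rewrite nE big_ord_recl /= expr0 mul1r.
  set S := \sum_(i < n') _ => /andP[S0 S1].
  have -> : \sum_(i < n') (-1) ^+ bump 0 i * u (bump 0 i) = - S.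
    by rewrite -sumrN; apply: eq_bigr => i _; rewrite /bump /= add1n exprS; ring.
  have u00 : u 0 = B by rewrite /u addn0 mulr0 add0r divr1.
  have u1 : u 1 <= B / 3.
    rewrite /u mulr1 (_ : 2 + 1 = 3); last by ring.
    by rewrite ler_pM2r ?invr_gt0 // ler_nat bin_half_le.
  rewrite ger0_norm; last by lra.
  by rewrite -mulr_natl; lra.
have ka0 : ka != 0 by rewrite -normr_gt0 (lt_le_trans _ kaB) // mulr_gt0.
exists (fun k => w k / a k ^+ 2 / ka), a; split.
- under eq_bigr do rewrite normrM normfV.
  rewrite -mulr_suml ler_pdivrMr ?normr_gt0 //.
  apply: (@le_trans _ _ (\sum_(k < n.*2) B * (a k)^-2)).
    apply: ler_sum => k _; rewrite normrM normfV normrX.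
    rewrite real_normK ?num_real // ler_pM2r ?invr_gt0 ?exprn_even_gt0 //=.
    rewrite /w normrM normrX normrN1 expr1n mul1r normr_nat ler_nat.
    have kn := ltn_ord k; case: (leqP n k) => nk.
      by rewrite -(subnKC nk) bin_half_le.
    rewrite -b_sym // -(@subnKC n (m - k)) ?bin_half_le // /m; lia.
  rewrite (@sum_sym_half n (fun k => B * (a k)^-2)); last first.
    by move=> k kn; rewrite a_sym // sqrrN.
  under eq_bigr do rewrite a_half.
  rewrite -mulr_sumr mulr2n; have := sum_inv_odd_sq n.
  by rewrite -(ler_pM2l B0) => H; lra.
- move=> k kn; rewrite /a ler_norml -mE -natr1.
  have : (k%:R : R) <= m%:R by rewrite ler_nat -ltnS mE.
  have : 0 <= k%:R :> R by [].
  have : 0 <= m%:R :> R by [].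
  lra.
- move=> j jn.
  case: j jn => [|[|j]] jn.
  + rewrite /=; under eq_bigr do rewrite expr0 mulr1.
    suff : \sum_(k < n.*2) w k / a k ^+ 2 / ka = - \sum_(k < n.*2) w k / a k ^+ 2 / ka by lra.
    rewrite {1}(reindex_inj rev_ord_inj) /= -sumrN; apply: eq_bigr => k _.
    have -> : (n.*2 - k.+1 = m - k)%N by rewrite /m; lia.
    rewrite /w s_sym // b_sym // a_sym // sqrrN; ring.
  + rewrite /=; transitivity (ka / ka); last exact: divff.
    rewrite {2}/ka mulr_suml; apply: eq_bigr => k _.
    by field; rewrite ka0 a_neq0.
  + rewrite /=; transitivity ((\sum_(k < m.+1) w k * (2 * k%:R + - m%:R) ^+ j) / ka).
      rewrite mulr_suml mE; apply: eq_bigr => k _; rewrite -(addn2 j) exprD -/(a k).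
      by field; rewrite ka0 a_neq0.
    by rewrite alt_binomial_affine ?mul0r //; rewrite -mE in jn; lia.
Qed.

End numdiff.

(** * Taylor remainders and the error of a difference scheme *)

Section taylor.
Context {R : realType}.

Lemma le_of_derive_le (f df g dg : R -> R) (a b : R) : a <= b ->
  (forall t : R, is_derive t (1 : R) f (df t)) -> (forall t : R, is_derive t (1 : R) g (dg t)) ->
  (forall t, a <= t -> t <= b -> df t <= dg t) -> f b - f a <= g b - g a.
Proof.
rewrite le_eqVlt => /orP[/eqP -> | ab] Hf Hg H; first by rewrite !subrr.
have Hd (t : R) : is_derive t (1 : R) (g - f) (dg t - df t) by exact: is_deriveB.
have [c cab] := @MVT R (g - f) (fun t => dg t - df t) a b ab (fun t _ => Hd t)
  ltac:(apply: continuous_subspaceT => x; apply: differentiable_continuous; apply/derivable1_diffP; by have [] := Hd x).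
move: cab; rewrite in_itv /= => /andP[ac cb] E.
have := H c (ltW ac) (ltW cb).
move: E; rewrite /= !fctE => E.
have : 0 <= (dg c - df c) * (b - a) -> f b - f a <= g b - g a by rewrite -E; lra.
move=> K L; apply: K; apply: mulr_ge0; lra.
Qed.

Lemma is_derive_monomial (c s : R) m :
  is_derive s (1 : R) (fun s : R => c * s ^+ m.+1) (c * (m.+1%:R * s ^+ m)).
Proof.
rewrite (_ : (fun s => _) = c \*: ((@id R) ^+ m.+1)).
  by apply: is_derive_eq; rewrite /GRing.scale /= mulr1.
by apply/funext => u; rewrite /GRing.scale /= exprfctE.
Qed.

Lemma norm_le_of_derive (f df : R -> R) (M : R) (m : nat) :
  f 0 = 0 -> (forall t : R, is_derive t (1 : R) f (df t)) ->
  (forall t, `|df t| <= M * `|t| ^+ m) ->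
  forall t, `|f t| <= M * `|t| ^+ m.+1 / m.+1%:R.
Proof.
move=> f0 Hf Hdf.
have pos (g dg : R -> R) t : 0 <= t -> g 0 = 0 -> (forall t : R, is_derive t (1 : R) g (dg t)) ->
   (forall t, `|dg t| <= M * `|t| ^+ m) -> g t <= M * t ^+ m.+1 / m.+1%:R.
  move=> t0 g0 Hg Hdg.
  have Hp (s : R) : is_derive s (1 : R) (fun s : R => M / m.+1%:R * s ^+ m.+1) (M * s ^+ m).
    have -> : M * s ^+ m = M / m.+1%:R * (m.+1%:R * s ^+ m) by field.
    exact: is_derive_monomial.
  have := le_of_derive_le t0 Hg Hp; rewrite g0 subr0 expr0n /= mulr0 subr0.
  rewrite mulrAC; apply => s s0 _.
  by apply: le_trans (ler_norm _) _; apply: le_trans (Hdg s) _; rewrite ger0_norm.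
have both (g dg : R -> R) t : 0 <= t -> g 0 = 0 -> (forall t : R, is_derive t (1 : R) g (dg t)) ->
   (forall t, `|dg t| <= M * `|t| ^+ m) -> `|g t| <= M * t ^+ m.+1 / m.+1%:R.
  move=> t0 g0 Hg Hdg; rewrite ler_norml lerNl; apply/andP; split; last exact: pos Hg Hdg.
  apply: (pos (- g) (fun s => - dg s)) => //; first by rewrite fctE g0 oppr0.
  by move=> s; rewrite normrN.
move=> t; have [t0|t0] := leP 0 t; first by rewrite (ger0_norm t0); exact: both Hf Hdf.
rewrite (ltr0_norm t0).
have H (s : R) : is_derive s (1 : R) (f \o -%R) (- df (- s)).
  have Ho : is_derive s (1 : R) (-%R : R -> R) (-1) by apply: is_deriveNid.
  by apply: is_derive_eq; rewrite mulrN1.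
have N0 : 0 <= - t by rewrite oppr_ge0 ltW.
have := both _ _ _ N0 _ H; rewrite /= opprK oppr0; apply => //.
by move=> s; rewrite normrN -[in X in _ <= X](normrN s).
Qed.

(** [F] lists a function and its successive derivatives. The [t]-derivative of the remainder of
    order [m+1] is the remainder of order [m] of [F 1]; the induction hypothesis is integrated by
    [norm_le_of_derive]. *)
Lemma taylor_bound (m : nat) (F : nat -> R -> R) (M x t : R) :
  (forall j (s : R), (j < m)%N -> is_derive s (1 : R) (F j) (F j.+1 s)) ->
  (forall s, `|F m s| <= M) ->
  `|F 0%N (x + t) - \sum_(j < m) F j x * t ^+ j / j`!%:R| <= M * `|t| ^+ m / m`!%:R.
Proof.
elim: m F t => [|m IH] F t HF HM.
  by rewrite big_ord0 subr0 expr0 mulr1 fact0 divr1.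
pose T (G : nat -> R -> R) m s : R := \sum_(j < m) G j x * s ^+ j / j`!%:R.
have dT (s : R) : is_derive s (1 : R) (fun s => T F m.+1 s) (T (fun j => F j.+1) m s).
  rewrite (_ : (fun s => T F m.+1 s) = (fun s : R => F 0%N x) + \sum_(j < m) (fun s : R => F j.+1 x / j.+1`!%:R * s ^+ j.+1)); last first.
    apply/funext => u; rewrite /T big_ord_recl /= fctE fact0 expr0 mulr1 divr1; congr (_ + _).
    by rewrite fct_sumE; apply: eq_bigr => j _; rewrite /bump /= add1n; ring.
  have D (j : 'I_m) := is_derive_monomial (F j.+1 x / j.+1`!%:R) s j.
  apply: is_derive_eq; rewrite add0r /T; apply: eq_bigr => j _.
  rewrite factS natrM.
  have u0 : j.+1%:R != 0 :> R by rewrite pnatr_eq0.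
  have v0 : j`!%:R != 0 :> R by rewrite pnatr_eq0 -lt0n fact_gt0.
  move: (j.+1%:R : R) (j`!%:R : R) (F j.+1 x) (s ^+ j) u0 v0 => u v p q u0 v0.
  by field; rewrite u0 v0.
have dG (s : R) : is_derive s (1 : R) (fun s => F 0%N (x + s) - T F m.+1 s) (F 1%N (x + s) - T (fun j => F j.+1) m s).
  apply: is_deriveB.
  have H1 : is_derive s (1 : R) (cst x + @id R) 1.
    by apply: is_derive_eq; rewrite add0r.
  have H2 : is_derive (x + s) (1 : R) (F 0%N) (F 1%N (x + s)) by exact: HF.
  by have := is_derive1_comp H2 H1; rewrite mulr1.
have G0 : F 0%N (x + 0) - T F m.+1 0 = 0.
  rewrite addr0 /T big_ord_recl /= expr0 mulr1 fact0 divr1 big1 ?addr0 ?subrr // => j _.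
  by rewrite /bump /= add1n expr0n mulr0 mul0r.
have bd s : `|F 1%N (x + s) - T (fun j => F j.+1) m s| <= M / m`!%:R * `|s| ^+ m.
  rewrite mulrAC; apply: (IH (fun j => F j.+1)) => // j u jm; exact: HF.
have := norm_le_of_derive G0 dG bd t.
rewrite -/(T F m.+1 t) => /le_trans; apply.
rewrite factS natrM le_eqVlt; apply/orP; left; apply/eqP.
have u0 : m.+1%:R != 0 :> R by rewrite pnatr_eq0.
have v0 : m`!%:R != 0 :> R by rewrite pnatr_eq0 -lt0n fact_gt0.
move: (m.+1%:R : R) (m`!%:R : R) (`|t| ^+ m.+1) u0 v0 => u v p u0 v0.
by field; rewrite u0 v0.
Qed.

(** The scheme is exact on the Taylor polynomial of degree below [2n], so only the remainders at the
    nodes contribute, with total weight 3. *)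
Lemma numdiff_error n (c a : nat -> R) (e M : R) (G : nat -> R -> R) (x : R) : 0 < e ->
  \sum_(k < n.*2) `|c k| <= 3 ->
  (forall k, (k < n.*2)%N -> `|a k| <= n.*2%:R) ->
  (forall j, (j < n.*2)%N -> \sum_(k < n.*2) c k * a k ^+ j = (j == 1%N)%:R) ->
  (forall j (s : R), (j < n.*2)%N -> is_derive s (1 : R) (G j) (G j.+1 s)) ->
  (forall s, `|G n.*2 s| <= M) -> (0 < n)%N ->
  `|G 1%N x - e^-1 * \sum_(k < n.*2) c k * G 0%N (x + e * a k)| <=
    e^-1 * (3 * (M * (n.*2%:R * e) ^+ n.*2 / n.*2`!%:R)).
Proof.
move=> e0 Hc Ha Hex HG HM n0.
have M0 : 0 <= M by apply: le_trans (HM 0).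
pose r k := G 0%N (x + e * a k) - \sum_(j < n.*2) G j x * (e * a k) ^+ j / j`!%:R.
have E : \sum_(k < n.*2) c k * G 0%N (x + e * a k) = e * G 1%N x + \sum_(k < n.*2) c k * r k.
  under [in RHS]eq_bigr do rewrite mulrBr.
  rewrite sumrB addrCA -[LHS]addr0; congr (_ + _).
  under eq_bigr do rewrite mulr_sumr.
  rewrite exchange_big /=.
  under eq_bigr => j _.
    rewrite (_ : \sum_(i < n.*2) _ = G j x * e ^+ j / j`!%:R * \sum_(k < n.*2) c k * a k ^+ j); last first.
      by rewrite mulr_sumr; apply: eq_bigr => k _; rewrite exprMn; ring.
    rewrite Hex //; over.
  have n1 : (1 < n.*2)%N by rewrite -muln2; lia.
  rewrite (bigD1 (Ordinal n1)) //= big1 ?addr0 => [|j jn]; last first.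
    rewrite (_ : (j == 1 :> nat) = false) ?mulr0 //; apply/negbTE; exact: jn.
  by rewrite expr1 (_ : 1`! = 1%N) // divr1 mulr1 mulrC subrr.
have -> : G 1%N x - e^-1 * \sum_(k < n.*2) c k * G 0%N (x + e * a k) = - (e^-1 * \sum_(k < n.*2) c k * r k).
  by rewrite E; field; rewrite gt_eqF.
rewrite normrN normrM (ger0_norm (ltW (_ : 0 < e^-1))) ?invr_gt0 // ler_pM2l ?invr_gt0 //.
apply: le_trans (ler_norm_sum _ _ _) _.
set D := M * _ / _.
have D0 : 0 <= D by rewrite /D divr_ge0 // mulr_ge0 // exprn_ge0 // mulr_ge0 // ltW.
apply: (@le_trans _ _ (\sum_(k < n.*2) `|c k| * D)); last by rewrite -mulr_suml ler_wpM2r.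
apply: ler_sum => k _; rewrite normrM ler_wpM2l //.
apply: le_trans (taylor_bound _ _ HG HM) _.
rewrite /D ler_wpM2r // ler_wpM2l // ler_pXn2r ?double_gt0 ?nnegrE ?mulr_ge0 ?(ltW e0) //.
by rewrite normrM (gtr0_norm e0) mulrC ler_wpM2r ?(ltW e0) // Ha.
Qed.

(** A weak Stirling bound, from [(1 + 1/k)^k <= e]. It turns the quotient of a power by a factorial
    in the Taylor remainder into a geometric factor. *)
Lemma expn_le_fact (m : nat) : m%:R ^+ m <= expR 1 ^+ m * m`!%:R :> R.
Proof.
elim: m => [|m IH]; first by rewrite !expr0 fact0 mulr1.
case: m IH => [|m] IH.
  by rewrite !expr1 mulr1; apply: le_trans (expR_ge1Dx 1); rewrite lerDl.
set k := m.+1 in IH *.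
have k0 : 0 < k%:R :> R by rewrite ltr0n.
have H : (k.+1%:R / k%:R) ^+ k <= expR 1 :> R.
  have -> : expR 1 = expR (k%:R^-1) ^+ k :> R by rewrite -expRM_natl mulfV ?gt_eqF.
  rewrite ler_pXn2r ?nnegrE ?divr_ge0 ?expR_ge0 //.
  have -> : k.+1%:R / k%:R = 1 + k%:R^-1 :> R by rewrite -natr1 mulrDl divff ?gt_eqF // mul1r.
  exact: expR_ge1Dx.
rewrite exprS factS natrM mulrCA ler_pM2l ?ltr0n // exprS -mulrA.
apply: le_trans (ler_wpM2l (expR_ge0 1) IH).
rewrite -ler_pdivrMr ?exprn_gt0 //; move: H; by rewrite expr_div_n.
Qed.

End taylor.

(** * Powers of the positive part of a trigonometric polynomial of degree one *)

Section trig_kernel.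
Context {R : realType}.

(** A quadratic bound on the increment survives integration against [h], which is how derivatives
    pass through the kernel representation; it also settles corners and polynomials. *)
Lemma is_derive_of_quadratic (f : R -> R) (x l C : R) : 0 <= C ->
  (forall h, `|h| <= 1 -> `|f (h + x) - f x - l * h| <= C * h ^+ 2) -> is_derive x (1 : R) f l.
Proof.
move=> C0 H.
have L : h^-1 *: (f (h *: (1 : R) + x) - f x) @[h --> 0^'] --> l.
  apply/cvgrPdist_le => e e0; near=> h.
  have h0 : h != 0 by near: h; exact: nbhs_dnbhs_neq.
  have h1 : `|h| <= 1 by near: h; apply: dnbhs0_le.
  have h2 : `|h| <= e / (C + 1) by near: h; apply: dnbhs0_le; rewrite divr_gt0 // ltr_wpDl.
  rewrite /GRing.scale /= mulr1.
  have -> : l - h^-1 * (f (h + x) - f x) = - (h^-1 * (f (h + x) - f x - l * h)) by field.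
  rewrite normrN normrM normfV -ler_pdivlMl ?invr_gt0 ?normr_gt0 // invrK.
  apply: le_trans (H h h1) _.
  rewrite -real_normK ?num_real // expr2 mulrCA ler_wpM2l //.
  rewrite ler_pdivlMr ?ltr_wpDl // in h2; have := normr_ge0 h; lra.
by apply: DeriveDef; [apply: cvgP L|exact: cvg_lim L].
Unshelve. all: end_near. Qed.

Lemma pospart_mul (q : R) a : (0 < a)%N -> q * Num.max q 0 ^+ a = Num.max q 0 ^+ a.+1.
Proof.
move=> a0; have [q0|q0] := leP 0 q; first by rewrite exprS.
by rewrite !expr0n /= (gtn_eqF a0) mulr0.
Qed.

Lemma is_derive_pospart (a : nat) (t : R) :
  is_derive t (1 : R) (fun s : R => Num.max s 0 ^+ a.+2) (a.+2%:R * Num.max t 0 ^+ a.+1).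
Proof.
have [t0|t0|t0] := ltgtP t 0.
- rewrite expr0n /= mulr0.
  apply: (near_eq_is_derive (f := cst 0)) => //.
  near=> s; rewrite /cst max_r ?expr0n //; apply: ltW; near: s; exact: lt_nbhsl.
- apply: (near_eq_is_derive (f := fun s : R => 1 * s ^+ a.+2)) => //.
    near=> s; rewrite mul1r max_l //; near: s; exact: lt_le_nbhsr.
  by have := is_derive_monomial 1 t a.+1; rewrite mul1r.
(* At the corner the exponent, at least two, gives the quadratic bound directly. *)
rewrite t0 expr0n /= mulr0.
apply: (@is_derive_of_quadratic _ _ _ 1) => // h h1.
rewrite addr0 maxxx expr0n /= !subr0 mul0r subr0 mul1r.
have [h0|h0] := leP 0 h; last by rewrite expr0n normr0 sqr_ge0.
rewrite ger0_norm ?exprn_ge0 // -addn2 exprD -[leRHS]mul1r ler_wpM2r ?sqr_ge0 //.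
by rewrite exprn_ile1 //; move: h1; rewrite ger0_norm.
Unshelve. all: end_near. Qed.

Lemma is_derive_affine2 (f g : R -> R) (c A B x df dg : R) :
  is_derive x (1 : R) f df -> is_derive x (1 : R) g dg ->
  is_derive x (1 : R) (fun t => c + (A * f t + B * g t)) (A * df + B * dg).
Proof.
move=> Hf Hg.
have := is_deriveD (is_derive_cst c x 1) (is_deriveD (is_deriveZ A Hf) (is_deriveZ B Hg)).
by rewrite add0r.
Qed.

Variables al A B : R.
Definition trigq (th : R) : R := al + (A * cos th + B * sin th).
Definition trigv (th : R) : R := B * cos th - A * sin th.

Lemma is_derive_trigq th : is_derive th (1 : R) trigq (trigv th).
Proof.
have -> : trigv th = A * - sin th + B * cos th by rewrite /trigv mulrN addrC.
exact: (is_derive_affine2 al A B (is_derive_cos th) (is_derive_sin th)).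
Qed.

Lemma is_derive_trigv th : is_derive th (1 : R) trigv (al - trigq th).
Proof.
have -> : al - trigq th = B * - sin th + - A * cos th.
  by rewrite /trigq opprD addNKr mulrN mulNr opprD addrC.
rewrite (_ : trigv = fun t => 0 + (B * cos t + - A * sin t)).
  exact: (is_derive_affine2 0 B (- A) (is_derive_cos th) (is_derive_sin th)).
by apply/funext => s; rewrite /trigv add0r mulNr.
Qed.

(* [trigF j a b g] is the [j]-th derivative of [trigq_+^a * trigv^b * al^g], from [trigq' = trigv] and [trigv' = al - trigq];
   the total degree [a + b + g] is preserved. *)
Fixpoint trigF (j a b g : nat) (th : R) {struct j} : R :=
  match j with
  | 0 => Num.max (trigq th) 0 ^+ a * trigv th ^+ b * al ^+ g
  | j'.+1 => a%:R * trigF j' a.-1 b.+1 g th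
             + b%:R * (trigF j' a b.-1 g.+1 th - trigF j' a.+1 b.-1 g th)
  end.

(** Each differentiation lowers the exponent of the positive part by at most one, so all exponents
    met at order [j] are at least [a - j >= 2], where that power is still differentiable. *)
Lemma is_derive_trigF j a b g th : (j.+1 < a)%N ->
  is_derive th (1 : R) (trigF j a b g) (trigF j.+1 a b g th).
Proof.
elim: j a b g => [|j IH] a b g ja.
  case: a ja => [|[|a]] // _.
  have D1 : is_derive th (1 : R) (fun th => Num.max (trigq th) 0 ^+ a.+2) (a.+2%:R * Num.max (trigq th) 0 ^+ a.+1 * trigv th).
    exact: (is_derive1_comp (is_derive_pospart a (trigq th)) (is_derive_trigq th)).
  have D2 : is_derive th (1 : R) (fun th => trigv th ^+ b) (b%:R * trigv th ^+ b.-1 * (al - trigq th)).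
    case: b => [|b].
      rewrite !mul0r (_ : (fun _ => _) = cst 1); first exact: is_derive_cst.
      by apply/funext => s; rewrite expr0.
    have := is_derive1_comp (is_derive_monomial 1 (trigv th) b) (is_derive_trigv th).
    by rewrite mul1r (_ : _ \o _ = fun th => trigv th ^+ b.+1) //; apply/funext => s /=; rewrite mul1r.
  rewrite (_ : trigF 0 a.+2 b g = al ^+ g \*: ((fun th => Num.max (trigq th) 0 ^+ a.+2) * (fun th => trigv th ^+ b))); last first.
    by apply/funext => s; rewrite /= /GRing.scale /= mulrC.
  apply: is_derive_eq; rewrite /= /GRing.scale /=.
  rewrite -[_ ^+ a.+3](@pospart_mul _ a.+2) // (exprS (trigv th)) (exprS al).
  move: (Num.max _ _ ^+ a.+2) (Num.max _ _ ^+ a.+1) (trigv th ^+ b) (trigv th ^+ b.-1) (al ^+ g) => x y z u v.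
  ring.
have ja1 : (j.+1 < a.-1)%N by case: a ja.
have ja2 : (j.+1 < a)%N by exact: ltnW.
have D1 := IH a.-1 b.+1 g ja1.
have D2 := IH a b.-1 g.+1 ja2.
have D3 := IH a.+1 b.-1 g (ltnW (ltnW ja)).
rewrite (_ : trigF j.+1 a b g = a%:R \*: trigF j a.-1 b.+1 g + b%:R \*: (trigF j a b.-1 g.+1 - trigF j a.+1 b.-1 g)) //.
by apply: is_derive_eq.
Qed.

(** A Bernstein-type inequality: a differentiation produces terms of the same total degree with
    coefficients adding up to [a + 2 b], at most twice that degree. *)
Lemma trigF_bound j a b g (th Q : R) : (forall s, `|trigq s| <= Q) -> (forall s, `|trigv s| <= Q) -> `|al| <= Q ->
  `|trigF j a b g th| <= (2 * (a + b + g)%N%:R) ^+ j * Q ^+ (a + b + g).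
Proof.
move=> Hq Hv Ha; have Q0 : 0 <= Q by apply: le_trans Ha.
elim: j a b g => [|j IH] a b g.
  rewrite expr0 mul1r /= !normrM !normrX !exprD.
  have pw (x : R) k : `|x| <= Q -> `|x| ^+ k <= Q ^+ k.
    by move=> xQ; apply: lerXn2r; rewrite ?nnegrE.
  have mx : `|Num.max (trigq th) 0| <= Q.
    apply: le_trans (Hq th); rewrite ger0_norm; last by rewrite le_max lexx orbT.
    by rewrite ge_max ler_norm normr_ge0.
  apply: ler_pM; [by rewrite mulr_ge0 ?exprn_ge0|by rewrite exprn_ge0| |exact: pw].
  by apply: ler_pM; rewrite ?exprn_ge0 //; exact: pw.
rewrite /=; set s := (a + b + g)%N.
set M := (2 * s%:R) ^+ j * Q ^+ s.
have M0 : 0 <= M by rewrite /M mulr_ge0 ?exprn_ge0 // mulr_ge0.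
have H1 : `|a%:R * trigF j a.-1 b.+1 g th| <= a%:R * M.
  rewrite normrM normr_nat; case: a @s @M M0 => [|a] s M M0; first by rewrite !mul0r.
  rewrite ler_wpM2l //; apply: le_trans (IH _ _ _) _.
  by rewrite /M /s /= addnS.
have H2 : `|b%:R * (trigF j a b.-1 g.+1 th - trigF j a.+1 b.-1 g th)| <= b%:R * (M + M).
  rewrite normrM normr_nat; case: b @s @M M0 H1 => [|b] s M M0 H1; first by rewrite !mul0r.
  rewrite ler_wpM2l //; apply: le_trans (ler_normB _ _) _; apply: lerD.
    by apply: le_trans (IH _ _ _) _; rewrite /M /s /= !addnS addSn.
  by apply: le_trans (IH _ _ _) _; rewrite /M /s /= !addnS !addSn.
apply: le_trans (ler_normD _ _) _; apply: le_trans (lerD H1 H2) _.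
rewrite exprS -mulrA -/M.
have -> : s%:R = a%:R + b%:R + g%:R :> R by rewrite /s !natrD.
have : 0 <= a%:R * M by rewrite mulr_ge0.
have : 0 <= g%:R * M by rewrite mulr_ge0.
rewrite !mulrDl !mulrDr !mulrDl; lra.
Qed.

End trig_kernel.

Section trig_numdiff.
Context {R : realType}.

(** With step [c0/n] and derivatives of order [2n] of size [(8n)^(2n) Q^(2n+2)], the powers of [n]
    cancel against [(2n)!]. What remains is a geometric rate proportional to [c0], which can be made
    as small as desired. The second bound is the first one applied to the derivative, whose higher
    derivatives are larger by one more factor [8n]. *)
Lemma trig_numdiff n (c a : nat -> R) (c0 Q al A B x : R) : (0 < n)%N -> 0 < c0 ->
  \sum_(k < n.*2) `|c k| <= 3 ->
  (forall k, (k < n.*2)%N -> `|a k| <= n.*2%:R) ->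
  (forall j, (j < n.*2)%N -> \sum_(k < n.*2) c k * a k ^+ j = (j == 1%N)%:R) ->
  (forall s, `|trigq al A B s| <= Q) -> (forall s, `|trigv A B s| <= Q) -> `|al| <= Q ->
  let F j := trigF al A B j n.*2.+2 0 0 in
  let err := 3 * Q ^+ 2 * (n%:R / c0) * (8 * c0 * Q * expR 1) ^+ n.*2 in
  `|F 1%N x - n%:R / c0 * \sum_(k < n.*2) c k * F 0%N (x + c0 / n%:R * a k)| <= err /\
  `|F 2%N x - n%:R / c0 * \sum_(k < n.*2) c k * F 1%N (x + c0 / n%:R * a k)| <= 8 * n%:R * err.
Proof.
move=> n0 c00 Hc Ha Hex Hq Hv Hal F err.
have Q0 : 0 <= Q by apply: le_trans Hal.
have nr : 0 < n%:R :> R by rewrite ltr0n.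
pose e := c0 / n%:R.
have e0 : 0 < e by rewrite divr_gt0.
have eV : n%:R / c0 = e^-1 by rewrite invf_div.
have c0E : c0 = n%:R * e by rewrite /e; field; rewrite gt_eqF.
pose K := n.*2.+2.
have FB j s : `|F j s| <= (2 * K%:R) ^+ j * Q ^+ K.
  by have := @trigF_bound R al A B j K 0 0 s Q Hq Hv Hal; rewrite !addn0.
have K8 : 2 * K%:R <= 8 * n%:R :> R.
  have -> : 8 * n%:R = 2 * (4 * n)%N%:R :> R by rewrite natrM; ring.
  by rewrite ler_pM2l // ler_nat /K; lia.
have K0 : 0 <= 2 * K%:R :> R by rewrite mulr_ge0.
have key : e^-1 * (3 * (((2 * K%:R) ^+ n.*2 * Q ^+ K) * (n.*2%:R * e) ^+ n.*2 / n.*2`!%:R)) <= err.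
  rewrite /err eV; clearbody e.
  have -> : 3 * Q ^+ 2 / e * (8 * c0 * Q * expR 1) ^+ n.*2 = e^-1 * (3 * (Q ^+ 2 * (8 * c0 * Q * expR 1) ^+ n.*2)) by ring.
  rewrite ler_pM2l ?invr_gt0 // ler_pM2l //.
  rewrite c0E.
  have f0 : 0 < n.*2`!%:R :> R by rewrite ltr0n fact_gt0.
  rewrite ler_pdivrMr //.
  rewrite [in Q ^+ K]/K -(addn2 n.*2) exprD.
  have -> : 8 * (n%:R * e) * Q * expR 1 = (8 * n%:R) * Q * e * expR 1 by ring.
  rewrite !exprMn.
  have H1 : (2 * K%:R) ^+ n.*2 <= (8 * n%:R) ^+ n.*2 :> R by apply: lerXn2r; rewrite ?nnegrE // mulr_ge0.
  have H2 := @expn_le_fact R n.*2.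
  move: H1 H2; rewrite -!exprMn.
  have e1 : 0 <= expR 1 :> R by exact: expR_ge0.
  have p1 : 0 <= (2 * K%:R) ^+ n.*2 :> R by exact: exprn_ge0.
  have p2 : 0 <= n.*2%:R ^+ n.*2 :> R by exact: exprn_ge0.
  have p3 : 0 <= Q ^+ n.*2 * Q ^+ 2 * e ^+ n.*2 by rewrite !mulr_ge0 ?exprn_ge0 // ltW.
  rewrite !exprMn -!exprMn => H1 H2.
  have := ler_wpM2l p3 (ler_pM p1 p2 H1 H2).
  rewrite !exprMn.
  move: (2 ^+ n.*2) (K%:R ^+ n.*2) (Q ^+ n.*2) (Q ^+ 2) (e ^+ n.*2) (n.*2%:R ^+ n.*2) (8 ^+ n.*2) (n%:R ^+ n.*2) (expR 1 ^+ n.*2) (n.*2`!%:R : R).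
  move=> u1 u2 u3 u4 u5 u6 u7 u8 u9 u10 H.
  by apply: le_trans (le_trans H _); rewrite le_eqVlt; apply/orP; left; apply/eqP; ring.
have err0 : 0 <= err.
  by rewrite /err !mulr_ge0 ?exprn_ge0 ?invr_ge0 ?expR_ge0 ?mulr_ge0 // ?ltW // mulr_ge0 // ltW.
split.
  rewrite eV; apply: le_trans key.
  apply: (@numdiff_error R n c a e _ F x) => // j s jn.
  by apply: is_derive_trigF; lia.
rewrite eV.
have := @numdiff_error R n c a e ((2 * K%:R) ^+ n.*2.+1 * Q ^+ K) (fun j => F j.+1) x e0 Hc Ha Hex.
have dF j (s : R) : (j < n.*2)%N -> is_derive s (1 : R) (F j.+1) (F j.+2 s).
  by move=> jn; apply: is_derive_trigF; lia.
move=> /(_ dF (FB n.*2.+1) n0) /le_trans; apply.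
have -> : e^-1 * (3 * ((2 * K%:R) ^+ n.*2.+1 * Q ^+ K * (n.*2%:R * e) ^+ n.*2 / (n.*2)`!%:R))
  = 2 * K%:R * (e^-1 * (3 * ((2 * K%:R) ^+ n.*2 * Q ^+ K * (n.*2%:R * e) ^+ n.*2 / (n.*2)`!%:R))).
  rewrite exprS; move: (_ ^+ n.*2) (Q ^+ K) (_ ^+ n.*2) => u v w; ring.
apply: le_trans (ler_wpM2l K0 key) _.
by rewrite ler_wpM2r.
Qed.

Lemma continuous_trigF (T : topologicalType) (al A B : T -> R) j a b g th (x : T) :
  {for x, continuous al} -> {for x, continuous A} -> {for x, continuous B} ->
  {for x, continuous (fun z => trigF (al z) (A z) (B z) j a b g th)}.
Proof.
move=> ca cA cB.
have cC (c : R) : {for x, continuous (fun _ : T => c)} by exact: cst_continuous.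
elim: j a b g => [|j IH] a b g /=.
  have cX (f : T -> R) k : {for x, continuous f} -> {for x, continuous (fun z => f z ^+ k)}.
    move=> cf; apply: (@continuous_comp _ _ _ f (fun t : R => t ^+ k)) => //.
    exact: exprn_continuous.
  have cq : {for x, continuous (fun z => trigq (al z) (A z) (B z) th)}.
    by rewrite /trigq; apply: continuousD => //; apply: continuousD; apply: continuousM.
  have cv : {for x, continuous (fun z => trigv (A z) (B z) th)}.
    by rewrite /trigv; apply: continuousB; apply: continuousM.
  apply: continuousM; last exact: cX.
  apply: continuousM; apply: cX => //.
  exact: continuous_max.
by apply: continuousD; apply: continuousM => //; apply: continuousB.
Qed.

End trig_numdiff.

(** * The mean value property *)

Section calculus.
Context {R : realType}.
Implicit Types n : nat.

Lemma is_derive_curve n (f : 'rV[R]_n -> R) (ga : R -> 'rV[R]_n) (v : 'rV[R]_n) (t : R) :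
  (forall i, is_derive t (1 : R) (fun s => ga s ord0 i) (v ord0 i)) -> differentiable f (ga t) ->
  is_derive t (1 : R) (fun s => f (ga s)) (\sum_i v ord0 i * pd i f (ga t)).
Proof.
move=> Hg Hf.
have dg : derivable ga t 1.
  by apply/derivable_mxP => i j; rewrite ord1; have [] := Hg j.
have Dg : differentiable ga t by apply/derivable1_diffP.
have vE : 'd ga t 1 = v.
  rewrite -deriveE // derive_mx //; apply/rowP => j; rewrite mxE.
  by have [_ <-] := Hg j.
apply: DeriveDef; first by apply/derivable1_diffP; apply: (differentiable_comp (f := ga) (g := f)).
rewrite deriveE; last by apply: (differentiable_comp (f := ga) (g := f)).
rewrite (diff_comp (f := ga) (g := f)) //= vE.
rewrite {1}(row_sum_delta v) linear_sum; apply: eq_bigr => j _.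
rewrite (_ : delta_mx 0 j = evec R j); last by apply/rowP => k; rewrite !mxE eq_sym.
by rewrite /pd (deriveE _ Hf) linearZ.
Qed.

Lemma continuous_rV_affine n (s : R) (b : 'rV[R]_n) : continuous (fun y : 'rV[R]_n => b + s *: y).
Proof.
move=> y; apply: continuousD; first exact: cst_continuous.
exact: scaler_continuous.
Qed.

Lemma mx_norm_le_enorm n (x : 'rV[R]_n) : `|x| <= enorm x.
Proof.
rewrite (_ : `|x| = mx_norm x) // mx_normrE; apply/bigmax_leP; split; first exact: enorm_ge0.
by move=> [i j] _ /=; rewrite ord1; exact: enorm_coord.
Qed.

Lemma bounded_on_ball n (f : 'rV[R]_n -> R) (Rad r : R) : r < Rad ->
  (forall x, eball 0 Rad x -> {for x, continuous f}) ->
  exists2 M : R, 0 <= M & forall x, enorm x <= r -> `|f x| <= M.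
Proof.
move=> rR cf; pose A := [set x : 'rV[R]_n | enorm x <= r].
have cA : compact A.
  apply: bounded_closed_compact.
    exists r; split; first exact: num_real.
    move=> M rM x /= Ax; apply: (le_trans (mx_norm_le_enorm x)).
    exact: le_trans Ax (ltW rM).
  rewrite (_ : A = @enorm R n @^-1` [set t | t <= r]) //.
  apply: closed_comp; last exact: closed_le.
  by move=> x _; exact: continuous_enorm.
have cfA : {within A, continuous f}.
  apply: continuous_in_subspaceT => x; rewrite inE => Ax; apply: cf.
  by rewrite /eball /= subr0; exact: le_lt_trans Ax rR.
have [M [_ HM]] := compact_bounded (continuous_compact cfA cA).
exists (`|M| + 1); first by rewrite addr_ge0.
move=> x xr; apply: (HM (`|M| + 1)); last by exists x.
by rewrite ltr_pwDr // ler_norm.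
Qed.

Lemma measurable_cont_support n (U : set 'rV[R]_n) (f : 'rV[R]_n -> R) : open U ->
  (forall x, U x -> {for x, continuous f}) -> (forall x, ~ U x -> f x = 0) -> measurable_fun setT f.
Proof.
move=> oU cf f0; rewrite (_ : f = f \_ U).
  apply/(measurable_restrictT _ (open_measurable_rV oU)).
  exact: continuous_measurable_rV.
apply/funext => x; rewrite patchE; case: ifPn => // /negP H; rewrite f0 // => Ux; apply: H; exact/mem_set.
Qed.

(** Boundedness and bounded support give integrability, and the class is stable under all operations
    used below. *)
Definition nice n (f : 'rV[R]_n -> R) := measurable_fun setT f /\
  exists M r : R, [/\ 0 <= M, 0 < r, (forall x, `|f x| <= M) & (forall x, r <= enorm x -> f x = 0)].

Lemma integrable_indic_eball n (c : 'rV[R]_n) (r : R) : 0 < r ->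
  (lam n).-integrable setT (fun x => (\1_(eball c r) x)%:E).
Proof.
move=> r0; apply/integrableP; split.
  by apply/measurable_EFinP; apply: measurable_indic; exact: measurable_eball.
rewrite (eq_integral (fun x => (\1_(eball c r) x)%:E)); last first.
  by move=> x _; rewrite gee0_abs // lee_fin.
rewrite integral_indic //; last exact: measurable_eball.
by rewrite setIT; move: (ltry (r ^+ n * vball n)); rewrite -(lam_eball c r0); exact.
Qed.

Lemma nice_integrable n (f : 'rV[R]_n -> R) : nice f -> (lam n).-integrable setT (EFin \o f).
Proof.
move=> [mf [M [r [M0 r0 fM fr]]]].
have mB : measurable (eball (0 : 'rV[R]_n) r) by exact: measurable_eball.
apply: (@le_integrable _ _ _ (lam n) setT measurableT _ (EFin \o (fun x => M * \1_(eball (0 : 'rV[R]_n) r) x))).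
- exact/measurable_EFinP.
- move=> x _ /=; have i0 : 0 <= M * \1_(eball (0 : 'rV[R]_n) r) x by rewrite mulr_ge0.
  rewrite lee_fin (ger0_norm i0).
  rewrite indicE; case: (boolP (x \in eball 0 r)) => [_|]; first by rewrite mulr1.
  move/negP => H; rewrite fr ?normr0 ?mulr0 //.
  by rewrite leNgt; apply/negP => xr; apply: H; rewrite inE /eball /= subr0.
- rewrite (_ : EFin \o _ = fun x : 'rV[R]_n => (M%:E * (\1_(eball (0 : 'rV[R]_n) r) x)%:E)%E); last first.
    by apply/funext => x; rewrite /= EFinM.
  apply: integrableZl => //; exact: integrable_indic_eball.
Qed.

Notation I n f := (Rintegral (lam n) setT f).

Lemma niceD n (f g : 'rV[R]_n -> R) : nice f -> nice g -> nice (fun x => f x + g x).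
Proof.
move=> [mf [M [r [M0 r0 fM fr]]]] [mg [M' [r' [M0' r0' gM gr]]]]; split; first exact: measurable_funD.
exists (M + M'), (r + r'); split; [exact: addr_ge0|exact: addr_gt0| |].
  by move=> x; apply: le_trans (ler_normD _ _) _; apply: lerD.
by move=> x xr; rewrite fr ?gr ?addr0 //; apply: le_trans xr; rewrite ?lerDl ?lerDr ltW.
Qed.

Lemma niceZ n (a : R) (f : 'rV[R]_n -> R) : nice f -> nice (fun x => a * f x).
Proof.
move=> [mf [M [r [M0 r0 fM fr]]]]; split; first exact: measurable_funM.
exists (`|a| * M), r; split => //; first exact: mulr_ge0.
  by move=> x; rewrite normrM ler_wpM2l.
by move=> x xr; rewrite fr ?mulr0.
Qed.

Lemma nice_sum n (J : Type) (s : seq J) (P : pred J) (f : J -> 'rV[R]_n -> R) :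
  (forall j, nice (f j)) -> nice (fun x => \sum_(j <- s | P j) f j x).
Proof.
move=> nf; elim: s => [|j s IH].
  rewrite (_ : (fun x => _) = cst 0); last by apply/funext => x; rewrite big_nil.
  by split => //; exists 0, 1; split => // x; rewrite normr0.
case Pj : (P j).
  rewrite (_ : (fun x => _) = fun x => f j x + \sum_(k <- s | P k) f k x); first exact: niceD.
  by apply/funext => x; rewrite big_cons Pj.
rewrite (_ : (fun x => _) = fun x => \sum_(k <- s | P k) f k x) //.
by apply/funext => x; rewrite big_cons Pj.
Qed.

Lemma nice_pos n (f : 'rV[R]_n -> R) : nice f -> nice (fun x => Num.max (f x) 0).
Proof.
move=> [mf [M [r [M0 r0 fM fr]]]]; split; first exact: measurable_maxr.
exists M, r; split => // x; last by move=> xr; rewrite fr ?maxxx.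
rewrite ger0_norm; last by rewrite le_max lexx orbT.
by rewrite ge_max M0 andbT (le_trans (ler_norm _) (fM x)).
Qed.

Lemma nice_affine n (a : R) (b : 'rV[R]_n) (f : 'rV[R]_n -> R) : 0 < a -> nice f -> nice (fun x => f (a *: x + b)).
Proof.
move=> a0 [mf [M [r [M0 r0 fM fr]]]]; split.
  exact: (measurableT_comp mf (measurable_rV_affine a b)).
exists M, ((r + enorm b) / a); split => //.
  by rewrite divr_gt0 // ltr_pwDl ?enorm_ge0.
move=> x; rewrite ler_pdivrMr // => H; apply: fr.
have := enormD (a *: x + b) (- b); rewrite addrK enormN enormZ gtr0_norm //; lra.
Qed.

Lemma I_D n (f g : 'rV[R]_n -> R) : nice f -> nice g -> I n (fun x => f x + g x) = I n f + I n g.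
Proof. by move=> nf ng; apply: RintegralD => //; exact: nice_integrable. Qed.

Lemma I_Z n a (f : 'rV[R]_n -> R) : nice f -> I n (fun x => a * f x) = a * I n f.
Proof. by move=> nf; apply: RintegralZl => //; exact: nice_integrable. Qed.

Lemma I_sum n (J : Type) (s : seq J) (f : J -> 'rV[R]_n -> R) :
  (forall j, nice (f j)) -> I n (fun x => \sum_(j <- s) f j x) = \sum_(j <- s) I n (f j).
Proof.
move=> nf; elim: s => [|j s IH].
  rewrite big_nil (_ : (fun x => _) = cst 0); last by apply/funext => x; rewrite big_nil.
  by rewrite /Rintegral integral0.
rewrite big_cons -IH -I_D //; last exact: nice_sum.
by congr (Rintegral _ _ _); apply/funext => x; rewrite big_cons.
Qed.

Lemma I_affine n (a : R) (b : 'rV[R]_n) (f : 'rV[R]_n -> R) : 0 < a -> nice f ->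
  a ^+ n * I n (fun x => f (a *: x + b)) = I n f.
Proof.
move=> a0 nf.
have pos g : nice g -> (forall x, 0 <= g x) -> a ^+ n * I n (fun x => g (a *: x + b)) = I n g.
  move=> ng g0; rewrite /Rintegral -(@ge0_lam_affine R n (PosNum a0) b (fun x => (g x)%:E)).
  - rewrite fineM //; apply: integrable_fin_num => //.
    by apply: nice_integrable; exact: nice_affine.
  - by apply/measurable_EFinP; have [] := ng.
  - by move=> x; rewrite lee_fin.
have nN : nice (fun x => -1 * f x) by exact: niceZ.
have dec (g : 'rV[R]_n -> R) x : g x = Num.max (g x) 0 + -1 * Num.max (-1 * g x) 0.
  by rewrite !mulN1r; case: (leP (g x) 0) => h; [rewrite max_l ?oppr_ge0 //; ring|rewrite max_r ?oppr_le0 ?ltW //; ring].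
(* The change of variables is known for nonnegative functions, hence the splitting into positive and
   negative parts. *)
have E (g : 'rV[R]_n -> R) : nice g -> I n g = I n (fun x => Num.max (g x) 0) - I n (fun x => Num.max (-1 * g x) 0).
  move=> ng; have n1 := nice_pos ng; have n2 := nice_pos (niceZ (-1) ng).
  rewrite -[X in _ - X]mul1r -mulNr -I_Z // -I_D //; last exact: niceZ.
  by congr (Rintegral _ _ _); apply/funext => x; exact: dec.
rewrite (E f) // (E (fun x => f (a *: x + b))); last exact: nice_affine.
rewrite mulrBr; congr (_ - _).
  by apply: (pos (fun x => Num.max (f x) 0)); [exact: nice_pos|move=> x; rewrite le_max lexx orbT].
by apply: (pos (fun x => Num.max (-1 * f x) 0)); [exact: nice_pos|move=> x; rewrite le_max lexx orbT].
Qed.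

Lemma continuous_ebump n k : continuous (fun y : 'rV[R]_n => Num.max (1 - enorm y ^+ 2) 0 ^+ k).
Proof.
move=> y; apply: (@continuous_comp _ _ _ (fun y : 'rV[R]_n => Num.max (1 - enorm y ^+ 2) 0) (fun t : R => t ^+ k)).
  apply: continuous_max; last exact: cst_continuous.
  apply: continuousB; first exact: cst_continuous.
  apply: (@continuous_comp _ _ _ (@enorm R n) (fun t : R => t ^+ 2)); first exact: continuous_enorm.
  exact: exprn_continuous.
exact: exprn_continuous.
Qed.

(** The shift keeps the exponent positive, hence the bump continuous and zero outside the unit ball.
    The gradient of [ebump k.+1] is a multiple of [y] times [ebump k], which is what the mean value
    property exploits. *)
Definition ebump n k (y : 'rV[R]_n) : R := Num.max (1 - enorm y ^+ 2) 0 ^+ k.+1.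

Lemma ebump_out n k (y : 'rV[R]_n) : 1 <= enorm y -> ebump k y = 0.
Proof.
move=> y1; rewrite /ebump max_r ?expr0n //.
by rewrite subr_le0 -(expr1n _ 2) ler_pXn2r ?nnegrE ?enorm_ge0.
Qed.

Lemma ebump_ge0 n k (y : 'rV[R]_n) : 0 <= ebump k y.
Proof. by rewrite exprn_ge0 // le_max lexx orbT. Qed.

Lemma ebump_le1 n k (y : 'rV[R]_n) : ebump k y <= 1.
Proof.
rewrite exprn_ile1 ?le_max ?lexx ?orbT // ge_max ler01 andbT.
by rewrite gerBl sqr_ge0.
Qed.

Lemma nice_mul_ebump n k (f : 'rV[R]_n -> R) (M : R) :
  (forall y, enorm y < 1 -> {for y, continuous f}) -> (forall y, enorm y < 1 -> `|f y| <= M) ->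
  nice (fun y => f y * ebump k y).
Proof.
move=> cf fM; split.
  apply: (@measurable_cont_support n (eball 0 1)); first exact: open_eball.
    move=> x; rewrite /eball /= subr0 => x1; apply: continuousM; first exact: cf.
    exact: continuous_ebump.
  move=> x; rewrite /eball /= subr0 => /negP; rewrite -leNgt => x1.
  by rewrite ebump_out ?mulr0.
exists `|M|, 1; split => // x; last by move=> x1; rewrite ebump_out ?mulr0.
have [x1|x1] := ltP (enorm x) 1; last by rewrite ebump_out ?mulr0 ?normr0.
rewrite normrM (ger0_norm (ebump_ge0 k x)) -[leRHS]mulr1.
by apply: ler_pM => //; [exact: ebump_ge0|exact: le_trans (fM x x1) (ler_norm _)|exact: ebump_le1].
Qed.

(** The integral of [phi (y + t e_i)] does not depend on [t]; its derivative at [t = 0], taken under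
    the integral sign, is the integral of [psi]. *)
Lemma I_pd0 n (i : 'I_n) (phi psi : 'rV[R]_n -> R) : nice phi -> nice psi ->
  (forall y (t : R), is_derive t (1 : R) (fun t => phi (y + t *: evec R i)) (psi (y + t *: evec R i))) ->
  I n psi = 0.
Proof.
move=> nphi npsi D.
have nsh t : nice (fun y => phi (y + t *: evec R i)).
  have := nice_affine (t *: evec R i) ltr01 nphi; rewrite (_ : (fun x => _) = fun y => phi (y + t *: evec R i)) //.
  by apply/funext => x; rewrite scale1r.
have [mpsi [M [r [M0 r0 HM Hr]]]] := npsi.
have e1 : enorm (evec R i : 'rV[R]_n) = 1.
  apply/eqP; rewrite -(eqrXn2 (ltn0Sn 1)) ?enorm_ge0 // sqr_enorm expr1n (bigD1 i) //= big1 => [|j ji].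
    by rewrite addr0 mxE eqxx expr1n.
  by rewrite mxE eq_sym (negbTE ji) expr0n.
(* A common majorant for [|t| < 1]: such translations enlarge the support by at most one. *)
pose G (y : 'rV[R]_n) := M * \1_(eball (0 : 'rV[R]_n) (r + 1)) y.
have iG : (lam n).-integrable setT (EFin \o G).
  rewrite (_ : EFin \o _ = fun x : 'rV[R]_n => (M%:E * (\1_(eball (0 : 'rV[R]_n) (r + 1)) x)%:E)%E); last first.
    by apply/funext => x; rewrite /= EFinM.
  by apply: integrableZl => //; apply: integrable_indic_eball; rewrite addr_gt0.
have dE (t : R) y : partial1of2 (fun t y => phi (y + t *: evec R i)) t y = psi (y + t *: evec R i).
  by rewrite partial1of2E; have [_ ->] := D y t.
have := @differentiation_under_integral R _ _ (lam n) (fun (t : R) y => phi (y + t *: evec R i)) setT measurableT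
  0 (-1) 1 _ _ _ G _ iG _.
rewrite /= (_ : (fun x' : R => _) = cst (I n phi)); last first.
  apply/funext => t; rewrite -[RHS](I_affine (t *: evec R i) ltr01) // expr1n mul1r.
  by apply: eq_Rintegral => x _; rewrite scale1r.
rewrite derive1_cst => ->.
- by apply: eq_Rintegral => x _; rewrite dE scale0r addr0.
- by rewrite in_itv /= ltrN10 ltr01.
- by move=> t _; exact: nice_integrable.
- by move=> t y _ _; have [] := D y t.
- by move=> y; rewrite /G mulr_ge0.
move=> t y; rewrite in_itv /= => t1 _; rewrite dE /G indicE.
case: (boolP (y \in _)) => [_|]; first by rewrite mulr1.
move/negP => H; rewrite Hr ?normr0 ?mulr0 //.
have : r + 1 <= enorm y by rewrite leNgt; apply/negP => h; apply: H; rewrite inE /eball /= subr0.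
have := enormD (y + t *: evec R i) (- (t *: evec R i)); rewrite addrK enormN enormZ e1 mulr1.
have : `|t| < 1 by rewrite ltr_norml.
lra.
Qed.

End calculus.

(** * Mean values against a radial bump *)

Section mean_value.
Context {R : realType} (n : nat) (Rad : R) (h : 'rV[R]_n -> R).
Hypothesis hH : harmonic_on (eball 0 Rad) h.
Notation I n f := (Rintegral (lam n) setT f).

Lemma eball0E (x : 'rV[R]_n) r : eball 0 r x = (enorm x < r) :> Prop.
Proof. by rewrite /eball /= subr0. Qed.

Lemma harmonic_continuous x : enorm x < Rad -> {for x, continuous h}.
Proof.
rewrite -eball0E => /hH[dh _ _ _]; exact: differentiable_continuous.
Qed.

Lemma harmonic_continuous_pd i x : enorm x < Rad -> {for x, continuous (pd i h)}.
Proof.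
rewrite -eball0E => /hH[_ dh _ _]; exact: differentiable_continuous.
Qed.

Lemma bounded_on_ball0 (f : 'rV[R]_n -> R) (r : R) : r < Rad ->
  (forall x, enorm x < Rad -> {for x, continuous f}) ->
  exists2 M : R, 0 <= M & forall x, enorm x <= r -> `|f x| <= M.
Proof. by move=> rR cf; apply: (bounded_on_ball rR) => x; rewrite eball0E; exact: cf. Qed.

Lemma continuous_normf (f : 'rV[R]_n -> R) x : {for x, continuous f} -> {for x, continuous (fun y : 'rV[R]_n => `|f y|)}.
Proof. by move=> cf; apply: (@continuous_comp _ _ _ f (fun t : R => `|t|)) => //; exact: norm_continuous. Qed.

Lemma is_derive_ebump k (y : 'rV[R]_n) i (t : R) :
  is_derive t (1 : R) (fun t : R => ebump k.+1 (y + t *: evec R i))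
    (- (2 * k.+2%:R) * (y + t *: evec R i) ord0 i * ebump k (y + t *: evec R i)).
Proof.
have ei : (evec R i : 'rV[R]_n) ord0 i = 1 by rewrite mxE eqxx.
have ei2 : \sum_(j < n) (evec R i : 'rV[R]_n) ord0 j ^+ 2 = 1.
  rewrite (bigD1 i) //= ei expr1n big1 ?addr0 // => j ji.
  by rewrite mxE eq_sym (negbTE ji) expr0n.
have sq (s : R) : enorm (y + s *: evec R i) ^+ 2 = enorm y ^+ 2 + 2 * (s * y ord0 i) + s ^+ 2.
  rewrite enorm_sqrD edotZr enormZ exprMn real_normK ?num_real // (sqr_enorm (evec R i)) ei2 mulr1.
  rewrite /edot (bigD1 i) //= ei mulr1 big1 ?addr0 // => j ji.
  by rewrite mxE eq_sym (negbTE ji) mulr0.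
have D : is_derive t (1 : R) (fun s : R => 1 - enorm (y + s *: evec R i) ^+ 2) (- (2 * (y ord0 i + t))).
  apply: (@is_derive_of_quadratic _ _ _ _ 1) => // s _; rewrite !sq.
  have -> : 1 - (enorm y ^+ 2 + 2 * ((s + t) * y ord0 i) + (s + t) ^+ 2) -
     (1 - (enorm y ^+ 2 + 2 * (t * y ord0 i) + t ^+ 2)) - - (2 * (y ord0 i + t)) * s = - s ^+ 2 by ring.
  by rewrite normrN mul1r ger0_norm // sqr_ge0.
pose u (s : R) := 1 - enorm (y + s *: evec R i) ^+ 2.
have := @is_derive1_comp R _ u t _ _ (is_derive_pospart k (u t)) D.
rewrite -[_ ^+ k.+1]/(ebump k (y + t *: evec R i)) => H.
rewrite (_ : _ * ebump k _ = k.+2%:R * ebump k (y + t *: evec R i) * - (2 * (y ord0 i + t))) //.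
have -> : (y + t *: evec R i) ord0 i = y ord0 i + t by rewrite !mxE eqxx mulr1.
by ring.
Qed.

Lemma nice_ebump k : nice (@ebump R n k).
Proof.
split; first by apply: continuous_measurable_rV => [|x _]; [exact: openT|exact: continuous_ebump].
exists 1, 1; split => // x; last exact: ebump_out.
by rewrite ger0_norm ?ebump_ge0 // ebump_le1.
Qed.

(** The left side, as a function of [rho], has derivative the integral of [y . grad h (x + rho y)]
    times [ebump k]. As [y ebump k] is a multiple of the gradient of [ebump k.+1], an integration by
    parts turns this into the Laplacian of [h], which vanishes. No integral over spheres enters. *)
Lemma mean_value k x (rho : R) : 0 <= rho -> enorm x + rho < Rad ->
  I n (fun y : 'rV[R]_n => h (x + rho *: y) * ebump k y) = I n (@ebump R n k) * h x.
Proof.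
move=> rho0 xr.
(* The margin lets [s] range over an open interval containing [[0, rho]], as differentiation under
   the integral requires. *)
pose dl := (Rad - enorm x - rho) / 2.
have dl0 : 0 < dl by rewrite /dl; lra.
pose r1 := rho + dl.
have r10 : 0 < r1 by rewrite /r1; lra.
have xr1 : enorm x + r1 < Rad by rewrite /r1 /dl; lra.
have dom (s : R) (y : 'rV[R]_n) : `|s| < r1 -> enorm y <= 1 -> enorm (x + s *: y) <= enorm x + r1.
  move=> s1 y1; apply: le_trans (enormD _ _) _; rewrite enormZ lerD2l -[leRHS]mulr1.
  by apply: ler_pM => //; [exact: enorm_ge0|exact: ltW].
have [M0 M00 HM0] := bounded_on_ball0 xr1 harmonic_continuous.
have [M1 M10 HM1] : exists2 M : R, 0 <= M & forall z, enorm z <= enorm x + r1 -> `|\sum_i `|pd i h z| | <= M.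
  apply: bounded_on_ball0 => // z zR; apply: continuous_sum => i.
  by apply: continuous_normf; exact: harmonic_continuous_pd.
have [M2 M20 HM2] : exists2 M : R, 0 <= M & forall z, enorm z <= enorm x + r1 -> `|\sum_i `|pd i (pd i h) z| | <= M.
  apply: bounded_on_ball0 => // z zR; apply: continuous_sum => i.
  by apply: continuous_normf; move: zR; rewrite -eball0E => /hH[_ _ + _]; apply.
have sum1 (f : 'I_n -> R) i : `|f i| <= `|\sum_j `|f j| |.
  have S0 : 0 <= \sum_j `|f j| by apply: sumr_ge0.
  by rewrite (ger0_norm S0) (bigD1 i) //= lerDl sumr_ge0.
have caff (s : R) (f : 'rV[R]_n -> R) (y : 'rV[R]_n) : {for (x + s *: y), continuous f} -> {for y, continuous (fun y : 'rV[R]_n => f (x + s *: y))}.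
  move=> cf; apply: (@continuous_comp _ _ _ (fun y : 'rV[R]_n => x + s *: y) f) => //.
  exact: continuous_rV_affine.
pose G (s : R) (y : 'rV[R]_n) : R := (\sum_i y ord0 i * pd i h (x + s *: y)) * ebump k y.
have nf (s : R) : `|s| < r1 -> nice (fun y : 'rV[R]_n => h (x + s *: y) * ebump k y).
  move=> s1; apply: (@nice_mul_ebump R n _ _ (M0)) => y y1.
    by apply: caff; apply: harmonic_continuous; apply: le_lt_trans (dom _ _ s1 (ltW y1)) xr1.
  by apply: HM0; exact: dom (ltW y1).
have GM (s : R) (y : 'rV[R]_n) : `|s| < r1 -> enorm y < 1 -> `|\sum_i y ord0 i * pd i h (x + s *: y)| <= M1.
  move=> s1 y1; apply: le_trans (HM1 _ (dom _ _ s1 (ltW y1))).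
  have S0 : 0 <= \sum_i `|pd i h (x + s *: y)| by apply: sumr_ge0.
  rewrite (ger0_norm S0); apply: le_trans (ler_norm_sum _ _ _) _.
  apply: ler_sum => i _; rewrite normrM -[leRHS]mul1r ler_wpM2r //.
  exact: le_trans (enorm_coord y i) (ltW y1).
have coordC i (y : 'rV[R]_n) : {for y, continuous (fun y : 'rV[R]_n => y ord0 i)} by exact: coord_continuous.
have nG (s : R) : `|s| < r1 -> nice (G s).
  move=> s1; apply: (@nice_mul_ebump R n _ _ (M1)) => y y1; last exact: GM.
  apply: continuous_sum => i; apply: continuousM; first exact: coordC.
  by apply: caff; apply: harmonic_continuous_pd; apply: le_lt_trans (dom _ _ s1 (ltW y1)) xr1.
have IG (s : R) : `|s| < r1 -> I n (G s) = 0.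
  move=> s1.
  pose phi i (y : 'rV[R]_n) : R := pd i h (x + s *: y) * ebump k.+1 y.
  (* The [i]-th partial derivative of [phi i]; in the sum over [i] the Laplacian drops out and a
     nonzero multiple of [G s] remains. *)
  pose psi i (y : 'rV[R]_n) : R := (s * pd i (pd i h) (x + s *: y)) * ebump k.+1 y
      + (- (2 * k.+2%:R) * y ord0 i * pd i h (x + s *: y)) * ebump k y.
  have nphi i : nice (phi i).
    apply: (@nice_mul_ebump R n _ _ (M1)) => y y1.
      by apply: caff; apply: harmonic_continuous_pd; apply: le_lt_trans (dom _ _ s1 (ltW y1)) xr1.
    by apply: le_trans (HM1 _ (dom _ _ s1 (ltW y1))); exact: (sum1 (fun i => pd i h _)).
  have npsi i : nice (psi i).
    apply: niceD.
      apply: (@nice_mul_ebump R n _ _ (`|s| * M2)) => y y1.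
        apply: continuousM; first exact: cst_continuous.
        apply: caff; have : enorm (x + s *: y) < Rad by apply: le_lt_trans (dom _ _ s1 (ltW y1)) xr1.
        by rewrite -eball0E => /hH[_ _ + _]; apply.
      rewrite normrM ler_wpM2l //.
      by apply: le_trans (HM2 _ (dom _ _ s1 (ltW y1))); exact: (sum1 (fun i => pd i (pd i h) _)).
    apply: (@nice_mul_ebump R n _ _ (`|2 * k.+2%:R| * M1)) => y y1.
      apply: continuousM.
        by apply: continuousM; [exact: cst_continuous|exact: coordC].
      by apply: caff; apply: harmonic_continuous_pd; apply: le_lt_trans (dom _ _ s1 (ltW y1)) xr1.
    rewrite !normrM -mulrA normrN normrM ler_wpM2l ?mulr_ge0 // -[leRHS]mul1r.
    apply: ler_pM => //; first exact: le_trans (enorm_coord y i) (ltW y1).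
    by apply: le_trans (HM1 _ (dom _ _ s1 (ltW y1))); exact: (sum1 (fun i => pd i h _)).
  have D i (y : 'rV[R]_n) (t : R) : is_derive t (1 : R) (fun t : R => phi i (y + t *: evec R i)) (psi i (y + t *: evec R i)).
    pose z := y + t *: evec R i.
    have [zR|zR] := ltP (enorm (x + s *: z)) Rad.
      have Dh : is_derive t (1 : R) (fun t : R => pd i h (x + s *: (y + t *: evec R i))) (s * pd i (pd i h) (x + s *: z)).
        have -> : s * pd i (pd i h) (x + s *: z) = \sum_j (s *: evec R i) ord0 j * pd j (pd i h) (x + s *: z).
          rewrite (bigD1 i) //= big1 => [|j ji]; last by rewrite !mxE eq_sym (negbTE ji) mulr0 mul0r.
          by rewrite !mxE eqxx mulr1 addr0.
        apply: (is_derive_curve (ga := fun t : R => x + s *: (y + t *: evec R i))); last first.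
          by move: zR; rewrite -eball0E => /hH[_ + _ _]; apply.
        move=> j; apply: (@is_derive_of_quadratic _ _ _ _ 0) => // u _; rewrite !mxE mul0r.
        by rewrite le_eqVlt normr_eq0; apply/orP; left; apply/eqP; ring.
      have Db := is_derive_ebump k y i t.
      apply: (is_derive_eq (is_deriveM Dh Db)); rewrite /psi -/z.
      by rewrite /GRing.scale /= -/z; ring.
    (* Where [x + s z] leaves the ball of harmonicity, [z] is outside the closed unit ball, and the
       bump vanishes near it whatever [h] does there. *)
    have z1 : 1 < enorm z.
      rewrite ltNge; apply/negP => z1; have := le_lt_trans (dom _ _ s1 z1) xr1.
      by rewrite ltNge zR.
    have -> : psi i (y + t *: evec R i) = 0 by rewrite /psi -/z !ebump_out ?(ltW z1) // !mulr0 addr0.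
    apply: (near_eq_is_derive (f := cst 0)) => //.
    have cz : {for t, continuous (fun t : R => enorm (y + t *: evec R i))}.
      apply: (@continuous_comp _ _ _ (fun t : R => y + t *: evec R i) (@enorm R n)); last exact: continuous_enorm.
      apply: continuousD; first exact: cst_continuous.
      exact: scalel_continuous.
    have : \forall u \near t, 1 < enorm (y + u *: evec R i) by apply: (cz [set u | 1 < u]); apply: open_nbhs_nbhs; split; [exact: open_gt|exact: z1].
    by apply: filterS => u u1; rewrite /phi ebump_out ?mulr0 // ltW.
  have S0 : I n (fun y : 'rV[R]_n => \sum_i psi i y) = 0.
    by rewrite I_sum // big1 // => i _; exact: (I_pd0 (nphi i) (npsi i) (D i)).
  have SE : (fun y : 'rV[R]_n => \sum_i psi i y) = fun y : 'rV[R]_n => - (2 * k.+2%:R) * G s y.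
    apply/funext => y; rewrite /psi big_split /= /G -mulr_suml -mulr_sumr.
    have -> : (s * \sum_i pd i (pd i h) (x + s *: y)) * ebump k.+1 y = 0.
      have [y1|y1] := ltP (enorm y) 1; last by rewrite ebump_out // mulr0.
      have : enorm (x + s *: y) < Rad by apply: le_lt_trans (dom _ _ s1 (ltW y1)) xr1.
      by rewrite -eball0E => /hH[_ _ _ ->]; rewrite mulr0 mul0r.
    by rewrite add0r mulr_suml mulr_sumr; apply: eq_bigr => i _; ring.
  move: S0; rewrite SE I_Z; last exact: nG.
  by move/eqP; rewrite mulf_eq0 oppr_eq0 mulf_eq0 !pnatr_eq0 /= => /eqP.
pose A (s : R) : R := I n (fun y : 'rV[R]_n => h (x + s *: y) * ebump k y).
have in_r1 (s : R) : - dl < s -> s < r1 -> `|s| < r1.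
  by move=> a b; rewrite ltr_norml b andbT; apply: le_lt_trans a; rewrite /r1; lra.
have dE (s : R) (y : 'rV[R]_n) : `|s| < r1 -> is_derive s (1 : R) (fun s : R => h (x + s *: y) * ebump k y) (G s y).
  move=> s1; have [y1|y1] := ltP (enorm y) 1; last first.
    rewrite /G ebump_out // mulr0 (_ : (fun s : R => _) = cst 0); last by apply/funext => u; rewrite mulr0.
    exact: is_derive_cst.
  have Dh : is_derive s (1 : R) (fun s : R => h (x + s *: y)) (\sum_i y ord0 i * pd i h (x + s *: y)).
    apply: (is_derive_curve (ga := fun s : R => x + s *: y)); last first.
      have : enorm (x + s *: y) < Rad by apply: le_lt_trans (dom _ _ s1 (ltW y1)) xr1.
      by rewrite -eball0E => /hH[+ _ _ _]; apply.
    move=> j; apply: (@is_derive_of_quadratic _ _ _ _ 0) => // u _; rewrite !mxE mul0r.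
    by rewrite le_eqVlt normr_eq0; apply/orP; left; apply/eqP; ring.
  apply: (is_derive_eq (is_deriveM Dh (is_derive_cst (ebump k y) s 1))).
  by rewrite scaler0 add0r /GRing.scale /= mulrC.
pose GG (y : 'rV[R]_n) := M1 * \1_(eball (0 : 'rV[R]_n) 1) y.
have iGG : (lam n).-integrable setT (EFin \o GG).
  rewrite (_ : EFin \o _ = fun x : 'rV[R]_n => (M1%:E * (\1_(eball (0 : 'rV[R]_n) 1) x)%:E)%E); last first.
    by apply/funext => z; rewrite /= EFinM.
  by apply: integrableZl => //; apply: integrable_indic_eball.
have dA (s : R) : - dl < s -> s < r1 -> is_derive s (1 : R) A 0.
  move=> sa sb.
  have Is : `] - dl, r1[%classic s by rewrite /= in_itv /= sa sb.
  have H1 (u : R) : `] - dl, r1[%classic u -> (lam n).-integrable setT (EFin \o (fun y : 'rV[R]_n => h (x + u *: y) * ebump k y)).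
    rewrite /= in_itv /= => /andP[ua ub]; apply: nice_integrable; apply: nf; exact: in_r1.
  have H2 (u : R) (y : 'rV[R]_n) : `] - dl, r1[%classic u -> setT y -> derivable (fun u : R => h (x + u *: y) * ebump k y) u 1.
    by rewrite /= in_itv /= => /andP[ua ub] _; have [] := dE u y (in_r1 _ ua ub).
  have H3 (y : 'rV[R]_n) : 0 <= GG y by rewrite /GG mulr_ge0.
  have H4 (u : R) (y : 'rV[R]_n) : `] - dl, r1[%classic u -> setT y ->
     `|partial1of2 (fun (u : R) (y : 'rV[R]_n) => h (x + u *: y) * ebump k y) u y| <= GG y.
    rewrite /= in_itv /= => /andP[ua ub] _; have u1 := in_r1 _ ua ub.
    rewrite partial1of2E; have [_ ->] := dE u y u1.
    rewrite /GG indicE /G; case: (boolP (y \in _)) => [|/negP H].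
      rewrite inE eball0E => y1; rewrite normrM mulr1 -[leRHS]mulr1.
      by apply: ler_pM => //; [exact: GM|rewrite ger0_norm ?ebump_ge0 // ebump_le1].
    rewrite ebump_out ?mulr0 ?normr0 // leNgt; apply/negP => y1; apply: H.
    by rewrite inE eball0E.
  have F := @differentiation_under_integral R _ _ (lam n) (fun (u : R) (y : 'rV[R]_n) => h (x + u *: y) * ebump k y) setT measurableT
    s (- dl) r1 Is H1 H2 GG H3 iGG H4.
  apply: DeriveDef.
    exact: (@derivable_under_integral R _ _ (lam n) (fun (u : R) (y : 'rV[R]_n) => h (x + u *: y) * ebump k y) setT measurableT
      s (- dl) r1 Is H1 H2 GG H3 iGG H4).
  rewrite -derive1E F -(IG s (in_r1 _ sa sb)); apply: eq_Rintegral => y _.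
  by rewrite partial1of2E; have [_ ->] := dE s y (in_r1 _ sa sb).
have A0 : A 0 = I n (@ebump R n k) * h x.
  rewrite /A mulrC -I_Z.
    by apply: eq_Rintegral => y _; rewrite scale0r addr0.
  exact: nice_ebump.
rewrite -A0 -/(A rho).
move: rho0; rewrite le_eqVlt => /orP[/eqP <- //|rho0].
have D (s : R) : s \in `]0, rho[ -> is_derive s (1 : R) A (cst 0 s).
  by rewrite in_itv /= => /andP[s0 s1]; apply: dA; rewrite /r1; lra.
have cA : {within `[0, rho], continuous A}.
  apply: derivable_within_continuous => s; rewrite in_itv /= => /andP[s0 s1].
  by have [] : is_derive s (1 : R) A 0 by apply: dA; rewrite /r1; lra.
have [c _] := MVT rho0 D cA.
by rewrite /cst mul0r => /eqP; rewrite subr_eq0 => /eqP.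
Qed.

End mean_value.

(** * Representation of a harmonic function by a kernel *)

Section transfer.
Context {R : realType} (n : nat) (Rad : R) (h : 'rV[R]_n -> R).
Hypothesis hH : harmonic_on (eball 0 Rad) h.
Notation I n f := (Rintegral (lam n) setT f).

(** Nothing is known of [h] outside its ball of harmonicity; the cutoff is defined on the whole
    space and is [nice] there. *)
Definition cutoff (s : R) (z : 'rV[R]_n) : R := h z * \1_(eball (0 : 'rV[R]_n) s) z.

Lemma nice_restrict (f : 'rV[R]_n -> R) (s : R) : 0 < s -> s < Rad ->
  (forall x, enorm x < Rad -> {for x, continuous f}) ->
  nice (fun z => f z * \1_(eball (0 : 'rV[R]_n) s) z).
Proof.
move=> s0 sR cf; have [M M0 HM] := bounded_on_ball sR (fun x (xR : eball 0 Rad x) => cf x (eq_ind _ id xR _ (eball0E x Rad))).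
have out z : s <= enorm z -> f z * \1_(eball (0 : 'rV[R]_n) s) z = 0.
  move=> sz; rewrite indicE memNset ?mulr0 // eball0E.
  by apply/negP; rewrite -leNgt.
split; last first.
  exists M, s; split => // z; have [zs|zs] := ltP (enorm z) s; last by rewrite out // normr0.
  rewrite normrM -[leRHS]mulr1; apply: ler_pM => //; first exact/HM/ltW.
  by rewrite indicE; case: (_ \in _); rewrite ?normr1 ?normr0.
rewrite (_ : (fun z => _) = f \_ (eball (0 : 'rV[R]_n) s)).
  apply/(measurable_restrictT _ (measurable_eball _ _)).
  apply: continuous_measurable_rV; first exact: open_eball.
  by move=> z; rewrite eball0E => zs; apply: cf; exact: lt_trans sR.
by apply/funext => z; rewrite patchE indicE; case: (z \in _); rewrite ?mulr1 ?mulr0.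
Qed.

Lemma nice_cutoff (s : R) : 0 < s -> s < Rad -> nice (cutoff s).
Proof. by move=> s0 sR; apply: nice_restrict => // x; exact: harmonic_continuous. Qed.

Definition mass (s : R) : R := I n (fun z => `|cutoff s z|).

Lemma cutoff_out (s : R) z : s <= enorm z -> cutoff s z = 0.
Proof.
move=> sz; rewrite /cutoff indicE memNset ?mulr0 // eball0E.
by apply/negP; rewrite -leNgt.
Qed.

Lemma cutoff_in (s : R) z : enorm z < s -> cutoff s z = h z.
Proof. by move=> zs; rewrite /cutoff indicE mem_set ?mulr1 // eball0E. Qed.

Lemma nice_mul_cutoff (f : 'rV[R]_n -> R) (D : R) (s : R) : 0 < s -> s < Rad ->
  measurable_fun setT f -> (forall z, enorm z < s -> `|f z| <= D) -> nice (fun z => f z * cutoff s z).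
Proof.
move=> s0 sR mf fD; have [mc [M [r [M0 r0 HM Hr]]]] := nice_cutoff s0 sR.
split; first exact: measurable_funM.
exists (`|D| * M), r; split => //; first exact: mulr_ge0.
  move=> z; have [zs|zs] := ltP (enorm z) s; last by rewrite cutoff_out // mulr0 normr0 mulr_ge0.
  by rewrite normrM; apply: ler_pM => //; exact: le_trans (fD z zs) (ler_norm _).
by move=> z zr; rewrite Hr // mulr0.
Qed.

Lemma nice_norm (f : 'rV[R]_n -> R) : nice f -> nice (fun z => `|f z|).
Proof.
move=> [mf [M [r [M0 r0 HM Hr]]]]; split; first exact: measurableT_comp.
exists M, r; split => // z; first by rewrite normr_id.
by move=> zr; rewrite Hr // normr0.
Qed.

Lemma I_le (f g : 'rV[R]_n -> R) : nice f -> nice g -> (forall z, f z <= g z) -> I n f <= I n g.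
Proof. by move=> nf ng fg; apply: le_Rintegral => //; exact: nice_integrable. Qed.

Lemma I_norm_le (f g : 'rV[R]_n -> R) : nice f -> nice g -> (forall z, `|f z| <= g z) -> `|I n f| <= I n g.
Proof.
move=> nf ng fg; apply: le_trans (le_normr_Rintegral _ (nice_integrable nf)) _ => //.
by apply: I_le => //; exact: nice_norm.
Qed.

Lemma mass_ge0 s : 0 <= mass s.
Proof. by apply: Rintegral_ge0. Qed.

Lemma I_mul_cutoff_le (f : 'rV[R]_n -> R) (D : R) (s : R) : 0 < s -> s < Rad ->
  measurable_fun setT f -> (forall z, enorm z < s -> `|f z| <= D) ->
  `|I n (fun z => f z * cutoff s z)| <= D * mass s.
Proof.
move=> s0 sR mf fD.
have nc := nice_norm (nice_cutoff s0 sR).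
rewrite /mass -I_Z //; apply: I_norm_le; first exact: nice_mul_cutoff fD.
  exact: niceZ.
move=> z; rewrite normrM; have [zs|zs] := ltP (enorm z) s; last by rewrite cutoff_out // normr0 !mulr0.
by rewrite ler_wpM2r // fD.
Qed.

(** The mean value property after [z = x + rho y]. Now [x] occurs only in the kernel, so
    differentiating [h] at [x] means differentiating an explicit function. *)
Lemma kernel_rep k (x : 'rV[R]_n) (rho s : R) : 0 < rho -> enorm x + rho <= s -> s < Rad ->
  rho ^+ n * I n (@ebump R n k) * h x = I n (fun z => ebump k (rho^-1 *: (z - x)) * cutoff s z).
Proof.
move=> rho0 xs sR.
have xR : enorm x + rho < Rad by exact: le_lt_trans sR.
have s0 : 0 < s by apply: lt_le_trans xs; apply: ltr_wpDl => //; exact: enorm_ge0.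
pose f z := ebump k (rho^-1 *: (z - x)) * cutoff s z.
have mf : measurable_fun setT (fun z : 'rV[R]_n => ebump k (rho^-1 *: (z - x))).
  apply: continuous_measurable_rV => [|z _]; first exact: openT.
  apply: (@continuous_comp _ _ _ (fun z : 'rV[R]_n => rho^-1 *: (z - x)) (@ebump R n k)); last exact: continuous_ebump.
  rewrite (_ : (fun z : 'rV[R]_n => _) = fun z => (- (rho^-1 *: x)) + rho^-1 *: z); first exact: continuous_rV_affine.
  by apply/funext => u; rewrite scalerBr addrC.
have nf : nice f.
  apply: (@nice_mul_cutoff _ 1) => // z _.
  by rewrite ger0_norm ?ebump_ge0 // ebump_le1.
rewrite -mulrA -(mean_value hH k (ltW rho0) xR) -/f -(I_affine x rho0 nf); congr (_ * _).
apply: eq_Rintegral => y _; rewrite /f addrK scalerA mulVf ?gt_eqF // scale1r mulrC.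
have [y1|y1] := ltP (enorm y) 1; last by rewrite ebump_out // !mul0r.
rewrite cutoff_in ?(addrC x) //; apply: lt_le_trans xs.
apply: le_lt_trans (enormD _ _) _; rewrite addrC ltrD2l enormZ gtr0_norm //.
by rewrite -[ltRHS]mulr1 ltr_pM2l.
Qed.

(** On the half ball the base of the power is at least [3/4]. This bound decays geometrically in
    [k], a loss to be recovered from the accuracy of the scheme. *)
Lemma ebump_mass k : (3 / 4) ^+ k.+1 * (2^-1 ^+ n * vball n) <= I n (@ebump R n k).
Proof.
have nB : nice (fun y : 'rV[R]_n => \1_(eball (0 : 'rV[R]_n) 2^-1) y).
  split; first by apply: measurable_indic; exact: measurable_eball.
  exists 1, 2^-1; split => // y; first by rewrite indicE; case: (_ \in _); rewrite ?normr1 ?normr0.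
  by move=> y2; rewrite indicE memNset // eball0E; apply/negP; rewrite -leNgt.
have -> : 2^-1 ^+ n * vball n = I n (fun y : 'rV[R]_n => \1_(eball (0 : 'rV[R]_n) 2^-1) y).
  rewrite /Rintegral integral_indic //; last exact: measurable_eball.
  by have := @lam_eball R n 0 2^-1; rewrite setIT invr_gt0 ltr0n => /(_ isT) => E; rewrite [X in fine X]E.
rewrite -I_Z //; apply: I_le; [exact: niceZ|exact: nice_ebump|].
move=> y; rewrite indicE; case: (boolP (y \in _)) => [|_]; last by rewrite mulr0 ebump_ge0.
rewrite inE eball0E mulr1 => y2; rewrite /ebump; apply: lerXn2r; rewrite ?nnegrE ?divr_ge0 //.
  by rewrite le_max lexx orbT.
rewrite le_max; apply/orP; left.
have : enorm y ^+ 2 <= 2^-1 ^+ 2 by apply: lerXn2r; rewrite ?nnegrE ?enorm_ge0 ?invr_ge0 ?ltW.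
by rewrite expr2 => H; lra.
Qed.

Lemma ebump_mass_gt0 k : 0 < I n (@ebump R n k).
Proof.
apply: lt_le_trans (ebump_mass k); apply: mulr_gt0; first by rewrite exprn_gt0 // divr_gt0.
by rewrite mulr_gt0 ?vball_gt0 // exprn_gt0 // invr_gt0.
Qed.

(** The quadratic bound, uniform in [z], integrates to a quadratic bound for [c u] with slope the
    integral of [U1]; uniqueness of the derivative identifies that slope with [c u']. *)
Lemma rep_derive (c s : R) (u : R -> R) (th u' C : R) (U : R -> 'rV[R]_n -> R) (U1 : 'rV[R]_n -> R) :
  0 < s -> s < Rad -> 0 <= C ->
  is_derive th (1 : R) u u' ->
  (forall t, c * u t = I n (fun z => U t z * cutoff s z)) ->
  (forall t, measurable_fun setT (U t)) -> measurable_fun setT U1 ->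
  (forall t, exists D, forall z, enorm z < s -> `|U t z| <= D) ->
  (exists D, forall z, enorm z < s -> `|U1 z| <= D) ->
  (forall t z, enorm z < s -> `|U (t + th) z - U th z - U1 z * t| <= C * t ^+ 2) ->
  c * u' = I n (fun z => U1 z * cutoff s z).
Proof.
move=> s0 sR C0 Du rep mU mU1 bU [D1 bU1] quad.
have nU t : nice (fun z => U t z * cutoff s z).
  by have [D bD] := bU t; exact: nice_mul_cutoff bD.
have nU1 : nice (fun z => U1 z * cutoff s z) by exact: nice_mul_cutoff bU1.
have D1' : is_derive th (1 : R) (fun t => c * u t) (I n (fun z => U1 z * cutoff s z)).
  apply: (@is_derive_of_quadratic _ _ _ _ (C * mass s)); first by rewrite mulr_ge0 // mass_ge0.
  move=> t _; rewrite !rep.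
  have -> : I n (fun z => U (t + th) z * cutoff s z) - I n (fun z => U th z * cutoff s z) - I n (fun z => U1 z * cutoff s z) * t
     = I n (fun z => (U (t + th) z - U th z - U1 z * t) * cutoff s z).
    rewrite [_ * t]mulrC -!mulNr -[- I n (fun z => U th z * _)]mulN1r -!I_Z // -I_D //; last exact: niceZ.
    rewrite -I_D //; [|by apply: niceD => //; exact: niceZ|exact: niceZ].
    by apply: eq_Rintegral => z _; ring.
  rewrite mulrAC; apply: I_mul_cutoff_le => //.
    by apply: measurable_funB; [exact: measurable_funB|exact: measurable_funM].
  by move=> z zs; exact: quad.
have D2' : is_derive th (1 : R) (fun t => c * u t) (c * u').
  by have := is_deriveZ c Du.
by have [_ <-] := D1'; have [_ ->] := D2'.
Qed.

End transfer.

(** * Growth of the L2 norm *)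

Section polar.
Context {R : realType} (n : nat).
Notation mu := (@lebesgue_measure R).
Hypothesis n0 : (0 < n)%N.

Definition pball : set 'rV[R]_n := [set y | 0 < enorm y < 1].

Lemma enorm_eq0 (y : 'rV[R]_n) : enorm y = 0 -> y = 0.
Proof.
move=> y0; apply/rowP => i; rewrite mxE; apply/eqP; rewrite -normr_le0 -y0.
exact: enorm_coord.
Qed.

Lemma measurable_pball : measurable pball.
Proof.
rewrite (_ : pball = (@enorm R n) @^-1` `]0, 1[%classic); last first.
  by apply/seteqP; split=> y; rewrite /pball /= in_itv.
by rewrite -[X in measurable X]setTI; apply: measurable_enorm.
Qed.

Lemma measurable_origin : measurable [set (0 : 'rV[R]_n)].
Proof.
rewrite (_ : [set 0] = (@enorm R n) @^-1` [set 0]).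
  by rewrite -[X in measurable X]setTI; apply: measurable_enorm.
by apply/seteqP; split=> y /= => [->|/enorm_eq0 //]; rewrite enorm0.
Qed.

Lemma lam_origin : lam n [set (0 : 'rV[R]_n)] = 0%E.
Proof.
apply/eqP; rewrite eq_le measure_ge0 andbT.
apply/lee_addgt0Pr => e e0; rewrite add0e.
pose r : R := Num.min 1 (e / vball n).
have r0 : 0 < r by rewrite lt_min ltr01 divr_gt0 ?vball_gt0.
apply: (@le_trans _ _ (lam n (eball (0 : 'rV[R]_n) r))).
  apply: le_measure; rewrite ?inE.
  - exact: measurable_origin.
  - exact: measurable_eball.
  - by move=> y -> ; rewrite /eball /= subrr enorm0.
rewrite lam_eball // lee_fin.
apply: (@le_trans _ _ (r * vball n)).
  rewrite (ler_wpM2r (ltW (vball_gt0 n))) //.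
  have [n' ->] : exists n', n = n'.+1 by exists n.-1; rewrite prednK.
  rewrite exprS -[leRHS]mulr1 (ler_wpM2l (ltW r0)) //.
  by apply: exprn_ile1; [exact: ltW|rewrite ge_min lexx].
by rewrite -ler_pdivlMr ?vball_gt0 // ge_min lexx orbT.
Qed.

(** The cone formula for spheres integrates over the full ball, although [y / |y|] is meaningful
    only off the origin; the origin is null. *)
Lemma lam_pball (f : 'rV[R]_n -> \bar R) : measurable_fun setT f -> (forall x, (0 <= f x)%E) ->
  (\int[lam n]_y ((\1_(eball (0 : 'rV[R]_n) 1) y)%:E * f y) = \int[lam n]_y ((\1_pball y)%:E * f y))%E.
Proof.
move=> mf f0.
have aeE : {ae lam n, forall y, setT y -> ((\1_(eball (0 : 'rV[R]_n) 1) y)%:E * f y = (\1_pball y)%:E * f y)%E}.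
  exists [set (0 : 'rV[R]_n)]; split; [exact: measurable_origin|exact: lam_origin|].
  move=> y /= H; apply: contrapT => y0; apply: H => _; congr (_ * _)%E; congr EFin.
  rewrite !indicE; congr (_%:R); congr nat_of_bool; apply/idP/idP; rewrite !inE /eball /pball /= subr0.
    by move=> ->; rewrite andbT lt_def enorm_ge0 andbT; apply/eqP => /enorm_eq0.
  by move=> /andP[].
apply: ae_eq_integral aeE => //.
  apply: emeasurable_funM => //; apply/measurable_EFinP; apply: measurable_indic; exact: measurable_eball.
by apply: emeasurable_funM => //; apply/measurable_EFinP; apply: measurable_indic; exact: measurable_pball.
Qed.

(** In [polar_rays] this is the integral in [s] at [a = |z|], whose value cancels the factor
    [|z|^n]. *)
Lemma integral_inv_pow (a : R) : 0 < a ->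
  (\int[mu]_(s in `[a, +oo[) ((n%:R * s ^- n.+1)%:E) = (a ^- n)%:E)%E.
Proof.
move=> a0.
have D (s : R) : 0 < s -> is_derive s (1 : R) (fun s : R => - s ^- n) (n%:R * s ^- n.+1).
  move=> s0; have sn : s != 0 by rewrite gt_eqF.
  have Dn : is_derive s (1 : R) (fun s : R => s ^+ n) (n%:R * s ^+ n.-1).
    have := is_derive_monomial 1 s n.-1; rewrite prednK // mul1r.
    by rewrite (_ : (fun s0 : R => _) = fun s : R => s ^+ n) //; apply/funext => u; rewrite mul1r.
  have sn0 : s ^+ n != 0 by rewrite expf_neq0.
  apply: (is_derive_eq (is_deriveN (is_deriveV (f := fun s : R => s ^+ n) sn0 Dn))); rewrite /GRing.scale /=.
  rewrite mulNr opprK.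
  have [n' nE] : exists n', n = n'.+1 by exists n.-1; rewrite prednK.
  rewrite nE /= !exprS; move: (s ^+ n') (expf_neq0 n' sn) => u u0.
  by field; rewrite sn u0.
rewrite (@ge0_continuous_FTC2y _ _ (fun s : R => - s ^- n) a 0).
- by rewrite sub0e EFinN oppeK.
- by move=> s as_; rewrite mulr_ge0 // invr_ge0 exprn_ge0 // (le_trans (ltW a0)).
- apply: continuous_in_subspaceT => s; rewrite inE /= in_itv /= andbT => as_.
  have s0 : 0 < s by exact: lt_le_trans as_.
  change {for s, continuous (fun x : R => n%:R * (x ^+ n.+1)^-1)}.
  apply: continuousM; first exact: cst_continuous.
  apply: continuousV; first by rewrite expf_neq0 // gt_eqF.
  exact: exprn_continuous.
- apply/cvgrPdist_le => e e0; near=> s.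
  have s1 : 1 <= s by near: s; apply: nbhs_pinfty_ge; exact: num_real.
  have se : e^-1 <= s by near: s; apply: nbhs_pinfty_ge; exact: num_real.
  have s0 : 0 < s by exact: lt_le_trans s1.
  rewrite sub0r opprK ger0_norm ?invr_ge0 ?exprn_ge0 ?(ltW s0) //.
  apply: (@le_trans _ _ s^-1); last by rewrite -[e]invrK lef_pV2 ?posrE ?invr_gt0.
  rewrite lef_pV2 ?posrE ?exprn_gt0 //.
  have [n' nE] : exists n', n = n'.+1 by exists n.-1; rewrite prednK.
  by rewrite nE exprS -[leLHS]mulr1 ler_wpM2l ?(ltW s0) // exprn_ege1.
- by move=> s as_; have [] := D s (lt_trans a0 as_).
- apply: cvg_at_right_filter; apply: (@continuousN _ _ _ (fun x : R => (x ^+ n)^-1)).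
  apply: (@continuousV _ _ (fun x : R => x ^+ n)); first by rewrite expf_neq0 // gt_eqF.
  exact: exprn_continuous.
- move=> s; rewrite in_itv /= andbT => as_; rewrite derive1E.
  by have [_ ->] := D s (lt_trans a0 as_).
Unshelve. all: end_near. Qed.

Lemma measurable_enormV : measurable_fun setT (fun y : 'rV[R]_n => (enorm y)^-1).
Proof.
apply: (@measurable_cont_support R n [set y | 0 < enorm y]).
- rewrite (_ : [set y | 0 < enorm y] = (@enorm R n) @^-1` [set t | 0 < t]) //.
  by apply: open_comp; [move=> y _; exact: continuous_enorm|exact: open_gt].
- move=> y y0; apply: continuousV; first by rewrite gt_eqF.
  exact: continuous_enorm.
- by move=> y /negP; rewrite lt_def enorm_ge0 andbT negbK => /eqP ->; rewrite invr0.
Qed.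

Lemma measurable_rV_scale d (T : measurableType d) (a : T -> R) (f : T -> 'rV[R]_n) :
  measurable_fun setT a -> measurable_fun setT f -> measurable_fun setT (fun z => a z *: f z).
Proof.
move=> ma mf; apply: measurable_rVP => i; under eq_fun do rewrite !mxE.
apply: measurable_funM => //; exact: (measurableT_comp (measurable_coord i) mf).
Qed.

(* Substituting t = s |y| on each ray and then z = s y turns the iterated integral into
   the integral of [n s^(-n-1) |z|^n g z] over [|z| < s], and integrating in [s] first gives back [g]. *)
Lemma polar_rays (g : 'rV[R]_n -> \bar R) : measurable_fun setT g -> (forall x, (0 <= g x)%E) ->
  let ray y := ((\1_pball y)%:E *
     \int[mu]_(t in [set` `](0%R : R), +oo[%R]) ((n%:R * t ^+ n.-1)%:E * g ((t / enorm y) *: y)%R))%E in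
  let sphere t := ((n%:R * t ^+ n.-1)%:E * \int[lam n]_y ((\1_pball y)%:E * g ((t / enorm y) *: y)%R))%E in
  [/\ measurable_fun setT ray, measurable_fun [set` `](0%R : R), +oo[%R] sphere,
      (\int[lam n]_z g z = \int[lam n]_y ray y)%E &
      (\int[lam n]_z g z = \int[mu]_(t in [set` `](0%R : R), +oo[%R]) sphere t)%E].
Proof.
move=> mg g0 ray sphere.
have Rn0 : 0 <= n%:R :> R by [].
have mP : measurable_fun setT (fun y : 'rV[R]_n => (\1_pball y)%:E : \bar R).
  by apply/measurable_EFinP; apply: measurable_indic; exact: measurable_pball.
pose J : set R := `]0, +oo[%classic.
have mJ : measurable J by exact: measurable_itv.
have mJi : measurable_fun setT (fun t : R => (\1_J t)%:E : \bar R).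
  by apply/measurable_EFinP; apply: measurable_indic.
have restr (f : R -> \bar R) : (\int[mu]_(t in J) f t = \int[mu]_t ((\1_J t)%:E * f t))%E.
  rewrite integral_mkcond; apply: eq_integral => t _; rewrite patchE indicE.
  by case: (t \in J); rewrite ?mul1e ?mul0e.
have mpow k : measurable_fun setT (fun t : R => (n%:R * t ^+ k)%:E : \bar R).
  by apply/measurable_EFinP; apply: measurable_funM => //; exact: measurable_funX.
pose F (z : R * 'rV[R]_n) : \bar R :=
  ((\1_J z.1)%:E * (n%:R * z.1 ^+ n.-1)%:E * ((\1_pball z.2)%:E * g ((z.1 / enorm z.2) *: z.2)%R))%E.
have mF : measurable_fun setT F.
  apply: emeasurable_funM.
    by apply: emeasurable_funM; [exact: (measurableT_comp mJi measurable_fst)|exact: (measurableT_comp (mpow _) measurable_fst)].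
  apply: emeasurable_funM; first exact: (measurableT_comp mP measurable_snd).
  apply: (measurableT_comp mg); apply: measurable_rV_scale; last exact: measurable_snd.
  apply: measurable_funM; first exact: measurable_fst.
  exact: (measurableT_comp measurable_enormV measurable_snd).
have pow0 (t : R) k : J t -> (0 <= (n%:R * t ^+ k)%:E)%E.
  by rewrite /J /= in_itv /= andbT => t0; rewrite lee_fin mulr_ge0 // exprn_ge0 // ltW.
have Jpow0 (t : R) k : (0 <= (\1_J t)%:E * (n%:R * t ^+ k)%:E)%E.
  rewrite indicE; case: (boolP (t \in J)) => [|_]; last by rewrite mul0e.
  by rewrite inE mul1e => Jt; exact: pow0.
have F0 z : (0 <= F z)%E by rewrite /F mule_ge0 // mule_ge0 // lee_fin.
have mgn (t : R) : measurable_fun setT (fun y : 'rV[R]_n => (\1_pball y)%:E * g ((t / enorm y) *: y)%R)%E.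
  apply: emeasurable_funM; first exact: mP.
  apply: (measurableT_comp mg); apply: measurable_rV_scale => //.
  apply: measurable_funM => //; exact: measurable_enormV.
have rayE y : ray y = (\int[mu]_t F (t, y))%E.
  rewrite /ray restr -ge0_integralZl //; last 2 first.
  - apply: emeasurable_funM; first exact: mJi.
    apply: emeasurable_funM; first exact: mpow.
    apply: (measurableT_comp mg).
    apply: (measurable_rV_scale (a := fun t : R => t / enorm y) (f := fun=> y)); last exact: measurable_cst.
    by apply: measurable_funM.
  - move=> t _; rewrite indicE; case: (boolP (t \in J)) => [|_]; last by rewrite mul0e.
    by rewrite inE mul1e => Jt; apply: mule_ge0 => //; exact: pow0.
  by apply: eq_integral => t _; rewrite /F /=; move: ((\1_J t)%:E) ((n%:R * t ^+ n.-1)%:E) ((\1_pball y)%:E) (g _) => u v w x; rewrite !muleA (muleC w u) -!muleA (muleCA w).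
have sphereE t : ((\1_J t)%:E * sphere t = \int[lam n]_y F (t, y))%E.
  by rewrite /sphere muleA -(lamZl (mgn t)) // => y; rewrite mule_ge0 // lee_fin.
have rayEf : ray = (fun y => \int[mu]_t F (t, y))%E by apply/funext.
suff key : (\int[lam n]_z g z = \int[lam n]_y \int[mu]_t F (t, y))%E.
  split.
  - rewrite rayEf; exact: (measurable_fun_fubini_tonelli_G (m1 := mu) F mF F0).
  - apply: (@eq_measurable_fun _ _ _ _ _ (fun t => \int[lam n]_y F (t, y))%E).
      by move=> t Jt; rewrite -sphereE indicE Jt mul1e.
    apply: measurable_funTS; exact: (measurable_fun_fubini_tonelli_F (m2 := lam n) F mF F0).
  - by rewrite key rayEf.
  - rewrite key restr -(@fubini_tonelli _ _ _ _ _ mu (lam n) F mF F0).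
    by apply: eq_integral => t _; rewrite sphereE.
symmetry.
(* The integrand after [t = s |y|] on each ray; the factor [|y|^n] comes from [t^(n-1) dt]. *)
pose H (z : R * 'rV[R]_n) : \bar R :=
  ((\1_J z.1)%:E * (n%:R * z.1 ^+ n.-1)%:E * ((\1_pball z.2)%:E * ((enorm z.2 ^+ n)%:E * g (z.1 *: z.2)%R)))%E.
have men : measurable_fun setT (fun y : 'rV[R]_n => (enorm y ^+ n)%:E).
  by apply/measurable_EFinP; apply: measurable_funX; exact: measurable_enorm.
have mH : measurable_fun setT H.
  apply: emeasurable_funM.
    by apply: emeasurable_funM; [exact: (measurableT_comp mJi measurable_fst)|exact: (measurableT_comp (mpow _) measurable_fst)].
  apply: emeasurable_funM; first exact: (measurableT_comp mP measurable_snd).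
  apply: emeasurable_funM; first exact: (measurableT_comp men measurable_snd).
  by apply: (measurableT_comp mg); apply: measurable_rV_scale; [exact: measurable_fst|exact: measurable_snd].
have en0 (y : 'rV[R]_n) : (0 <= (enorm y ^+ n)%:E)%E by rewrite lee_fin exprn_ge0 // enorm_ge0.
have H0 z : (0 <= H z)%E by rewrite /H mule_ge0 // mule_ge0 // ?lee_fin // mule_ge0.
symmetry.
transitivity (\int[lam n]_y \int[mu]_s H (s, y))%E; last first.
  apply: eq_integral => y _.
  have [y0|y0] := eqVneq (\1_pball y : R) 0.
    by apply: eq_integral => t _; rewrite /F /H /= y0 !mul0e !mule0.
  have ey : 0 < enorm y.
    by apply/negPn/negP => h; move: y0; rewrite indicE memNset ?eqxx // => -[] /andP[]; rewrite (negbTE h).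
  rewrite -(ge0_integral_affine (PosNum ey) 0 (f := fun t => F (t, y))); last 2 first.
  - exact: (measurableT_comp mF (measurable_pair2 y)).
  - by move=> t; exact: F0.
  rewrite /= -ge0_integralZl //; last 2 first.
  - apply: (measurableT_comp (f := fun t => F (t, y)) (measurableT_comp mF (measurable_pair2 y))).
    by apply: measurable_funD => //; exact: measurable_funM.
  - by rewrite lee_fin ltW.
  apply: eq_integral => s _; rewrite /F /H /= addr0.
  have -> : \1_J (enorm y * s) = \1_J s :> R.
    rewrite !indicE; congr (_%:R); congr nat_of_bool.
    by apply/idP/idP; rewrite !inE /J /= !in_itv /= !andbT pmulr_rgt0.
  rewrite [enorm y * s]mulrC -mulrA divff ?gt_eqF // mulr1.
  rewrite !indicE; case: (s \in J); last by rewrite !mul0e mule0.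
  case: (y \in pball); last by rewrite !mul0e !mule0.
  have -> : enorm y ^+ n = enorm y * enorm y ^+ n.-1 by rewrite -exprS prednK.
  rewrite exprMn !mul1e !muleA -!EFinM; congr (_%:E * _)%E.
  by move: (s ^+ n.-1) (enorm y ^+ n.-1) (enorm y) n%:R => u v w k; ring.
transitivity (\int[mu]_s \int[lam n]_y H (s, y))%E; last first.
  exact: (@fubini_tonelli _ _ _ _ _ mu (lam n) H mH H0).
(* The data after [z = s y]: [B] describes the image [0 < |z| < s] of the punctured ball, and [K]
   collects [n s^(n-1)], the Jacobian [s^(-n)] and the [s^(-n)] from [|y|^n = |z|^n / s^n]. *)
pose B (z : R * 'rV[R]_n) : R := \1_[set z : R * 'rV[R]_n | 0 < enorm z.2 < z.1] z.
pose K (s : R) : \bar R := ((\1_J s) * (n%:R * s ^- n.+1))%:E.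
pose G (z : R * 'rV[R]_n) : \bar R :=
  ((B z)%:E * K z.1 * ((enorm z.2 ^+ n)%:E * g z.2))%E.
have mB : measurable_fun setT (fun z => (B z)%:E).
  apply/measurable_EFinP; apply: measurable_indic.
  have m2 : measurable_fun setT (fun z : R * 'rV[R]_n => enorm z.2).
    by apply: (measurableT_comp _ measurable_snd); exact: measurable_enorm.
  rewrite (_ : [set _ | _] = (fun z : R * 'rV[R]_n => 0 < enorm z.2) @^-1` [set true] `&`
     (fun z : R * 'rV[R]_n => enorm z.2 < z.1) @^-1` [set true]).
    apply: measurableI; rewrite -[X in measurable X]setTI.
      by apply: (measurable_fun_ltr _ m2).
    by apply: (measurable_fun_ltr m2 measurable_fst).
  by apply/seteqP; split => z /=; [move=> /andP[-> ->]|move=> [-> ->]].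
have mK : measurable_fun setT K.
  apply/measurable_EFinP.
  rewrite (_ : (fun s : R => _) = (fun s : R => n%:R * s ^- n.+1) \_ J); last first.
    by apply/funext => s; rewrite patchE indicE; case: (s \in J); rewrite ?mul1r ?mul0r.
  apply/(measurable_restrictT _ mJ); apply: open_continuous_measurable_fun.
    exact: interval_open.
  move=> s; rewrite inE /J /= in_itv /= andbT => s0.
  change {for s, continuous (fun x : R => n%:R * (x ^+ n.+1)^-1)}.
  apply: continuousM; first exact: cst_continuous.
  apply: (@continuousV _ _ (fun x : R => x ^+ n.+1)); first by rewrite expf_neq0 // gt_eqF.
  exact: exprn_continuous.
have K0 s : (0 <= K s)%E.
  rewrite /K lee_fin indicE; case: (boolP (s \in J)); last by rewrite mul0r.
  rewrite inE /J /= in_itv /= andbT mul1r => s0; rewrite mulr_ge0 // invr_ge0 exprn_ge0 //; exact: ltW.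
have mG : measurable_fun setT G.
  apply: emeasurable_funM.
    by apply: emeasurable_funM => //; exact: (measurableT_comp mK measurable_fst).
  apply: emeasurable_funM; first exact: (measurableT_comp men measurable_snd).
  exact: (measurableT_comp mg measurable_snd).
have B0 z : (0 <= (B z)%:E)%E by rewrite lee_fin.
have G0 z : (0 <= G z)%E by apply: mule_ge0; [exact: mule_ge0|exact: mule_ge0].
transitivity (\int[lam n]_y \int[mu]_s G (s, y))%E.
  apply: ae_eq_integral => //.
    exact: (measurable_fun_fubini_tonelli_G (m1 := mu) G mG G0).
  exists [set (0 : 'rV[R]_n)]; split; [exact: measurable_origin|exact: lam_origin|].
  move=> y /= Hy; apply: contrapT => y0; apply: Hy => _.
  have ey : 0 < enorm y by rewrite lt_def enorm_ge0 andbT; apply/eqP => /enorm_eq0.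
  have mBK : measurable_fun setT (fun s : R => (B (s, y))%:E * K s)%E.
    by apply: emeasurable_funM => //; exact: (measurableT_comp mB (measurable_pair2 y)).
  rewrite /G /= ge0_integralZr //; last 2 first.
  - by move=> s _; exact: mule_ge0.
  - exact: mule_ge0.
  rewrite [X in (X * _)%E](_ : _ = (enorm y ^- n)%:E).
    by rewrite muleA -EFinM mulVf ?mul1e // expf_neq0 // gt_eqF.
  rewrite -(integral_inv_pow ey) -integral_itv_obnd_cbnd; last first.
    apply: (@eq_measurable_fun _ _ _ _ _ K); last exact: measurable_funTS.
    move=> s; rewrite inE /= in_itv /= andbT => ys.
    by rewrite /K indicE mem_set ?mul1r // /J /= in_itv /= andbT (lt_trans ey ys).
  rewrite [RHS]integral_mkcond; apply: eq_integral => s _.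
  rewrite patchE /B /K /= !indicE /=; case: (ltP (enorm y) s) => ys.
    rewrite mem_set /= ?ey ?ys // mul1e mem_set; last by rewrite /J /= in_itv /= andbT (lt_trans ey ys).
    by rewrite mul1r mem_set //= in_itv /= ys.
  rewrite memNset /=; last by move=> /andP[_]; rewrite ltNge ys.
  by rewrite mul0e memNset //= in_itv /= ltNge ys.
transitivity (\int[mu]_s \int[lam n]_y G (s, y))%E.
  symmetry; exact: (@fubini_tonelli _ _ _ _ _ mu (lam n) G mG G0).
apply: eq_integral => s _.
have [sJ|sJ] := boolP (s \in J); last first.
  by apply: eq_integral => y _; rewrite /G /H /K /= indicE (negbTE sJ) mul0r mule0 !mul0e.
have s0 : 0 < s by move: sJ; rewrite inE /J /= in_itv /= andbT.
rewrite -(ge0_lam_affine (PosNum s0) 0 (f := fun y => G (s, y))); last 2 first.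
- exact: (measurableT_comp mG (measurable_pair1 s)).
- by move=> y.
rewrite /= -lamZl; last 3 first.
- apply: (measurableT_comp (measurableT_comp mG (measurable_pair1 s))).
  exact: measurable_rV_affine.
- by move=> y.
- by rewrite lee_fin exprn_ge0 // ltW.
apply: eq_integral => y _; rewrite /G /H /K /B /= addr0 !indicE /= sJ enormZ gtr0_norm // mul1r mul1e.
rewrite (_ : (_, _) \in _ = (y \in pball)); last first.
  by apply/idP/idP; rewrite !inE /= enormZ gtr0_norm // pmulr_rgt0 // gtr_pMr.
case: (y \in pball); last by rewrite !mul0e !mule0.
rewrite !mul1e !muleA -!EFinM; congr (_%:E * _)%E.
have E : s ^+ n = s * s ^+ n.-1 by rewrite -exprS prednK.
rewrite exprMn exprS E; have sN : s ^+ n.-1 != 0 by rewrite expf_neq0 // gt_eqF.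
by move: sN; move: (s ^+ n.-1) (enorm y ^+ n) n%:R => u v w u0; field; rewrite u0 gt_eqF.
Qed.

End polar.

(** * From the frequency bound to doubling *)

Section growth.
Context {R : realType} (n : nat) (Rad : R) (h : 'rV[R]_n -> R).
Notation mu := (@lebesgue_measure R).
Notation I n f := (Rintegral (lam n) setT f).

Lemma nice_EFin (f : 'rV[R]_n -> R) : nice f -> (\int[lam n]_z (f z)%:E)%E = (I n f)%:E.
Proof.
by move=> nf; rewrite /Rintegral fineK //; apply: integrable_fin_num => //; exact: nice_integrable.
Qed.

Lemma nice_sqr (f : 'rV[R]_n -> R) : nice f -> nice (fun z => f z ^+ 2).
Proof.
move=> [mf [M [r [M0 r0 fM fr]]]]; split; first exact: measurable_funX.
exists (M ^+ 2), r; split => //; first exact: exprn_ge0.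
  by move=> z; rewrite normrX; apply: lerXn2r; rewrite ?nnegrE.
by move=> z zr; rewrite fr // expr0n.
Qed.

Lemma FTC_le (F f g : R -> R) (a b : R) : a <= b ->
  (forall t, a <= t <= b -> is_derive t (1 : R) F (f t)) ->
  (forall t, a <= t <= b -> {for t, continuous f}) ->
  measurable_fun [set` `]a, b[] g -> (forall t, a < t < b -> `|f t| <= g t) ->
  (`|F b - F a|%:E <= \int[mu]_(t in [set` `]a, b[]) (g t)%:E)%E.
Proof.
move=> ab dF cf mg fg.
move: ab; rewrite le_eqVlt => /orP[/eqP E|ab].
  rewrite E subrr normr0; apply: integral_ge0 => t; rewrite /= in_itv /= => tab.
  by rewrite lee_fin; apply: le_trans (fg t _); rewrite ?E.
have cF t : a <= t <= b -> {for t, continuous F}.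
  by move=> /dF[dFt _]; apply: differentiable_continuous; exact/derivable1_diffP.
have mfo : measurable_fun [set` `]a, b[] f.
  apply: open_continuous_measurable_fun; first exact: interval_open.
  by move=> t; rewrite inE /= in_itv /= => /andP[H1 H2]; apply: cf; rewrite !ltW.
have E : (\int[mu]_(t in [set` `]a, b[]) (f t)%:E = (F b)%:E - (F a)%:E)%E.
  rewrite -(@integral_itv_bndoo _ a b _ true false); last exact/measurable_EFinP.
  apply: continuous_FTC2 => //.
  - by apply: continuous_in_subspaceT => t; rewrite inE /= in_itv /=; exact: cf.
  - split.
    + by move=> t; rewrite in_itv /= => /andP[/ltW H1 /ltW H2]; have [] := dF t; rewrite ?H1.
    + by apply: cvg_at_right_filter; apply: cF; rewrite lexx ltW.
    + by apply: cvg_at_left_filter; apply: cF; rewrite lexx ltW.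
  - move=> t; rewrite in_itv /= => /andP[/ltW H1 /ltW H2]; rewrite derive1E.
    by have [|_ ->] := dF t; first by rewrite H1.
rewrite -abse_EFin EFinB -E.
apply: le_trans (le_abse_integral _ _ _) _ => //; first exact/measurable_EFinP.
apply: ge0_le_integral => //.
- by apply/measurable_EFinP; exact: measurableT_comp.
- exact/measurable_EFinP.
Qed.

Hypothesis n0 : (0 < n)%N.
Hypothesis hH : harmonic_on (eball 0 Rad) h.

Lemma grad_normE (x : 'rV[R]_n) : grad_norm h x = enorm (\row_i pd i h x).
Proof. by rewrite /grad_norm /enorm; congr Num.sqrt; apply: eq_bigr => i _; rewrite mxE. Qed.

Lemma sqr_grad_norm (x : 'rV[R]_n) : grad_norm h x ^+ 2 = \sum_i pd i h x ^+ 2.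
Proof. by rewrite grad_normE sqr_enorm; apply: eq_bigr => i _; rewrite mxE. Qed.

Definition vol (s : R) : R := I n (fun z => cutoff h s z ^+ 2).

Definition sqr_grad (s : R) (z : 'rV[R]_n) : R := grad_norm h z ^+ 2 * \1_(eball (0 : 'rV[R]_n) s) z.

Lemma nice_sqr_cutoff s : 0 < s -> s < Rad -> nice (fun z => cutoff h s z ^+ 2).
Proof. by move=> s0 sR; apply: nice_sqr; exact: nice_cutoff sR. Qed.

Lemma nice_sqr_grad s : 0 < s -> s < Rad -> nice (sqr_grad s).
Proof.
move=> s0 sR; apply: (nice_restrict s0 sR) => x xR.
rewrite (_ : (fun z => _) = fun z => \sum_i pd i h z ^+ 2); last by apply/funext => z; exact: sqr_grad_norm.
apply: continuous_sum => i.
apply: (@continuous_comp _ _ _ (pd i h) (fun t : R => t ^+ 2)); last exact: exprn_continuous.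
exact: harmonic_continuous_pd xR.
Qed.

Definition dirichlet (s : R) : R := I n (sqr_grad s).

(** A majorant of the derivative of [t^n h(t w)^2], divided by [t^(n-1)], for [t < s]. The parameter
    [a] is the weight in Young's inequality for the cross term [2 s |h| |grad h|]. *)
Definition ray_density (a s : R) (z : 'rV[R]_n) : R :=
  (n%:R + a) * cutoff h s z ^+ 2 + s ^+ 2 / a * sqr_grad s z.

Lemma nice_ray_density a s : 0 < s -> s < Rad -> nice (ray_density a s).
Proof.
by move=> s0 sR; apply: niceD; apply: niceZ; [exact: nice_sqr_cutoff|exact: nice_sqr_grad].
Qed.

Lemma ray_density_ge0 a s z : 0 < a -> 0 <= ray_density a s z.
Proof.
move=> a0; apply: addr_ge0; apply: mulr_ge0; rewrite ?sqr_ge0 ?addr_ge0 ?divr_ge0 ?sqr_ge0 //; try exact: ltW.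
by rewrite mulr_ge0 // sqr_ge0.
Qed.

Lemma ray_bound (a s : R) (w : 'rV[R]_n) : 0 < a -> 0 < s -> s < Rad -> enorm w = 1 ->
  ((s ^+ n * h (s *: w) ^+ 2)%:E <=
    \int[mu]_(t in [set` `](0 : R), s[%R]) (t ^+ n.-1 * ray_density a s (t *: w))%:E)%E.
Proof.
move=> a0 s0 sR w1.
pose r (t : R) := \sum_i w ord0 i * pd i h (t *: w).
pose F (t : R) := t ^+ n * (h (t *: w) * h (t *: w)).
pose f (t : R) := n%:R * t ^+ n.-1 * (h (t *: w) * h (t *: w)) + t ^+ n * (2 * h (t *: w) * r t).
have tw t : 0 <= t -> enorm (t *: w) = t by move=> t0; rewrite enormZ w1 mulr1 ger0_norm.
have twR t : 0 <= t <= s -> enorm (t *: w) < Rad by move=> /andP[t0 ts]; rewrite tw // (le_lt_trans ts).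
have ctw (t : R) : {for t, continuous (fun t : R => t *: w)} by exact: scalel_continuous.
have ch t : 0 <= t <= s -> {for t, continuous (fun t : R => h (t *: w))}.
  move=> ts; apply: (@continuous_comp _ _ _ (fun t : R => t *: w) h) => //.
  exact: harmonic_continuous (twR _ ts).
have cr t : 0 <= t <= s -> {for t, continuous r}.
  move=> ts; apply: continuous_sum => i; apply: continuousM; first exact: cst_continuous.
  apply: (@continuous_comp _ _ _ (fun t : R => t *: w) (pd i h)) => //.
  exact: harmonic_continuous_pd (twR _ ts).
have := @FTC_le F f (fun t => t ^+ n.-1 * ray_density a s (t *: w)) 0 s (ltW s0).
have -> : F 0 = 0 by rewrite /F expr0n eqn0Ngt n0 mul0r.
rewrite subr0 ger0_norm; last by rewrite mulr_ge0 ?exprn_ge0 ?(ltW s0) // -expr2 sqr_ge0.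
have -> : F s = s ^+ n * h (s *: w) ^+ 2 by rewrite /F -expr2.
apply.
- move=> t ts.
  have Dh : is_derive t (1 : R) (fun t : R => h (t *: w)) (r t).
    apply: (@is_derive_curve R n h (fun t : R => t *: w)) => [i|].
      rewrite (_ : (fun u : R => _) = fun u : R => w ord0 i * u ^+ 1); last first.
        by apply/funext => u; rewrite mxE expr1 mulrC.
      by have := is_derive_monomial (w ord0 i) t 0; rewrite expr0 !mulr1.
    by have := hH (x := t *: w); rewrite eball0E => /(_ (twR _ ts))[].
  have Dn : is_derive t (1 : R) (fun t : R => t ^+ n) (n%:R * t ^+ n.-1).
    have := is_derive_monomial 1 t n.-1; rewrite prednK // mul1r.
    by rewrite (_ : (fun s0 : R => _) = fun s : R => s ^+ n) //; apply/funext => u; rewrite mul1r.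
  apply: (is_derive_eq (is_deriveM Dn (is_deriveM Dh Dh))); rewrite /f /GRing.scale /=.
  change (t ^+ n * (h (t *: w) * r t + h (t *: w) * r t) + (h (t *: w) * h (t *: w)) * (n%:R * t ^+ n.-1) =
    n%:R * t ^+ n.-1 * (h (t *: w) * h (t *: w)) + t ^+ n * (2 * h (t *: w) * r t)).
  by move: (t ^+ n) (t ^+ n.-1) (h _) (r t) n%:R => u v x y k; ring.
- move=> t ts; apply: continuousD.
    apply: continuousM; last by apply: continuousM; exact: ch.
    apply: continuousM; [exact: cst_continuous|exact: exprn_continuous].
  apply: continuousM; first exact: exprn_continuous.
  apply: continuousM; last exact: cr.
  by apply: continuousM; [exact: cst_continuous|exact: ch].
- apply: measurable_funTS; apply: measurable_funM; first exact: measurable_funX.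
  have [md _] := nice_ray_density a s0 sR; apply: (measurableT_comp md).
  by apply: (measurable_rV_scale (a := fun t : R => t) (f := fun=> w)); [exact: measurable_id|exact: measurable_cst].
- move=> t /andP[t0 ts].
  have ein : \1_(eball (0 : 'rV[R]_n) s) (t *: w) = 1 :> R by rewrite indicE mem_set // eball0E tw // ltW.
  rewrite /ray_density /sqr_grad /cutoff ein !mulr1.
  have rG : `|r t| <= grad_norm h (t *: w).
    have := cauchy_schwarz w (\row_i pd i h (t *: w)); rewrite w1 mul1r -grad_normE.
    by rewrite /edot; under eq_bigr do rewrite mxE.
  have G0 : 0 <= grad_norm h (t *: w) by rewrite grad_normE enorm_ge0.
  have tn : t ^+ n = t * t ^+ n.-1 by rewrite -exprS prednK.
  have -> : f t = t ^+ n.-1 * (n%:R * h (t *: w) ^+ 2 + t * (2 * h (t *: w) * r t)).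
    by rewrite /f tn expr2; move: (t ^+ n.-1) (h _) (r t) n%:R => v x y k; ring.
  rewrite normrM.
  have tn0 : 0 <= t ^+ n.-1 by rewrite exprn_ge0 // ltW.
  rewrite (ger0_norm tn0) ler_wpM2l //.
  apply: le_trans (ler_normD _ _) _.
  have -> : `|n%:R * h (t *: w) ^+ 2| = n%:R * h (t *: w) ^+ 2 by rewrite ger0_norm // mulr_ge0 // sqr_ge0.
  rewrite [(n%:R + a) * _]mulrDl -addrA lerD2l !normrM (gtr0_norm t0) (ger0_norm (ler0n R 2)).
  apply: (@le_trans _ _ (s * (2 * `|h (t *: w)| * grad_norm h (t *: w)))).
    apply: ler_pM => //; first exact: ltW.
      exact: ltW.
    by apply: ler_wpM2l.
  (* [(a |h| - s |grad h|)^2 >= 0] divided by [a] *)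
  rewrite -(real_normK (num_real (h _))).
  move: (`|h _|) (grad_norm h _) => x y.
  have -> : a * x ^+ 2 + s ^+ 2 / a * y ^+ 2 = ((a * x - s * y) ^+ 2) / a + s * (2 * x * y).
    by field; rewrite gt_eqF.
  by rewrite lerDr divr_ge0 ?sqr_ge0 // ltW.
Qed.

(** Multiplied by [n t^(n-1)], this is the integral of [h^2] over the sphere of radius [t], in the
    cone normalisation of [sphere_int]. *)
Definition sphere2 (t : R) : \bar R :=
  (\int[lam n]_y ((\1_(@pball R n) y)%:E * (h ((t / enorm y) *: y)%R ^+ 2)%:E))%E.

Lemma enorm_ray_le (t : R) (y : 'rV[R]_n) : 0 <= t -> enorm ((t / enorm y) *: y) <= t.
Proof.
move=> t0; rewrite enormZ normrM (ger0_norm t0) ger0_norm ?invr_ge0 ?enorm_ge0 //.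
have [->|y0] := eqVneq (enorm y) 0; first by rewrite mulr0.
by rewrite -mulrA mulVf // mulr1.
Qed.

Lemma measurable_ray (t : R) : 0 < t -> t < Rad ->
  measurable_fun setT (fun y : 'rV[R]_n => h ((t / enorm y) *: y) ^+ 2).
Proof.
move=> t0 tR; apply: measurable_funX; pose s := (t + Rad) / 2.
have s0 : 0 < s by rewrite /s; lra.
have sR : s < Rad by rewrite /s; lra.
rewrite (_ : (fun y => _) = fun y => cutoff h s ((t / enorm y) *: y)).
  have [mc _] := nice_cutoff hH s0 sR.
  apply: (measurableT_comp mc); apply: measurable_rV_scale; last exact: measurable_id.
  by apply: measurable_funM; [exact: measurable_cst|exact: measurable_enormV].
apply/funext => y; rewrite cutoff_in //.
by apply: (le_lt_trans (enorm_ray_le y (ltW t0))); rewrite /s; lra.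
Qed.

(** [ray_bound] averaged over the directions [y / |y|]; [polar_rays] reassembles the rays into
    integrals over the ball. *)
Lemma sphere2_le (a t : R) : 0 < a -> 0 < t -> t < Rad ->
  ((n%:R * t ^+ n)%:E * sphere2 t <= ((n%:R + a) * vol t + t ^+ 2 / a * dirichlet t)%:E)%E.
Proof.
move=> a0 t0 tR.
have nd := nice_ray_density a t0 tR.
have nc := nice_sqr_cutoff t0 tR; have ng := nice_sqr_grad t0 tR.
have -> : (n%:R + a) * vol t + t ^+ 2 / a * dirichlet t = I n (ray_density a t).
  by rewrite /vol /dirichlet -!I_Z // -I_D //; apply: niceZ.
have mg : measurable_fun setT (fun z => (ray_density a t z)%:E) by apply/measurable_EFinP; exact: nd.1.
have g0 z : (0 <= (ray_density a t z)%:E)%E by rewrite lee_fin ray_density_ge0.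
have [mray _ Er _] := polar_rays n0 mg g0.
rewrite -nice_EFin // Er /sphere2 -lamZl; last 3 first.
- apply: emeasurable_funM; apply/measurable_EFinP; first by apply: measurable_indic; exact: measurable_pball.
  exact: measurable_ray.
- by move=> y; apply: mule_ge0; rewrite lee_fin // sqr_ge0.
- by rewrite lee_fin mulr_ge0 // exprn_ge0 // ltW.
apply: ge0_le_integral => //.
- move=> y _; apply: mule_ge0; first by rewrite lee_fin mulr_ge0 // exprn_ge0 // ltW.
  by apply: mule_ge0; rewrite lee_fin // sqr_ge0.
- apply: emeasurable_funM; first exact: measurable_cst.
  apply: emeasurable_funM; apply/measurable_EFinP; first by apply: measurable_indic; exact: measurable_pball.
  exact: measurable_ray.
move=> y _; rewrite indicE; case: (boolP (y \in _)); last by rewrite !mul0e mule0.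
rewrite inE !mul1e => /andP[y0 _].
pose w := (enorm y)^-1 *: y.
have w1 : enorm w = 1 by rewrite enormZ ger0_norm ?invr_ge0 ?enorm_ge0 // mulVf // gt_eqF.
have wE u : (u / enorm y) *: y = u *: w by rewrite /w scalerA.
have := ray_bound a0 t0 tR w1; rewrite wE => RB.
have mrd : measurable_fun setT (fun u : R => u ^+ n.-1 * ray_density a t (u *: w)).
  apply: measurable_funM; first exact: measurable_funX.
  apply: (measurableT_comp nd.1).
  by apply: (measurable_rV_scale (a := fun t : R => t) (f := fun=> w)); [exact: measurable_id|exact: measurable_cst].
rewrite -EFinM -mulrA EFinM.
apply: (@le_trans _ _ (n%:R%:E * \int[mu]_(u in [set` `](0 : R), t[%R]) (u ^+ n.-1 * ray_density a t (u *: w))%:E)%E).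
  by apply: lee_wpmul2l RB; rewrite lee_fin.
pose D : set R := [set` `](0 : R), t[%R].
have mf : measurable_fun D (fun u : R => (u ^+ n.-1 * ray_density a t (u *: w))%:E).
  by apply: measurable_funTS; apply/measurable_EFinP.
have f0 (u : R) : D u -> (0 <= (u ^+ n.-1 * ray_density a t (u *: w))%:E)%E.
  rewrite /D /= in_itv /= => /andP[u0 _]; rewrite lee_fin; apply: mulr_ge0; last exact: ray_density_ge0.
  by rewrite exprn_ge0 // ltW.
have nE0 : (0 <= (n%:R : R)%:E)%E by rewrite lee_fin.
rewrite -(@ge0_integralZl _ _ _ mu D (measurable_itv _) _ mf _ f0 nE0).
have E : (fun x : R => ((n%:R * x ^+ n.-1)%:E * (ray_density a t ((x / enorm y) *: y))%:E)%E) =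
   (fun x : R => (n%:R%:E * (x ^+ n.-1 * ray_density a t (x *: w))%:E)%E).
  by apply/funext => u; rewrite wE -!EFinM mulrA.
rewrite E; apply: ge0_subset_integral.
- exact: measurable_itv.
- exact: measurable_itv.
- apply: measurable_funTS; apply: emeasurable_funM; first exact: measurable_cst.
  exact/measurable_EFinP.
- move=> u; rewrite /= in_itv /= andbT => u0; rewrite mule_ge0 // lee_fin mulr_ge0 ?ray_density_ge0 //.
  by rewrite exprn_ge0 // ltW.
- by move=> u; rewrite /D /= !in_itv /= => /andP[-> _].
Qed.

(** The weight [a = 4 m] is chosen so that the frequency bound makes the Dirichlet term of
    [sphere2_le] at most half of the left side, which absorbs it. *)
Lemma sphere2_growth (m : nat) (t : R) : (0 < m)%N -> 0 < t -> t < Rad -> frequency h 0 t <= m%:R ->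
  exists s : R, [/\ sphere2 t = s%:E, 0 <= s & n%:R * t ^+ n * s <= 2 * (n%:R + 4 * m%:R) * vol t].
Proof.
move=> m0 t0 tR.
have nR : 0 < n%:R :> R by rewrite ltr0n.
have mR : 0 < m%:R :> R by rewrite ltr0n.
have ntn : 0 < n%:R * t ^+ n by rewrite mulr_gt0 // exprn_gt0.
have S0 : (0 <= sphere2 t)%E.
  by apply: integral_ge0 => y _; apply: mule_ge0; rewrite lee_fin // sqr_ge0.
have S1 := sphere2_le ltr01 t0 tR.
have a0 : 0 < 4 * m%:R :> R by rewrite mulr_gt0.
have S2 := sphere2_le a0 t0 tR.
case E : (sphere2 t) S0 S1 S2 => [s| |] //; last first.
  by move=> _; rewrite gt0_muley ?lte_fin // leNgt ltry.
rewrite lee_fin => s0 _; rewrite -EFinM lee_fin => S2.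
rewrite /frequency.
rewrite [iint _](_ : _ = (dirichlet t)%:E); last first.
  have ng := nice_sqr_grad t0 tR.
  rewrite (_ : (fun y => _) = fun y => (sqr_grad t y)%:E); last by apply/funext => y; rewrite mulrC.
  rewrite iintE ?nice_EFin //; first by apply/measurable_EFinP; exact: ng.1.
  by move=> y; rewrite lee_fin mulr_ge0 // sqr_ge0.
rewrite [sphere_int _ _ _](_ : _ = (t ^+ n.-1 * n%:R * s)%:E); last first.
  rewrite /sphere_int [RHS]EFinM; congr mule; rewrite -E /sphere2.
  have mr := measurable_ray t0 tR.
  rewrite iintE.
  - have mE : measurable_fun setT (fun y : 'rV[R]_n => (h ((t / enorm y) *: y) ^+ 2)%:E) by exact/measurable_EFinP.
    rewrite -(lam_pball n0 mE); last by move=> y; rewrite lee_fin sqr_ge0.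
    by apply: eq_integral => y _; rewrite add0r EFinM.
  - apply/measurable_EFinP; under eq_fun do rewrite add0r.
    by apply: measurable_funM => //; apply: measurable_indic; exact: measurable_eball.
  - by move=> y; rewrite lee_fin mulr_ge0 // sqr_ge0.
rewrite /=; set H := t ^+ n.-1 * n%:R * s => Hf.
have tH : n%:R * t ^+ n * s = t * H.
  have -> : t ^+ n = t * t ^+ n.-1 by rewrite -exprS prednK.
  by rewrite /H; move: (t ^+ n.-1) (n%:R : R) => u v; ring.
have v0 : 0 <= vol t.
  rewrite -lee_fin /vol -nice_EFin; last exact: nice_sqr_cutoff.
  by apply: integral_ge0 => y _; rewrite lee_fin sqr_ge0.
exists s; split => //; rewrite tH.
have H0 : 0 <= H by rewrite /H !mulr_ge0 // exprn_ge0 // ltW.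
have rhs0 : 0 <= 2 * (n%:R + 4 * m%:R) * vol t.
  by rewrite mulr_ge0 // mulr_ge0 // addr_ge0 // ltW.
(* If [h] vanishes on the sphere in the mean, the frequency is a division by zero and carries no
   information, but the claim is trivial. *)
move: H0; rewrite le_eqVlt => /orP[/eqP <-|H0]; first by rewrite mulr0.
have H20 : 0 < 2 * H by rewrite mulr_gt0.
move: Hf; rewrite (ler_pdivrMr _ _ H20) => Hf.
rewrite tH in S2.
have : t ^+ 2 / (4 * m%:R) * dirichlet t <= t * H / 2.
  have -> : t ^+ 2 / (4 * m%:R) * dirichlet t = t * (t * dirichlet t) / (4 * m%:R) by rewrite expr2; ring.
  rewrite ler_pdivrMr // -mulrA -[leRHS]mulrA ler_wpM2l ?(ltW t0) //.
  by apply: le_trans Hf _; move: (m%:R : R) => M; rewrite le_eqVlt; apply/orP; left; apply/eqP; field.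
lra.
Qed.

Lemma vol_ge0 t : 0 < t -> t < Rad -> 0 <= vol t.
Proof.
move=> t0 tR; rewrite -lee_fin /vol -nice_EFin; last exact: nice_sqr_cutoff.
by apply: integral_ge0 => y _; rewrite lee_fin sqr_ge0.
Qed.

Lemma vol_mono r1 r2 : 0 < r1 -> r1 <= r2 -> r2 < Rad -> vol r1 <= vol r2.
Proof.
move=> r10 r12 r2R.
apply: I_le; [exact: nice_sqr_cutoff (le_lt_trans r12 r2R)|exact: nice_sqr_cutoff (lt_le_trans r10 r12) r2R|].
move=> z; have [zs|zs] := ltP (enorm z) r1; last by rewrite cutoff_out // expr0n sqr_ge0.
by rewrite !cutoff_in // (lt_le_trans zs).
Qed.

(** The differential inequality for [vol] in integrated form: the shell [r1 <= |z| < r2] is sliced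
    into spheres, each bounded by [K vol r2 / r1]. No differentiability of [vol] is involved. *)
Lemma vol_step (K r1 r2 : R) : 0 < r1 -> r1 < r2 -> r2 < Rad -> 0 <= K ->
  (forall t, 0 < t < Rad -> exists s : R, [/\ sphere2 t = s%:E, 0 <= s & n%:R * t ^+ n * s <= K * vol t]) ->
  vol r2 <= vol r1 + (r2 - r1) / r1 * K * vol r2.
Proof.
move=> r10 r12 r2R K0 HS.
have r20 : 0 < r2 by exact: lt_trans r12.
pose g z := cutoff h r2 z ^+ 2 - cutoff h r1 z ^+ 2.
have nc1 := nice_sqr_cutoff r10 (lt_trans r12 r2R); have nc2 := nice_sqr_cutoff r20 r2R.
have ng : nice g.
  rewrite (_ : g = fun z => cutoff h r2 z ^+ 2 + (-1) * cutoff h r1 z ^+ 2).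
    by apply: niceD => //; exact: niceZ.
  by apply/funext => z; rewrite /g mulN1r.
have Ig : I n g = vol r2 - vol r1.
  rewrite (_ : g = fun z => cutoff h r2 z ^+ 2 + (-1) * cutoff h r1 z ^+ 2).
    by rewrite I_D ?I_Z ?mulN1r //; exact: niceZ.
  by apply/funext => z; rewrite /g mulN1r.
have gin z : r1 <= enorm z -> enorm z < r2 -> g z = h z ^+ 2.
  by move=> z1 z2; rewrite /g cutoff_in // cutoff_out // expr0n subr0.
have gout z : ~~ (r1 <= enorm z < r2) -> g z = 0.
  rewrite negb_and -ltNge -leNgt => /orP[z1|z2]; rewrite /g.
    by rewrite !cutoff_in ?subrr // (lt_trans z1).
  by rewrite !cutoff_out ?subrr // (le_trans (ltW r12)).
have g0 z : 0 <= g z.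
  have [/andP[z1 z2]|/gout ->//] := boolP (r1 <= enorm z < r2).
  by rewrite gin // sqr_ge0.
have mg : measurable_fun setT (fun z => (g z)%:E) by apply/measurable_EFinP; exact: ng.1.
have g0' z : (0 <= (g z)%:E)%E by rewrite lee_fin.
have [_ msp _ Es] := polar_rays n0 mg g0'.
suff : I n g <= (r2 - r1) / r1 * K * vol r2 by rewrite Ig lerBlDl.
rewrite -lee_fin -nice_EFin // Es.
pose B := K * vol r2 / r1.
have B0 : 0 <= B by rewrite /B mulr_ge0 ?invr_ge0 ?(ltW r10) // mulr_ge0 // vol_ge0.
apply: (@le_trans _ _ (\int[mu]_(t in [set` `](0 : R), +oo[%R]) ((B * \1_([set` `[r1, r2[%R]) t)%:E))%E).
  apply: ge0_le_integral => //.
  - move=> t; rewrite /= in_itv /= andbT => t0; apply: mule_ge0; first by rewrite lee_fin mulr_ge0 // exprn_ge0 // ltW.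
    by apply: integral_ge0 => y _; apply: mule_ge0; rewrite lee_fin.
  - by apply/measurable_EFinP; apply: measurable_funTS; apply: measurable_funM.
  - move=> t; rewrite /= in_itv /= andbT => t0.
    have ray y : pball y -> enorm ((t / enorm y) *: y) = t.
      move=> /andP[y0 _]; rewrite enormZ normrM (gtr0_norm t0) ger0_norm ?invr_ge0 ?enorm_ge0 //.
      by rewrite -mulrA mulVf ?mulr1 // gt_eqF.
    have [/andP[t1 t2]|tn] := boolP (r1 <= t < r2); last first.
      rewrite (eq_integral (cst 0%E)); last first.
        move=> y _; rewrite indicE; case: (boolP (y \in _)); last by rewrite mul0e.
        by rewrite inE => yp; rewrite gout ?mule0 // ray.
      by rewrite integral0 mule0 lee_fin mulr_ge0.
    have [|s [sE s0 sK]] := HS t; first by rewrite t0 (lt_trans t2).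
    rewrite (eq_integral (fun y : 'rV[R]_n => ((\1_(@pball R n) y)%:E * (h ((t / enorm y) *: y)%R ^+ 2)%:E)%E)); last first.
      move=> y _; rewrite indicE; case: (boolP (y \in _)); last by rewrite !mul0e.
      by rewrite inE => yp; rewrite gin ?ray.
    rewrite -[X in (_ * X)%E]/(sphere2 t) sE -EFinM lee_fin indicE mem_set; last by rewrite /= in_itv /= t1.
    rewrite mulr1 /B ler_pdivlMr //.
    apply: (@le_trans _ _ (n%:R * t ^+ n * s)).
      have -> : t ^+ n = t ^+ n.-1 * t by rewrite -exprSr prednK.
      rewrite mulrA -[leRHS]mulrAC; apply: ler_wpM2l => //.
      by rewrite mulr_ge0 // mulr_ge0 // exprn_ge0 // ltW.
    apply: le_trans sK _; apply: ler_wpM2l => //; apply: vol_mono => //; exact: ltW.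
rewrite (_ : (fun t => _) = fun t => (B%:E * (\1_([set` `[r1, r2[%R]) t)%:E)%E); last by apply/funext => t; rewrite EFinM.
have mi : measurable_fun [set` `](0 : R), +oo[%R] (fun t : R => (\1_([set` `[r1, r2[%R]) t)%:E : \bar R).
  by apply/measurable_EFinP; apply: measurable_funTS; exact: measurable_indic.
have B0E : (0 <= B%:E)%E by rewrite lee_fin.
have i0 (t : R) : [set` `](0 : R), +oo[%R] t -> (0 <= (\1_([set` `[r1, r2[%R]) t)%:E :> \bar R)%E by rewrite lee_fin.
rewrite (@ge0_integralZl _ _ _ mu _ (measurable_itv _) _ mi _ i0 B0E).
rewrite integral_indic //.
apply: (@le_trans _ _ (B%:E * mu [set` `[r1, r2[%R])%E).
  apply: lee_wpmul2l; first by rewrite lee_fin.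
  by apply: le_measure; [rewrite inE; exact: measurableI|rewrite inE; exact: measurable_itv|exact: subIsetl].
rewrite lebesgue_measure_itv /= lte_fin r12 -EFinB -EFinM lee_fin /B.
by rewrite le_eqVlt; apply/orP; left; apply/eqP; ring.
Qed.

Lemma bernoulli_ineq (x : R) k : 0 <= x -> 1 + k%:R * x <= (1 + x) ^+ k.
Proof.
move=> x0; elim: k => [|k IH]; first by rewrite expr0 mul0r addr0.
rewrite exprS -natr1; have := ler_wpM2l (addr_ge0 ler01 x0) IH.
have : 0 <= k%:R * x ^+ 2 by rewrite mulr_ge0 // sqr_ge0.
rewrite expr2; move: (k%:R : R) ((1 + x) ^+ k) => u v; lra.
Qed.

Variable m : nat.
Hypothesis m0 : (0 < m)%N.
Hypothesis hfreq : forall t, 0 < t < Rad -> frequency h 0 t <= m%:R.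

(** For the ratio [q = 1 + 1/(2K)] the increment in [vol_step] is half of [vol r2], so each step at
    most doubles [vol]. By Bernoulli [q^(4K) >= 3], and [4K = 8 (n + 4 m)] steps suffice. *)
Lemma vol_growth (r : R) : 0 < r -> 3 * r < Rad -> vol (3 * r) <= 2 ^+ (8 * (n + 4 * m)) * vol r.
Proof.
move=> r0 rR.
pose k := (2 * (n + 4 * m))%N; pose K : R := k%:R.
have KE : K = 2 * (n%:R + 4 * m%:R) by rewrite /K /k natrM natrD natrM.
have K0 : 0 < K by rewrite /K ltr0n /k; lia.
pose q : R := 1 + (2 * K)^-1.
have q1 : 1 < q by rewrite ltrDl invr_gt0 mulr_gt0.
have q0 : 0 < q by exact: lt_trans q1.
have HS t : 0 < t < Rad -> exists s : R, [/\ sphere2 t = s%:E, 0 <= s & n%:R * t ^+ n * s <= K * vol t].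
  by move=> tR; have /andP[t0 t1] := tR; rewrite KE; apply: sphere2_growth => //; exact: hfreq.
have step r' : 0 < r' -> r' < Rad -> vol r' <= 2 * vol (r' / q).
  move=> r'0 r'R; have d0 : 0 < r' / q by exact: divr_gt0.
  have dr : r' / q < r' by rewrite ltr_pdivrMr // ltr_pMr.
  have := vol_step d0 dr r'R (ltW K0) HS.
  have -> : (r' - r' / q) / (r' / q) * K = 2^-1.
    rewrite /q; field; rewrite gt_eqF //= ?andbT; apply/andP; split; last by rewrite gt_eqF.
    by rewrite gt_eqF // addr_gt0 // mulr_gt0.
  lra.
have iter j r' : 0 < r' -> r' < Rad -> r' <= q ^+ j * r -> vol r' <= 2 ^+ j * vol r.
  elim: j r' => [|j IH] r' r'0 r'R.
    by rewrite !expr0 !mul1r => r'r; apply: vol_mono => //; lra.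
  rewrite exprS -mulrA => r'q; apply: le_trans (step _ r'0 r'R) _.
  rewrite exprS -mulrA ler_wpM2l //; apply: IH; first exact: divr_gt0.
    by apply: le_lt_trans r'R; rewrite ler_pdivrMr // ler_pMr // ltW.
  by rewrite ler_pdivrMr // mulrC.
apply: iter => //; first by rewrite mulr_gt0.
rewrite ler_wpM2r ?(ltW r0) //.
have x0 : 0 <= (2 * K)^-1 by rewrite invr_ge0 ltW // mulr_gt0.
apply: le_trans (bernoulli_ineq (8 * (n + 4 * m)) x0).
rewrite (_ : (8 * (n + 4 * m))%:R = 4 * K); last by rewrite /K /k -natrM; congr (_%:R); lia.
by rewrite le_eqVlt; apply/orP; left; apply/eqP; field; rewrite gt_eqF.
Qed.

(** Cauchy-Schwarz, from the nonnegativity of the integral of [(a |h| - 1)^2] over the ball at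
    [a = mass / vol]. If [vol] is zero, another [a] shows that [mass] is zero. *)
Lemma sqr_mass_le (s : R) : 0 < s -> s < Rad -> mass h s ^+ 2 <= vol s * (s ^+ n * vball n).
Proof.
move=> s0 sR; set b := s ^+ n * _.
have b0 : 0 < b by rewrite mulr_gt0 ?exprn_gt0 ?vball_gt0.
have nc := nice_cutoff hH s0 sR; have nq := nice_sqr_cutoff s0 sR.
have nB : nice (fun y : 'rV[R]_n => \1_(eball (0 : 'rV[R]_n) s) y).
  split; first by apply: measurable_indic; exact: measurable_eball.
  exists 1, s; split => // y; first by rewrite indicE; case: (_ \in _); rewrite ?normr1 ?normr0.
  by move=> y2; rewrite indicE memNset // eball0E; apply/negP; rewrite -leNgt.
have IB : I n (fun y : 'rV[R]_n => \1_(eball (0 : 'rV[R]_n) s) y) = b.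
  rewrite /Rintegral integral_indic //; last exact: measurable_eball.
  by have := @lam_eball R n 0 s s0; rewrite setIT => E; rewrite [X in fine X]E.
have key a : 2 * a * mass h s <= a ^+ 2 * vol s + b.
  have -> : a ^+ 2 * vol s + b = I n (fun z => a ^+ 2 * cutoff h s z ^+ 2 + \1_(eball (0 : 'rV[R]_n) s) z).
    by rewrite I_D // ?IB ?I_Z //; exact: niceZ.
  rewrite /mass -I_Z; last exact: nice_norm.
  apply: I_le; [by apply: niceZ; exact: nice_norm|by apply: niceD => //; exact: niceZ|].
  move=> z; have [zs|zs] := ltP (enorm z) s; last first.
    by rewrite cutoff_out // normr0 mulr0 expr0n mulr0 add0r.
  rewrite indicE mem_set ?eball0E // cutoff_in // -(real_normK (num_real (h z))).
  rewrite [X in _ + X](_ : _ = 1) //; have := sqr_ge0 (a * `|h z| - 1).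
  move: (`|h z|) => x; rewrite !expr2; lra.
have v0 := vol_ge0 s0 sR; have M0 := mass_ge0 h s.
move: v0; rewrite le_eqVlt => /orP[/eqP v0|v0].
  rewrite -v0 mul0r; move: M0; rewrite le_eqVlt => /orP[/eqP <-|M0]; first by rewrite expr0n.
  have := key (b / mass h s); rewrite -v0 mulr0 add0r -mulrA mulfVK ?gt_eqF //; lra.
have := key (mass h s / vol s).
have -> : 2 * (mass h s / vol s) * mass h s = 2 * (mass h s ^+ 2 / vol s) by rewrite expr2; ring.
have -> : (mass h s / vol s) ^+ 2 * vol s = mass h s ^+ 2 / vol s by field; rewrite gt_eqF.
by move=> H; rewrite mulrC -ler_pdivrMr //; lra.
Qed.

End growth.

(** * Angular derivatives *)

Section rotation.
Context {R : realType} (n : nat) (i j : 'I_n).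
Hypothesis ij : i != j.

Definition rot (th : R) (x : 'rV[R]_n) : 'rV[R]_n :=
  \row_k (if k == i then x ord0 i * cos th - x ord0 j * sin th
          else if k == j then x ord0 j * cos th + x ord0 i * sin th else x ord0 k).

Lemma rot_i th x : rot th x ord0 i = x ord0 i * cos th - x ord0 j * sin th.
Proof. by rewrite mxE eqxx. Qed.

Lemma rot_j th x : rot th x ord0 j = x ord0 j * cos th + x ord0 i * sin th.
Proof. by rewrite mxE eqxx eq_sym (negbTE ij). Qed.

Lemma rot_out th x k : k != i -> k != j -> rot th x ord0 k = x ord0 k.
Proof. by move=> ki kj; rewrite mxE (negbTE ki) (negbTE kj). Qed.

Lemma rot_ext (x y : 'rV[R]_n) : x ord0 i = y ord0 i -> x ord0 j = y ord0 j ->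
  (forall k, k != i -> k != j -> x ord0 k = y ord0 k) -> x = y.
Proof.
move=> xi xj xk; apply/rowP => k.
by have [->//|ki] := eqVneq k i; have [->//|kj] := eqVneq k j; exact: xk.
Qed.

Lemma rot_comp th ph x : rot th (rot ph x) = rot (th + ph) x.
Proof.
apply: rot_ext => [||k ki kj]; last by rewrite !rot_out.
- rewrite !rot_i rot_j cosD sinD; ring.
- rewrite !rot_j rot_i cosD sinD; ring.
Qed.

Lemma rot0 x : rot 0 x = x.
Proof.
apply: rot_ext => [||k ki kj]; last by rewrite rot_out.
- by rewrite rot_i cos0 sin0; ring.
- by rewrite rot_j cos0 sin0; ring.
Qed.

Lemma rotK th : cancel (rot th) (rot (- th)).
Proof. by move=> x; rewrite rot_comp addNr rot0. Qed.

Lemma rotD th : {morph rot th : x y / x + y}.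
Proof.
move=> x y; apply: rot_ext => [||k ki kj].
- by rewrite [RHS]mxE !rot_i !mxE; ring.
- by rewrite [RHS]mxE !rot_j !mxE; ring.
- by rewrite [RHS]mxE !rot_out // mxE.
Qed.

Lemma sum_ij (f : 'I_n -> R) : \sum_k f k = f i + f j + \sum_(k | (k != i) && (k != j)) f k.
Proof. by rewrite (bigD1 i) //= (bigD1 j) 1?eq_sym //= addrA. Qed.

(** This is a trigonometric polynomial of degree one in [th]. As rotations preserve [|x|], the same
    holds for [|z - rot th x|^2], hence for the base of the bump. *)
Lemma edot_rot th (z x : 'rV[R]_n) : edot z (rot th x) = edot z x - (z ord0 i * x ord0 i + z ord0 j * x ord0 j) +
  ((z ord0 i * x ord0 i + z ord0 j * x ord0 j) * cos th + (z ord0 j * x ord0 i - z ord0 i * x ord0 j) * sin th).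
Proof.
rewrite /edot !sum_ij rot_i rot_j.
have -> : \sum_(k | (k != i) && (k != j)) z ord0 k * rot th x ord0 k = \sum_(k | (k != i) && (k != j)) z ord0 k * x ord0 k.
  by apply: eq_bigr => k /andP[ki kj]; rewrite rot_out.
ring.
Qed.

Lemma enorm_rot th x : enorm (rot th x) = enorm x.
Proof.
rewrite /enorm; congr Num.sqrt; rewrite !sum_ij rot_i rot_j; congr (_ + _).
  have := cos2Dsin2 th; move: (cos th) (sin th) => c s E.
  have -> : forall u v : R, (u * c - v * s) ^+ 2 + (v * c + u * s) ^+ 2 = (u ^+ 2 + v ^+ 2) * (c ^+ 2 + s ^+ 2).
    by move=> u v; ring.
  by rewrite E mulr1.
by apply: eq_bigr => k /andP[ki kj]; rewrite rot_out.
Qed.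

Lemma measurable_rot th : measurable_fun setT (rot th).
Proof.
apply: measurable_rVP => k.
have [->|ki] := eqVneq k i.
  under eq_fun do rewrite rot_i.
  by apply: measurable_funB; apply: measurable_funM => //; exact: measurable_coord.
have [->|kj] := eqVneq k j.
  under eq_fun do rewrite rot_j.
  by apply: measurable_funD; apply: measurable_funM => //; exact: measurable_coord.
by under eq_fun do rewrite rot_out //; exact: measurable_coord.
Qed.

(* Derivatives of orders one and two along the rotation group of the [(i, j)]-plane. *)
Definition ang (f : 'rV[R]_n -> R) (y : 'rV[R]_n) : R := y ord0 i * pd j f y - y ord0 j * pd i f y.

Definition ang2 (f : 'rV[R]_n -> R) (y : 'rV[R]_n) : R :=
  - (y ord0 i * pd i f y + y ord0 j * pd j f y) + (y ord0 i * ang (pd j f) y - y ord0 j * ang (pd i f) y).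

Definition rotgen (y : 'rV[R]_n) : 'rV[R]_n :=
  \row_k (if k == i then - y ord0 j else if k == j then y ord0 i else 0).

Lemma rotgen_i y : rotgen y ord0 i = - y ord0 j.
Proof. by rewrite mxE eqxx. Qed.

Lemma rotgen_j y : rotgen y ord0 j = y ord0 i.
Proof. by rewrite mxE eqxx eq_sym (negbTE ij). Qed.

Lemma is_derive_rot (x : 'rV[R]_n) (th : R) k :
  is_derive th (1 : R) (fun t => rot t x ord0 k) (rotgen (rot th x) ord0 k).
Proof.
rewrite /rotgen mxE; have [->|ki] := eqVneq k i.
  rewrite (_ : (fun t => _) = fun t => 0 + (x ord0 i * cos t + (- x ord0 j) * sin t)); last first.
    by apply/funext => t; rewrite rot_i add0r mulNr.
  have -> : - rot th x ord0 j = x ord0 i * - sin th + (- x ord0 j) * cos th by rewrite rot_j; ring.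
  exact: (is_derive_affine2 0 (x ord0 i) (- x ord0 j) (is_derive_cos th) (is_derive_sin th)).
have [->|kj] := eqVneq k j.
  rewrite (_ : (fun t => _) = fun t => 0 + (x ord0 j * cos t + x ord0 i * sin t)); last first.
    by apply/funext => t; rewrite rot_j add0r.
  have -> : rot th x ord0 i = x ord0 j * - sin th + x ord0 i * cos th by rewrite rot_i; ring.
  exact: (is_derive_affine2 0 (x ord0 j) (x ord0 i) (is_derive_cos th) (is_derive_sin th)).
rewrite (_ : (fun t => _) = cst (x ord0 k)); first exact: is_derive_cst.
by apply/funext => t; rewrite rot_out.
Qed.

Lemma is_derive_rot_fun (f : 'rV[R]_n -> R) (x : 'rV[R]_n) (th : R) : differentiable f (rot th x) ->
  is_derive th (1 : R) (fun t => f (rot t x)) (ang f (rot th x)).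
Proof.
move=> df; have := is_derive_curve (is_derive_rot x th) df.
suff -> : \sum_k rotgen (rot th x) ord0 k * pd k f (rot th x) = ang f (rot th x) by [].
rewrite sum_ij big1 ?addr0; last by move=> k /andP[ki kj]; rewrite mxE (negbTE ki) (negbTE kj) mul0r.
by rewrite rotgen_i rotgen_j /ang mulNr addrC.
Qed.

Lemma is_derive_rot_ang (f : 'rV[R]_n -> R) (x : 'rV[R]_n) (th : R) :
  (forall k, differentiable (pd k f) (rot th x)) ->
  is_derive th (1 : R) (fun t => ang f (rot t x)) (ang2 f (rot th x)).
Proof.
move=> df.
have D (k l : 'I_n) := is_deriveM (is_derive_rot x th k) (is_derive_rot_fun (df l)).
have DB := is_deriveB (D i j) (D j i).
apply: (is_derive_eq DB); rewrite /ang2 /GRing.scale /= rotgen_i rotgen_j.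
move: (rot th x) => y; move: (ang _ y) (ang _ y) (pd _ _ y) (pd _ _ y) (y ord0 i) (y ord0 j) => u v u' v' p q; ring.
Qed.

End rotation.

(** * The difference scheme applied to angular derivatives *)

Section tangential.
Context {R : realType} (n : nat) (Rad : R) (h : 'rV[R]_n -> R).
Hypothesis hH : harmonic_on (eball 0 Rad) h.
Notation I n f := (Rintegral (lam n) setT f).
Local Notation cutoff := (cutoff h).
Local Notation mass := (mass h).

(** The error of the scheme for [u] is the integral against [h] of its error for the kernel, so a
    pointwise bound for the kernel is enough. *)
Lemma rep_combination (c s b D : R) (N : nat) (w t : nat -> R) (u : R -> R) (u' : R)
    (U : R -> 'rV[R]_n -> R) (U1 : 'rV[R]_n -> R) :
  0 < s -> s < Rad -> 0 < c ->
  (forall t, c * u t = I n (fun z => U t z * cutoff s z)) -> c * u' = I n (fun z => U1 z * cutoff s z) ->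
  (forall t, measurable_fun setT (U t)) -> measurable_fun setT U1 ->
  (forall t, exists D, forall z, enorm z < s -> `|U t z| <= D) ->
  (exists D, forall z, enorm z < s -> `|U1 z| <= D) ->
  (forall z, enorm z < s -> `|U1 z - b * \sum_(k < N) w k * U (t k) z| <= D) ->
  `|u' - b * \sum_(k < N) w k * u (t k)| <= D * mass s / c.
Proof.
move=> s0 sR c0 rep rep1 mU mU1 bU [D1 bU1] H.
have nU t' : nice (fun z => U t' z * cutoff s z).
  by have [D' bD] := bU t'; exact: (nice_mul_cutoff hH s0 sR (mU t') bD).
have nU1 : nice (fun z => U1 z * cutoff s z) by exact: (nice_mul_cutoff hH s0 sR mU1 bU1).
rewrite ler_pdivlMr // -{1}(gtr0_norm c0) -normrM mulrC.
have -> : c * (u' - b * \sum_(k < N) w k * u (t k)) =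
    I n (fun z => (U1 z - b * \sum_(k < N) w k * U (t k) z) * cutoff s z).
  rewrite mulrBr rep1.
  have -> : c * (b * \sum_(k < N) w k * u (t k)) = b * I n (fun z => \sum_(k < N) w k * (U (t k) z * cutoff s z)).
    rewrite I_sum; last by move=> k; exact: niceZ.
    rewrite mulrCA mulr_sumr; congr (_ * _); apply: eq_bigr => k _.
    by rewrite I_Z // -rep mulrCA.
  have nS : nice (fun z => \sum_(k < N) w k * (U (t k) z * cutoff s z)) by apply: nice_sum => k; exact: niceZ.
  rewrite -mulNr -I_Z // -I_D //; last exact: niceZ.
  apply: eq_Rintegral => z _; rewrite mulrBl mulNr -mulrA mulr_suml.
  by congr (_ - _ * _); apply: eq_bigr => k _; rewrite mulrA.
apply: (I_mul_cutoff_le hH s0 sR _ H).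
apply: measurable_funB => //; apply: measurable_funM; first exact: measurable_cst.
by apply: measurable_sum => k; apply: measurable_funM.
Qed.

Variables (i j : 'I_n).
Hypothesis ij : i != j.

Variables (x : 'rV[R]_n) (rho s : R).
Hypothesis rho0 : 0 < rho.
Hypothesis xrho : enorm x <= 2 * rho.
Hypothesis xs : enorm x + rho <= s.
Hypothesis srho : s <= 3 * rho.
Hypothesis sR : s < Rad.

(** [al], [A] and [B] are the coefficients of [1 - |z - rot th x|^2 / rho^2] as a trigonometric
    polynomial in [th]; [A'] and [B'] are read off from [edot_rot]. *)
Let A' (z : 'rV[R]_n) := z ord0 i * x ord0 i + z ord0 j * x ord0 j.
Let B' (z : 'rV[R]_n) := z ord0 j * x ord0 i - z ord0 i * x ord0 j.
Let al (z : 'rV[R]_n) := 1 - rho^-1 ^+ 2 * (enorm z ^+ 2 + enorm x ^+ 2) + 2 * rho^-1 ^+ 2 * (edot z x - A' z).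
Let A z := 2 * rho^-1 ^+ 2 * A' z.
Let B z := 2 * rho^-1 ^+ 2 * B' z.

Let ebump_rot k th z : ebump k (rho^-1 *: (z - rot i j th x)) = trigF (al z) (A z) (B z) 0 k.+1 0 0 th.
Proof.
rewrite /= !mulr1 /ebump; congr (Num.max _ 0 ^+ _).
rewrite enormZ exprMn real_normK ?num_real // enorm_sqrB (enorm_rot ij) (edot_rot ij) /trigq /al /A /B /A' /B'.
ring.
Qed.

Let s0 : 0 < s.
Proof. by apply: lt_le_trans xs; apply: ltr_wpDl => //; exact: enorm_ge0. Qed.

Let coord_bound (z : 'rV[R]_n) k l : enorm z < s -> `|z ord0 k * x ord0 l| <= 6 * rho ^+ 2.
Proof.
move=> zs; rewrite normrM.
have -> : 6 * rho ^+ 2 = (3 * rho) * (2 * rho) by rewrite expr2; ring.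
apply: ler_pM => //; first by apply: le_trans (enorm_coord z k) _; apply: le_trans srho; exact: ltW.
exact: le_trans (enorm_coord x l) xrho.
Qed.

Let rho2 (a b : R) : `|a| <= b * rho ^+ 2 -> `|rho^-1 ^+ 2 * a| <= b.
Proof.
move=> ab; rewrite normrM normrX (gtr0_norm (_ : 0 < rho^-1)) ?invr_gt0 //.
by rewrite exprVn mulrC ler_pdivrMr ?exprn_gt0.
Qed.

Let bounds (z : 'rV[R]_n) : enorm z < s -> [/\ `|A z| <= 24, `|B z| <= 24 & `|al z| <= 50].
Proof.
move=> zs.
have H1 := coord_bound i i zs; have H2 := coord_bound j j zs.
have H3 := coord_bound j i zs; have H4 := coord_bound i j zs.
have hA : `|A' z| <= 12 * rho ^+ 2 by apply: le_trans (ler_normD _ _) _; lra.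
have hB : `|B' z| <= 12 * rho ^+ 2 by apply: le_trans (ler_normB _ _) _; lra.
have hz : enorm z ^+ 2 <= 9 * rho ^+ 2.
  have -> : 9 * rho ^+ 2 = (3 * rho) ^+ 2 by ring.
  by apply: lerXn2r; rewrite ?nnegrE ?enorm_ge0 ?mulr_ge0 ?(ltW rho0) //; apply: le_trans srho; exact: ltW.
have hx : enorm x ^+ 2 <= 4 * rho ^+ 2.
  have -> : 4 * rho ^+ 2 = (2 * rho) ^+ 2 by ring.
  by apply: lerXn2r; rewrite ?nnegrE ?enorm_ge0 ?mulr_ge0 ?(ltW rho0).
have hd : `|edot z x| <= 6 * rho ^+ 2.
  apply: le_trans (cauchy_schwarz z x) _.
  have -> : 6 * rho ^+ 2 = (3 * rho) * (2 * rho) by rewrite expr2; ring.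
  by apply: ler_pM; rewrite ?enorm_ge0 //; apply: le_trans srho; exact: ltW.
have hs : `|enorm z ^+ 2 + enorm x ^+ 2| <= 13 * rho ^+ 2.
  by rewrite ger0_norm ?addr_ge0 ?sqr_ge0 //; lra.
have hdA : `|edot z x - A' z| <= 18 * rho ^+ 2 by apply: le_trans (ler_normB _ _) _; lra.
have := rho2 hA; have := rho2 hB; have := rho2 hs; have := rho2 hdA.
rewrite /A /B /al -!(mulrA 2) !normrM (ger0_norm (ler0n R 2)) => K1 K2 K3 K4; split; [lra|lra|].
apply: le_trans (ler_normD _ _) _; rewrite normrM (ger0_norm (ler0n R 2)).
have := ler_normB 1 (rho^-1 ^+ 2 * (enorm z ^+ 2 + enorm x ^+ 2)); rewrite normr1.
move: K1 K2; rewrite -!normrM; lra.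
Qed.

(** The radius [rho] is comparable to both [|x|] and [s], so all coefficients are absolute
    constants; 100 exceeds [50 + 24 + 24]. *)
Let trig_bounds (z : 'rV[R]_n) : enorm z < s -> [/\ forall t, `|trigq (al z) (A z) (B z) t| <= 100,
  forall t, `|trigv (A z) (B z) t| <= 100 & `|al z| <= 100].
Proof.
move=> /bounds[hA hB ha].
have cs (a b : R) : `|b| <= 1 -> `|a * b| <= `|a|.
  by move=> b1; rewrite normrM -[leRHS]mulr1 ler_wpM2l.
have cb t : `|cos t| <= 1 :> R by rewrite ler_norml cos_geN1 cos_le1.
have sb t : `|sin t| <= 1 :> R by rewrite ler_norml sin_geN1 sin_le1.
split; last by apply: le_trans ha _; lra.
  move=> t; apply: le_trans (ler_normD _ _) _.
  have := ler_normD (A z * cos t) (B z * sin t); have := cs (A z) _ (cb t); have := cs (B z) _ (sb t); lra.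
move=> t; apply: le_trans (ler_normB _ _) _.
have := cs (B z) _ (cb t); have := cs (A z) _ (sb t); lra.
Qed.

Let cA' : forall z : 'rV[R]_n, {for z, continuous A'}.
Proof.
by rewrite /A' => z; apply: continuousD; apply: continuousM; try exact: cst_continuous; exact: coord_continuous.
Qed.

Let cB' : forall z : 'rV[R]_n, {for z, continuous B'}.
Proof.
by rewrite /B' => z; apply: continuousB; apply: continuousM; try exact: cst_continuous; exact: coord_continuous.
Qed.

Let cal : forall z : 'rV[R]_n, {for z, continuous al}.
Proof.
rewrite /al => z; apply: continuousD.
  apply: continuousB; first exact: cst_continuous.
  apply: continuousM; first exact: cst_continuous.
  apply: continuousD; last exact: cst_continuous.
  apply: (@continuous_comp _ _ _ (@enorm R n) (fun t : R => t ^+ 2)); first exact: continuous_enorm.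
  exact: exprn_continuous.
apply: continuousM; first exact: cst_continuous.
apply: continuousB; last exact: cA'.
rewrite /edot; apply: continuous_sum => k; apply: continuousM; [exact: coord_continuous|exact: cst_continuous].
Qed.

Let mF jj a t : measurable_fun setT (fun z => trigF (al z) (A z) (B z) jj a 0 0 t).
Proof.
apply: continuous_measurable_rV; first exact: openT.
move=> z _; apply: continuous_trigF.
- exact: cal.
- by rewrite /A; apply: continuousM; [exact: cst_continuous|exact: cA'].
- by rewrite /B; apply: continuousM; [exact: cst_continuous|exact: cB'].
Qed.

Let bF jj a t : exists D, forall z, enorm z < s -> `|trigF (al z) (A z) (B z) jj a 0 0 t| <= D.
Proof.
exists ((2 * (a + 0 + 0)%N%:R) ^+ jj * 100 ^+ (a + 0 + 0)) => z /trig_bounds[Hq Hv Ha].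
exact: trigF_bound.
Qed.

Let quadF jj a th : (jj.+2 < a)%N -> exists2 C, 0 <= C & forall t z, enorm z < s ->
  `|trigF (al z) (A z) (B z) jj a 0 0 (t + th) - trigF (al z) (A z) (B z) jj a 0 0 th
    - trigF (al z) (A z) (B z) jj.+1 a 0 0 th * t| <= C * t ^+ 2.
Proof.
move=> ja; pose M : R := (2 * (a + 0 + 0)%N%:R) ^+ jj.+2 * 100 ^+ (a + 0 + 0).
exists (M / 2); first by rewrite divr_ge0 // mulr_ge0 // exprn_ge0 // mulr_ge0.
move=> t z /trig_bounds[Hq Hv Ha].
pose F k := trigF (al z) (A z) (B z) (jj + k) a 0 0.
have FD k (u : R) : (k < 2)%N -> is_derive u (1 : R) (F k) (F k.+1 u).
  move=> k2; rewrite /F addnS; apply: is_derive_trigF; apply: leq_ltn_trans ja.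
  by rewrite -addnS -[jj.+2]addn2 leq_add2l.
have FM u : `|F 2%N u| <= M by rewrite /F addnC; exact: trigF_bound.
have := @taylor_bound R 2 F M th t FD FM.
rewrite !big_ord_recl big_ord0 /= expr0 fact0 divr1 mulr1 addr0 /bump /= expr1 /F addn0 addn1.
rewrite (_ : 1`!%:R = 1) // divr1 (_ : 2`!%:R = 2) // (addrC th) opprD addrA.
by rewrite -normrX (ger0_norm (sqr_ge0 t)) mulrAC.
Qed.

(** One kernel and its two [th]-derivatives represent [h], [ang] and [ang2]. The main terms only
    evaluate [h] or [ang] at points of the same norm as [x]; the mass over the larger ball appears
    in [E] alone. *)
Lemma tangential_estimate (m : nat) (c a : nat -> R) (c0 : R) : (0 < m)%N -> 0 < c0 ->
  \sum_(k < m.*2) `|c k| <= 3 -> (forall k, (k < m.*2)%N -> `|a k| <= m.*2%:R) ->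
  (forall l, (l < m.*2)%N -> \sum_(k < m.*2) c k * a k ^+ l = (l == 1%N)%:R) ->
  let err := 3 * 100 ^+ 2 * (m%:R / c0) * (8 * c0 * 100 * expR 1) ^+ m.*2 in
  let E := err * mass s / (rho ^+ n * I n (@ebump R n m.*2.+1)) in
  `|ang i j h x| <= m%:R / c0 * \sum_(k < m.*2) `|c k| * `|h (rot i j (c0 / m%:R * a k) x)| + E /\
  `|ang2 i j h x| <= m%:R / c0 * \sum_(k < m.*2) `|c k| * `|ang i j h (rot i j (c0 / m%:R * a k) x)| + 8 * m%:R * E.
Proof.
move=> m0 c00 Hc Ha Hex err E.
set cK := rho ^+ n * _ in E *.
have cK0 : 0 < cK by rewrite mulr_gt0 ?exprn_gt0 // ebump_mass_gt0.
(* The exponent of [ebump m.*2.+1]: it gives [2m+1] derivatives, so that the scheme of order [2m]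
   also applies to the first derivative. *)
pose K := m.*2.+2.
have K3 : (3 < K)%N by have := m0; rewrite -leq_double /K !ltnS.
pose F jj t z := trigF (al z) (A z) (B z) jj K 0 0 t.
have rxR t : enorm (rot i j t x) < Rad.
  by rewrite (enorm_rot ij); apply: lt_trans sR; apply: lt_le_trans xs; rewrite ltrDl.
have rep0 t : cK * h (rot i j t x) = I n (fun z => F 0%N t z * cutoff s z).
  rewrite /cK (kernel_rep hH m.*2.+1 (x := rot i j t x) rho0 _ sR); last by rewrite (enorm_rot ij).
  by apply: eq_Rintegral => z _; rewrite ebump_rot.
have rep1 t : cK * ang i j h (rot i j t x) = I n (fun z => F 1%N t z * cutoff s z).
  have Dh : is_derive t (1 : R) (fun t => h (rot i j t x)) (ang i j h (rot i j t x)).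
    by apply: (is_derive_rot_fun ij); have := hH (x := rot i j t x); rewrite eball0E => /(_ (rxR t))[].
  have [|C C0 HC] := @quadF 0 K t; first exact: ltnW.
  apply: (rep_derive hH s0 sR C0 Dh rep0 _ _ _ _ HC) => [t'||t'|]; try exact: mF; exact: bF.
have rep2 t : cK * ang2 i j h (rot i j t x) = I n (fun z => F 2%N t z * cutoff s z).
  have Dh : is_derive t (1 : R) (fun t => ang i j h (rot i j t x)) (ang2 i j h (rot i j t x)).
    by apply: (is_derive_rot_ang ij) => k; have := hH (x := rot i j t x); rewrite eball0E => /(_ (rxR t))[].
  have [|C C0 HC] := @quadF 1 K t.
    exact: K3.
  apply: (rep_derive hH s0 sR C0 Dh rep1 _ _ _ _ HC) => [t'||t'|]; try exact: mF; exact: bF.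
have ndiff z : enorm z < s ->
    `|F 1%N 0 z - m%:R / c0 * \sum_(k < m.*2) c k * F 0%N (c0 / m%:R * a k) z| <= err /\
    `|F 2%N 0 z - m%:R / c0 * \sum_(k < m.*2) c k * F 1%N (c0 / m%:R * a k) z| <= 8 * m%:R * err.
  move=> /trig_bounds[Hq Hv Hal].
  have [H1 H2] := trig_numdiff 0 m0 c00 Hc Ha Hex Hq Hv Hal.
  have e0 k : c0 / m%:R * a k = 0 + c0 / m%:R * a k by rewrite add0r.
  split; under eq_bigr do rewrite e0; [exact: H1|exact: H2].
have fin (u : R -> R) (u' D : R) : `|u' - m%:R / c0 * \sum_(k < m.*2) c k * u (c0 / m%:R * a k)| <= D ->
    `|u'| <= m%:R / c0 * \sum_(k < m.*2) `|c k| * `|u (c0 / m%:R * a k)| + D.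
  move=> H; rewrite -[u'](subrK (m%:R / c0 * \sum_(k < m.*2) c k * u (c0 / m%:R * a k))) addrC.
  apply: le_trans (ler_normD _ _) _; apply: lerD H.
  rewrite normrM (ger0_norm (_ : 0 <= m%:R / c0)) ?divr_ge0 ?(ltW c00) //.
  apply: ler_wpM2l; first by rewrite divr_ge0 // ltW.
  by apply: le_trans (ler_norm_sum _ _ _) _; apply: ler_sum => k _; rewrite normrM.
have E2 : 8 * m%:R * E = 8 * m%:R * err * mass s / cK by rewrite /E !mulrA.
split.
- have := rep1 0; rewrite (rot0 ij) => rep10.
  apply: (fin (fun t => h (rot i j t x))).
  apply: (@rep_combination cK s (m%:R / c0) err m.*2 c (fun k => c0 / m%:R * a k) (fun t => h (rot i j t x)) _ _ _ s0 sR cK0 rep0 rep10) => [t'||t'||z zs]; try exact: mF; try exact: bF.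
  exact: (ndiff z zs).1.
- have := rep2 0; rewrite (rot0 ij) => rep20.
  rewrite E2; apply: (fin (fun t => ang i j h (rot i j t x))).
  apply: (@rep_combination cK s (m%:R / c0) (8 * m%:R * err) m.*2 c (fun k => c0 / m%:R * a k) (fun t => ang i j h (rot i j t x)) _ _ _ s0 sR cK0 rep1 rep20) => [t'||t'||z zs]; try exact: mF; try exact: bF.
  exact: (ndiff z zs).2.
Qed.

End tangential.

(** * Bounds on all Lq norms at once *)

Section jensen.
Context {R : realType}.

(** Convexity: the power lies above its tangent at [s]. The terms are arranged without subtraction,
    ready for extended-valued integrals; at [s = 0] the quotient is zero and the inequality stays
    true. *)
Lemma powR_tangent (q s t : R) : 1 <= q -> 0 <= s -> 0 <= t ->
  s `^ q + q * s `^ q * (t / s) <= t `^ q + q * s `^ q.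
Proof.
move=> q1 s0 t0; have q0 : 0 < q by exact: lt_le_trans q1.
move: s0; rewrite le_eqVlt => /orP[/eqP <-|s0].
  by rewrite powR0 ?gt_eqF // mulr0 mul0r !addr0 powR_ge0.
set u := t / s; have u0 : 0 <= u by rewrite divr_ge0 // ltW.
have -> : t = u * s by rewrite /u divfK // gt_eqF.
rewrite powRM //; last exact: ltW.
have sq : 0 < s `^ q by exact: powR_gt0.
suff H : 1 + q * u <= u `^ q + q.
  have := ler_wpM2r (ltW sq) H; rewrite !mulrDl mul1r mulrAC; lra.
move: q1; rewrite le_eqVlt => /orP[/eqP <-|q1].
  by rewrite powRr1 // mul1r addrC.
(* Young's inequality for [u] and [1] *)
pose p := (1 - q^-1)^-1.
have qV : q^-1 < 1 by rewrite invf_lt1.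
have p0 : 0 < p by rewrite invr_gt0 subr_gt0.
have qp : q^-1 + p^-1 = 1 by rewrite /p invrK addrC subrK.
have := conjugate_powR u0 ler01 q0 p0 qp; rewrite powR1 mulr1 mul1r /p invrK => H.
have := ler_wpM2l (ltW q0) H.
have -> : q * (u `^ q / q + (1 - q^-1)) = u `^ q + q - 1 by field; rewrite gt_eqF.
lra.
Qed.

(** The tangent inequality at the mean value [s = S / w], integrated over [D]: the linear terms
    cancel. *)
Lemma jensen_powR d (T : measurableType d) (mu : {measure set T -> \bar R}) (D : set T) (w S q : R) (f : T -> R) :
  measurable D -> mu D = w%:E -> 0 < w -> measurable_fun D f -> (forall x, D x -> 0 <= f x) ->
  (\int[mu]_(x in D) (f x)%:E = S%:E)%E -> 1 <= q ->
  (((S / w) `^ q * w)%:E <= \int[mu]_(x in D) (f x `^ q)%:E)%E.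
Proof.
move=> mD muD w0 mf f0 fS q1.
have S0 : 0 <= S by rewrite -lee_fin -fS; apply: integral_ge0 => x Dx; rewrite lee_fin f0.
pose s := S / w; have s0 : 0 <= s by rewrite divr_ge0 // ltW.
have c0 : 0 <= q * s `^ q by rewrite mulr_ge0 ?powR_ge0 // (le_trans ler01).
have mfq : measurable_fun D (fun x => (f x `^ q)%:E).
  by apply/measurable_EFinP; apply: (measurableT_comp (measurable_powR q) mf).
have mfE : measurable_fun D (fun x => (f x)%:E) by apply/measurable_EFinP.
have fq0 x : D x -> (0 <= (f x `^ q)%:E)%E by rewrite lee_fin powR_ge0.
have cs0 : 0 <= q * s `^ q / s by rewrite divr_ge0.
have fE0 x : D x -> (0 <= (f x)%:E)%E by rewrite lee_fin; exact: f0.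
have L : (\int[mu]_(x in D) ((s `^ q)%:E + (q * s `^ q / s)%:E * (f x)%:E) = (s `^ q * w + q * s `^ q / s * S)%:E)%E.
  rewrite ge0_integralD //; last 3 first.
  - by move=> x _; rewrite lee_fin powR_ge0.
  - by move=> x Dx; apply: mule_ge0; [rewrite lee_fin|exact: fE0].
  - by apply: emeasurable_funM => //; exact: measurable_cst.
  rewrite (@ge0_integralZl _ _ _ mu D mD _ mfE) // ?lee_fin // fS.
  by rewrite (integral_cst mu mD) muD -!EFinM -EFinD.
have U : (\int[mu]_(x in D) ((f x `^ q)%:E + (q * s `^ q)%:E) = \int[mu]_(x in D) (f x `^ q)%:E + (q * s `^ q * w)%:E)%E.
  rewrite ge0_integralD //.
  by rewrite (integral_cst mu mD) muD -EFinM.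
have LU : (\int[mu]_(x in D) ((s `^ q)%:E + (q * s `^ q / s)%:E * (f x)%:E) <=
   \int[mu]_(x in D) ((f x `^ q)%:E + (q * s `^ q)%:E))%E.
  apply: ge0_le_integral => //.
  - by move=> x Dx; apply: adde_ge0; [rewrite lee_fin powR_ge0|apply: mule_ge0; [rewrite lee_fin|exact: fE0]].
  - apply: emeasurable_funD; first exact: measurable_cst.
    by apply: emeasurable_funM => //; exact: measurable_cst.
  - by apply: emeasurable_funD => //; exact: measurable_cst.
  - move=> x Dx; rewrite -EFinM -!EFinD lee_fin.
    have := powR_tangent q1 s0 (f0 x Dx); by rewrite mulrA mulrAC.
move: LU; rewrite L U.
have -> : q * s `^ q / s * S = q * s `^ q * w.
  have [s00|sn0] := eqVneq s 0.
    by rewrite s00 powR0 ?gt_eqF ?(lt_le_trans ltr01) // !mulr0 !mul0r.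
  by rewrite -mulrA; congr (_ * _); rewrite /s invf_div mulrC mulrCA mulfV ?mulr1 //; apply: contra_neq sn0 => S00; rewrite /s S00 mul0r.
by rewrite EFinD leeD2rE.
Qed.

End jensen.

(** * Calculus of domination in the ball *)

Section domination.
Context {R : realType} (n : nat) (r : R) (f0 : 'rV[R]_n -> R).
Notation mu := (@lebesgue_measure R).
Notation I n f := (Rintegral (lam n) setT f).
Hypothesis r0 : 0 < r.
Hypothesis nf0 : nice f0.
Hypothesis f00 : forall z, 0 <= f0 z.

Notation chi z := (\1_(eball (0 : 'rV[R]_n) r) z : R).

Definition moment (q : R) (F : 'rV[R]_n -> R) : \bar R := (\int[lam n]_z (F z `^ q * chi z)%:E)%E.

(* [F] is at most [A] times [f0] in the norm of [L^q(B(0,r))] for every finite [q >= 1]; the case [q = oo]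
   follows by letting [q] tend to infinity. *)
Definition dom (A : R) (F : 'rV[R]_n -> R) := [/\ measurable_fun setT F, forall z, 0 <= F z, 0 < A &
  forall q, 1 <= q -> (moment q F <= (A `^ q)%:E * moment q f0)%E].

Lemma measurable_moment q F : measurable_fun setT F -> measurable_fun setT (fun z => (F z `^ q * chi z)%:E).
Proof.
move=> mF; apply/measurable_EFinP; apply: measurable_funM.
  exact: (measurableT_comp (measurable_powR q) mF).
by apply: measurable_indic; exact: measurable_eball.
Qed.

Lemma chi_ge0 z : 0 <= chi z. Proof. by []. Qed.

Lemma moment_integrand_ge0 q F z : (0 <= (F z `^ q * chi z)%:E)%E.
Proof. by rewrite lee_fin; apply: mulr_ge0; [exact: powR_ge0|exact: chi_ge0]. Qed.

Lemma moment_ge0 q F : (0 <= moment q F)%E.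
Proof. by apply: integral_ge0 => z _; exact: moment_integrand_ge0. Qed.

Lemma chi_in z : enorm z < r -> chi z = 1.
Proof. by move=> zr; rewrite indicE mem_set // /eball /= subr0. Qed.

Lemma chi_out z : r <= enorm z -> chi z = 0.
Proof. by move=> zr; rewrite indicE memNset // /eball /= subr0; apply/negP; rewrite -leNgt. Qed.

Lemma moment_le q F G c : 0 <= c -> measurable_fun setT F -> measurable_fun setT G ->
  (forall z, enorm z < r -> F z `^ q <= c * G z `^ q) -> (moment q F <= c%:E * moment q G)%E.
Proof.
move=> c0 mF mG FG; have c0E : (0 <= c%:E)%E by rewrite lee_fin.
rewrite /moment -(lamZl (measurable_moment q mG) (moment_integrand_ge0 q G) c0E).
apply: ge0_le_integral => //.
- by move=> z _; exact: moment_integrand_ge0.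
- exact: measurable_moment.
- by apply: emeasurable_funM; [exact: measurable_cst|exact: measurable_moment].
- move=> z _; rewrite -EFinM lee_fin; have [zr|zr] := ltP (enorm z) r.
    by rewrite chi_in // !mulr1; exact: FG.
  by rewrite chi_out // !mulr0.
Qed.

Lemma dom_le (A A' c : R) (F G : 'rV[R]_n -> R) : dom A F -> measurable_fun setT G -> (forall z, 0 <= G z) -> 0 <= c ->
  (forall z, enorm z < r -> G z <= c * F z) -> c * A <= A' -> 0 < A' -> dom A' G.
Proof.
move=> [mF F0 A0 HF] mG G0 c0 GF cA A'0; split => // q q1.
have q0 : 0 <= q by exact: le_trans q1.
have H : (moment q G <= (c `^ q)%:E * moment q F)%E.
  apply: moment_le => //; first exact: powR_ge0.
  move=> z zr; rewrite -powRM //; apply: (ge0_ler_powR q0); rewrite ?nnegrE //.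
    by rewrite mulr_ge0.
  exact: GF.
apply: (le_trans H); apply: (@le_trans _ _ ((c `^ q)%:E * ((A `^ q)%:E * moment q f0))%E).
  by apply: lee_wpmul2l; [rewrite lee_fin powR_ge0|exact: HF].
rewrite muleA -EFinM -(@powRM _ c A q c0 (ltW A0)); apply: lee_wpmul2r; first exact: moment_ge0.
rewrite lee_fin; apply: (ge0_ler_powR q0); rewrite ?nnegrE //; first by rewrite mulr_ge0 // ltW.
exact: ltW.
Qed.

Lemma dom_self : dom 1 f0.
Proof. by split => //; [exact: nf0.1|move=> q _; rewrite powR1 mul1e]. Qed.

Lemma dom_zero A : 0 < A -> dom A (fun=> 0).
Proof.
move=> A0; apply: (dom_le dom_self (c := 0)) => //; first by move=> z _; rewrite mul0r.
by rewrite mul0r ltW.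
Qed.

(** Minkowski's inequality by convexity: [(F + G)/(A + B)] is the mean of [F/A] and [G/B] with
    weights [A/(A+B)] and [B/(A+B)], and the moments of both are at most that of [f0]. *)
Lemma dom_add (A B : R) (F G : 'rV[R]_n -> R) : dom A F -> dom B G -> dom (A + B) (fun z => F z + G z).
Proof.
move=> [mF F0 A0 HF] [mG G0 B0 HG]; have AB : 0 < A + B by exact: addr_gt0.
split => //; [exact: measurable_funD|by move=> z; rewrite addr_ge0|].
move=> q q1; have q0 : 0 <= q by exact: le_trans q1.
have qn0 : q != 0 by rewrite gt_eqF // (lt_le_trans ltr01).
pose a := (A + B) `^ q * (A / (A + B)) / A `^ q.
pose b := (A + B) `^ q * (B / (A + B)) / B `^ q.
have a0 : 0 <= a by rewrite divr_ge0 ?powR_ge0 // mulr_ge0 ?powR_ge0 // divr_ge0 // ltW.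
have b0 : 0 <= b by rewrite divr_ge0 ?powR_ge0 // mulr_ge0 ?powR_ge0 // divr_ge0 // ltW.
have pt z : (F z + G z) `^ q <= a * F z `^ q + b * G z `^ q.
  pose s := (F z + G z) / (A + B); pose t1 := F z / A; pose t2 := G z / B.
  have t10 : 0 <= t1 by rewrite divr_ge0 // ltW.
  have t20 : 0 <= t2 by rewrite divr_ge0 // ltW.
  have s0 : 0 <= s by rewrite divr_ge0 ?addr_ge0 // ltW.
  have sE : A / (A + B) * t1 + B / (A + B) * t2 = s.
    by rewrite /s /t1 /t2; field; rewrite !gt_eqF.
  have FE : F z = A * t1 by rewrite /t1 mulrC divfK // gt_eqF.
  have GE : G z = B * t2 by rewrite /t2 mulrC divfK // gt_eqF.
  have -> : F z + G z = (A + B) * s by rewrite /s mulrC divfK // gt_eqF.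
  rewrite FE GE (@powRM _ A t1 q (ltW A0) t10) (@powRM _ B t2 q (ltW B0) t20) (@powRM _ (A + B) s q (ltW AB) s0).
  have Aq : 0 < A `^ q by exact: powR_gt0.
  have Bq : 0 < B `^ q by exact: powR_gt0.
  have -> : a * (A `^ q * t1 `^ q) = (A + B) `^ q * (A / (A + B) * t1 `^ q).
    by rewrite /a mulrA divfK ?gt_eqF // -mulrA.
  have -> : b * (B `^ q * t2 `^ q) = (A + B) `^ q * (B / (A + B) * t2 `^ q).
    by rewrite /b mulrA divfK ?gt_eqF // -mulrA.
  rewrite -mulrDr ler_wpM2l ?powR_ge0 //.
  have w10 : 0 <= A / (A + B) by rewrite divr_ge0 // ltW.
  have w20 : 0 <= B / (A + B) by rewrite divr_ge0 // ltW.
  have w12 : A / (A + B) + B / (A + B) = 1 by field; rewrite gt_eqF.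
  have H1 := ler_wpM2l w10 (powR_tangent q1 s0 t10).
  have H2 := ler_wpM2l w20 (powR_tangent q1 s0 t20).
  have E : q * s `^ q * ((A / (A + B) * t1 + B / (A + B) * t2) / s) = q * s `^ q.
    rewrite sE; have [->|sn0] := eqVneq s 0; last by rewrite divff // mulr1.
    by rewrite powR0 // mulr0 mul0r.
  move: H1 H2 E w12; move: (A / _) (B / _) (s `^ q) (t1 `^ q) (t2 `^ q) => u v S T1 T2 H1 H2 E w12.
  have := lerD H1 H2.
  have -> : u * (S + q * S * (t1 / s)) + v * (S + q * S * (t2 / s)) =
    (u + v) * S + q * S * ((u * t1 + v * t2) / s) by ring.
  have -> : u * (T1 + q * S) + v * (T2 + q * S) = u * T1 + v * T2 + (u + v) * (q * S) by ring.
  rewrite E w12 !mul1r; lra.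
have aE : (0 <= a%:E)%E by rewrite lee_fin.
have bE : (0 <= b%:E)%E by rewrite lee_fin.
have mFq := measurable_moment q mF; have mGq := measurable_moment q mG.
apply: (@le_trans _ _ (a%:E * moment q F + b%:E * moment q G)%E).
  rewrite /moment -(lamZl mFq (moment_integrand_ge0 q F) aE) -(lamZl mGq (moment_integrand_ge0 q G) bE).
  rewrite -ge0_integralD //; last 4 first.
  - by move=> z _; apply: mule_ge0 => //; exact: moment_integrand_ge0.
  - by apply: emeasurable_funM; [exact: measurable_cst|].
  - by move=> z _; apply: mule_ge0 => //; exact: moment_integrand_ge0.
  - by apply: emeasurable_funM; [exact: measurable_cst|].
  apply: ge0_le_integral => //.
  - by move=> z _; apply: (moment_integrand_ge0 q (fun z => F z + G z)).
  - by apply: (measurable_moment q); exact: measurable_funD.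
  - apply: emeasurable_funD; apply: emeasurable_funM => //; exact: measurable_cst.
  - move=> z _; rewrite -!EFinM -EFinD lee_fin !mulrA -mulrDl; apply: ler_wpM2r; [exact: chi_ge0|exact: pt].
have Aq : A `^ q != 0 by rewrite gt_eqF // powR_gt0.
have Bq : B `^ q != 0 by rewrite gt_eqF // powR_gt0.
have -> : (A + B) `^ q = a * A `^ q + b * B `^ q.
  by rewrite /a /b !divfK // -mulrDr -mulrDl divff ?mulr1 // gt_eqF.
have aq0 : (0 <= (a * A `^ q)%:E)%E by rewrite lee_fin mulr_ge0 // powR_ge0.
have bq0 : (0 <= (b * B `^ q)%:E)%E by rewrite lee_fin mulr_ge0 // powR_ge0.
rewrite EFinD ge0_muleDl; [|exact: aq0|exact: bq0].
rewrite (EFinM a) (EFinM b) -!muleA; apply: leeD; apply: lee_wpmul2l => //; [exact: HF|exact: HG].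
Qed.

(** [dom] asks for a positive constant; the slack [e] supplies it when all weights vanish. *)
Lemma dom_sum N (A e : R) (w : nat -> R) (F : nat -> 'rV[R]_n -> R) : 0 < A -> 0 < e -> (forall k, 0 <= w k) ->
  (forall k, (k < N)%N -> dom A (F k)) -> dom (A * \sum_(k < N) w k + e) (fun z => \sum_(k < N) w k * F k z).
Proof.
move=> A0 + w0; elim: N e => [|N IH] e e0 HF.
  rewrite big_ord0 mulr0 add0r.
  by under eq_fun do rewrite big_ord0; exact: dom_zero.
rewrite (_ : (fun z => _) = fun z => \sum_(k < N) w k * F k z + w N * F N z); last first.
  by apply/funext => z; rewrite big_ord_recr.
rewrite big_ord_recr /=.
have -> : A * (\sum_(k < N) w k + w N) + e = (A * \sum_(k < N) w k + e / 2) + (w N * A + e / 2) by field.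
have e20 : 0 < e / 2 by rewrite divr_gt0.
apply: dom_add; first by apply: IH => // k kN; apply: HF; exact: leqW.
have dN := HF N (ltnSn N); have [mF F0 _ _] := dN.
apply: (dom_le dN (c := w N)) => //.
- exact: measurable_funM.
- by move=> z; rewrite mulr_ge0.
- by rewrite lerDl ltW.
- by apply: ltr_wpDl => //; rewrite mulr_ge0 // ltW.
Qed.

Lemma dom_rot (i j : 'I_n) (th A : R) (F : 'rV[R]_n -> R) : i != j -> dom A F -> dom A (fun z => F (rot i j th z)).
Proof.
move=> ij [mF F0 A0 HF]; split; [|by move=> z; exact: F0|exact: A0|].
  apply: (measurableT_comp mF); exact: measurable_rot.
move=> q q1; apply: le_trans (HF q q1).
have rK : cancel (rot i j (- th)) (rot i j th) by move=> z; have := rotK ij (- th) z; rewrite opprK.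
rewrite /moment -(ge0_lam_isometry (rotD ij th) (rotK ij th) rK (enorm_rot ij th) (measurable_rot ij th)
   (measurable_moment q mF) (moment_integrand_ge0 q F)).
rewrite le_eqVlt; apply/orP; left; apply/eqP; apply: eq_integral => z _; congr (_ * _)%:E.
have [zr|zr] := ltP (enorm z) r; first by rewrite !chi_in // enorm_rot.
by rewrite !chi_out // enorm_rot.
Qed.

(** The dilation maps the ball into itself, and its Jacobian costs [l^(-n) <= 2^n]. *)
Lemma moment_dil (q l : R) (F : 'rV[R]_n -> R) : 2^-1 <= l <= 1 -> measurable_fun setT F ->
  (moment q (fun z => F (l *: z)) <= (2 ^+ n)%:E * moment q F)%E.
Proof.
move=> /andP[l2 l1] mF; have l0 : 0 < l by apply: lt_le_trans l2; rewrite invr_gt0.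
rewrite /moment -(ge0_lam_affine (PosNum l0) 0 (measurable_moment q mF) (moment_integrand_ge0 q F)) /= muleA -EFinM.
set X := (X in (_ <= _ * X)%E).
have mX : measurable_fun setT (fun x : 'rV[R]_n => (F (l *: x + 0) `^ q * chi (l *: x + 0))%:E).
  exact: (measurableT_comp (measurable_moment q mF) (measurable_rV_affine l 0)).
apply: (@le_trans _ _ X).
  apply: ge0_le_integral => //.
  - by move=> z _; exact: (moment_integrand_ge0 q (fun z => F (l *: z))).
  - apply: (measurable_moment q (F := fun z => F (l *: z))); apply: (measurableT_comp mF).
    by apply: measurable_rV_scale; [exact: measurable_cst|exact: measurable_id].
  - move=> z _; rewrite addr0 lee_fin; apply: ler_wpM2l; first exact: powR_ge0.
    have [zr|zr] := ltP (enorm z) r; last by rewrite (chi_out zr).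
    rewrite !chi_in // enormZ (gtr0_norm l0); apply: le_lt_trans zr.
    by rewrite -[leRHS]mul1r; apply: ler_wpM2r => //; exact: enorm_ge0.
rewrite -[leLHS]mul1e; apply: lee_wpmul2r.
  by apply: integral_ge0 => z _; exact: (moment_integrand_ge0 q F).
by rewrite lee_fin -exprMn exprn_ege1 // -ler_pdivrMl // mulr1.
Qed.

Lemma dom_dil (l A : R) (F : 'rV[R]_n -> R) : 2^-1 <= l <= 1 -> dom A F -> dom (2 ^+ n * A) (fun z => F (l *: z)).
Proof.
move=> l12 [mF F0 A0 HF]; have c1 : 1 <= 2 ^+ n :> R by rewrite exprn_ege1 // ler1n.
have c0 : 0 < 2 ^+ n :> R by exact: lt_le_trans c1.
split => //; last first.
  move=> q q1; apply: (le_trans (moment_dil q l12 mF)).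
  rewrite (@powRM _ (2 ^+ n) A q (ltW c0) (ltW A0)) EFinM -muleA; apply: lee_pmul; rewrite ?lee_fin ?(ltW c0) ?moment_ge0 //; last exact: HF.
  by rewrite -{1}[2 ^+ n]powRr1 ?(ltW c0) //; exact: ler_powR.
- by rewrite mulr_gt0.
- apply: (measurableT_comp mF); apply: measurable_rV_scale; [exact: measurable_cst|exact: measurable_id].
Qed.

Lemma integral_chi_f0 : (\int[lam n]_(z in eball (0 : 'rV[R]_n) r) (f0 z)%:E)%E = (I n (fun z => f0 z * chi z))%:E.
Proof.
have nfc : nice (fun z => f0 z * chi z).
  have [mf [M [s [M0 s0 fM fs]]]] := nf0; split.
    by apply: measurable_funM => //; apply: measurable_indic; exact: measurable_eball.
  exists M, s; split => // z; last by move=> /fs ->; rewrite mul0r.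
  have [zr|zr] := ltP (enorm z) r; first by rewrite chi_in // mulr1.
  by rewrite chi_out // mulr0 normr0.
rewrite -nice_EFin // integral_mkcond; apply: eq_integral => z _; rewrite patchE indicE.
by case: (z \in _); rewrite ?mulr1 ?mulr0.
Qed.

(** Jensen's inequality for the mean of [f0] over the ball; [vball n] appears because the mean is
    normalised by [r^n] instead of the volume. *)
Lemma dom_cst : dom (vball n) (fun=> r ^- n * I n (fun z => f0 z * chi z)).
Proof.
set S := I n _; have v0 := @vball_gt0 R n; have rn0 : 0 < r ^+ n by exact: exprn_gt0.
have S0 : 0 <= S.
  by rewrite -lee_fin -integral_chi_f0; apply: integral_ge0 => z _; rewrite lee_fin.
split => //; first by move=> _; rewrite mulr_ge0 // invr_ge0 ltW.
move=> q q1; have q0 : 0 <= q by exact: le_trans q1.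
have w0 : 0 < r ^+ n * vball n by exact: mulr_gt0.
have mB : measurable (eball (0 : 'rV[R]_n) r) by exact: measurable_eball.
have := jensen_powR mB (lam_eball 0 r0) w0 (measurable_funTS nf0.1) (fun z _ => f00 z) integral_chi_f0 q1.
rewrite -/S => J.
have -> : moment q (fun=> r ^- n * S) = ((vball n `^ q)%:E * ((S / (r ^+ n * vball n)) `^ q * (r ^+ n * vball n))%:E)%E.
  have sw0 : 0 <= S / (r ^+ n * vball n) by rewrite divr_ge0 // ltW.
  set X := S / _ in sw0 *; set W := r ^+ n * _.
  have E : vball n `^ q * (X `^ q * W) = (vball n * X) `^ q * W by rewrite mulrA (@powRM _ (vball n) X q (ltW v0) sw0).
  rewrite -EFinM E /moment /X /W.
  have -> : vball n * (S / (r ^+ n * vball n)) = r ^- n * S by field; rewrite !gt_eqF.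
  rewrite (_ : (fun z => _) = fun z => (((r ^- n * S) `^ q)%:E * (chi z)%:E)%E); last by apply/funext => z; rewrite EFinM.
  rewrite lamZl; last 3 first.
  - by apply/measurable_EFinP; apply: measurable_indic.
  - by move=> z; rewrite lee_fin; exact: chi_ge0.
  - by rewrite lee_fin powR_ge0.
  by rewrite integral_indic // setIT EFinM; congr mule; exact: lam_eball.
apply: lee_wpmul2l; first by rewrite lee_fin powR_ge0.
apply: (le_trans J); rewrite integral_mkcond; apply: ge0_le_integral => //.
- by move=> z _; rewrite patchE; case: ifP => // _; rewrite lee_fin powR_ge0.
- apply/(measurable_restrictT _ mB); apply/measurable_EFinP; apply: measurable_funTS.
  exact: (measurableT_comp (measurable_powR q) nf0.1).
- exact: measurable_moment nf0.1.
- by move=> z _; rewrite patchE indicE; case: (z \in _); rewrite ?mulr1 // lee_fin mulr0.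
Qed.

Section average.
Variables (a b : R) (F : 'rV[R]_n -> R).
Hypothesis a2 : 2^-1 <= a.
Hypothesis ab : a < b.
Hypothesis b1 : b <= 1.
Hypothesis nF : nice F.
Hypothesis F0 : forall z, 0 <= F z.

(** Not divided by the length of the interval, so that the gain of a short interval shows up as the
    factor [b - a] in [dom_ray_average]. *)
Definition ray_average (z : 'rV[R]_n) : R := fine (\int[mu]_(l in [set` `]a, b[%R]) (F (l *: z))%:E).

Let J : set R := [set` `]a, b[%R].
Let mJ : measurable J. Proof. exact: measurable_itv. Qed.

Let muJ : mu J = (b - a)%:E.
Proof. by rewrite /J lebesgue_measure_itv /= lte_fin ab EFinB. Qed.

Let int_cst c : (\int[mu]_(l in J) (cst c) l = c * (b - a)%:E)%E.
Proof. by rewrite integral_cst //; congr mule; exact: muJ. Qed.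

Let mscale (z : 'rV[R]_n) : measurable_fun setT (fun l : R => F (l *: z)).
Proof.
apply: (measurableT_comp nF.1).
by apply: (measurable_rV_scale (a := fun t : R => t) (f := fun=> z)); [exact: measurable_id|exact: measurable_cst].
Qed.

Lemma ray_averageE z : (\int[mu]_(l in [set` `]a, b[%R]) (F (l *: z))%:E = (ray_average z)%:E)%E.
Proof.
rewrite /ray_average fineK // ge0_fin_numE; last by apply: integral_ge0 => l _; rewrite lee_fin.
have [_ [M [s [M0 _ FM _]]]] := nF.
apply: (@le_lt_trans _ _ (\int[mu]_(l in J) (cst M%:E) l)%E).
  apply: ge0_le_integral => //.
  - by move=> l _; rewrite lee_fin.
  - by apply: measurable_funTS; apply/measurable_EFinP; exact: mscale.
  - by move=> l _; rewrite lee_fin; apply: le_trans (ler_norm _) (FM _).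
by rewrite int_cst -EFinM ltry.
Qed.

Lemma ray_average_ge0 z : 0 <= ray_average z.
Proof. by rewrite -lee_fin -ray_averageE; apply: integral_ge0 => l _; rewrite lee_fin. Qed.

Let mJi : measurable_fun setT (fun l : R => (\1_J l : R)).
Proof. exact: measurable_indic. Qed.

Lemma measurable_ray_average : measurable_fun setT ray_average.
Proof.
pose K (zl : 'rV[R]_n * R) : \bar R := (\1_J zl.2 * F (zl.2 *: zl.1))%:E.
have mK : measurable_fun setT K.
  apply/measurable_EFinP; apply: measurable_funM; first exact: (measurableT_comp mJi measurable_snd).
  apply: (measurableT_comp nF.1); apply: measurable_rV_scale; [exact: measurable_snd|exact: measurable_fst].
have K0 zl : (0 <= K zl)%E by rewrite lee_fin mulr_ge0.
have mint := measurable_fun_fubini_tonelli_F (m2 := mu) K mK K0.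
apply/measurable_EFinP; apply: (eq_measurable_fun _ _ mint) => z _.
rewrite /= -ray_averageE [RHS]integral_mkcond; apply: eq_integral => l _.
by rewrite /K /= patchE indicE; case: (l \in _); rewrite ?mul1r ?mul0r.
Qed.

(** Jensen in [l] at fixed [z], exchange of the integrals, and [moment_dil] at each fixed [l]. *)
Lemma dom_ray_average A : dom A F -> dom (2 ^+ n * (b - a) * A) ray_average.
Proof.
move=> [mF _ A0 HF]; pose w := b - a; have w0 : 0 < w by rewrite subr_gt0.
have c0 : 0 < 2 ^+ n :> R by exact: exprn_gt0.
split; [exact: measurable_ray_average|exact: ray_average_ge0|by rewrite mulr_gt0 // mulr_gt0|].
move=> q q1; have q0 : 0 <= q by exact: le_trans q1.
have wq : 0 <= w `^ q / w by rewrite divr_ge0 ?powR_ge0 // ltW.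
pose K (lz : R * 'rV[R]_n) : \bar R := (\1_J lz.1 * (F (lz.1 *: lz.2) `^ q * chi lz.2))%:E.
have mK : measurable_fun setT K.
  apply/measurable_EFinP; apply: measurable_funM; first exact: (measurableT_comp mJi measurable_fst).
  apply: measurable_funM.
    apply: (measurableT_comp (measurable_powR q)); apply: (measurableT_comp mF).
    by apply: measurable_rV_scale; [exact: measurable_fst|exact: measurable_snd].
  apply: (measurableT_comp (f := fun z : 'rV[R]_n => chi z) _ measurable_snd).
  by apply: measurable_indic; exact: measurable_eball.
have K0 lz : (0 <= K lz)%E by rewrite lee_fin; apply: mulr_ge0 => //; apply: mulr_ge0; [exact: powR_ge0|exact: chi_ge0].
have step1 : (moment q ray_average <= (w `^ q / w)%:E * \int[lam n]_z \int[mu]_l K (l, z))%E.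
  have mint := measurable_fun_fubini_tonelli_G (m1 := mu) K mK K0.
  have int0 z : (0 <= \int[mu]_l K (l, z))%E by apply: integral_ge0 => l _; exact: K0.
  have wqE : (0 <= (w `^ q / w)%:E)%E by rewrite lee_fin.
  rewrite -(lamZl mint int0 wqE); apply: ge0_le_integral => //.
  - by move=> z _; exact: moment_integrand_ge0.
  - exact: measurable_moment measurable_ray_average.
  - by apply: emeasurable_funM; [exact: measurable_cst|exact: mint].
  - move=> z _; have [zr|zr] := ltP (enorm z) r; last first.
      by rewrite (chi_out zr) mulr0; apply: mule_ge0; [exact: wqE|exact: int0].
    have J1 := @jensen_powR R _ _ mu J w _ q _ mJ muJ w0 (measurable_funTS (mscale z)) (fun l _ => F0 _) (ray_averageE z) q1.
    rewrite chi_in // mulr1.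
    have -> : ray_average z `^ q = w `^ q / w * ((ray_average z / w) `^ q * w).
      rewrite [X in _ * X]mulrC mulrA divfK ?gt_eqF // -(@powRM _ w (ray_average z / w) q (ltW w0)); last by rewrite divr_ge0 ?ray_average_ge0 // ltW.
      by congr (_ `^ q); rewrite mulrCA divff ?mulr1 // gt_eqF.
    rewrite EFinM; apply: lee_wpmul2l => //; apply: (le_trans J1).
    rewrite integral_mkcond le_eqVlt; apply/orP; left; apply/eqP; apply: eq_integral => l _.
    by rewrite patchE /K /= indicE (chi_in zr) mulr1; case: (l \in _); rewrite ?mul1r ?mul0r.
have step2 : (\int[lam n]_z \int[mu]_l K (l, z) <= w%:E * ((2 ^+ n)%:E * moment q F))%E.
  rewrite -(@fubini_tonelli _ _ _ _ _ mu (lam n) K mK K0).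
  apply: (@le_trans _ _ (\int[mu]_(l in J) (cst ((2 ^+ n)%:E * moment q F)%E) l)%E).
    rewrite [leRHS]integral_mkcond; apply: ge0_le_integral => //.
    - by move=> l _; apply: integral_ge0 => z _; exact: K0.
    - exact: (measurable_fun_fubini_tonelli_F (m2 := lam n) K mK K0).
    - by apply/(measurable_restrictT _ mJ); exact: measurable_cst.
    - move=> l _; rewrite patchE; case: ifPn => [|/negbTE lJ]; last first.
        rewrite (eq_integral (cst 0%E)) ?integral0 // => z _.
        by rewrite /K /= indicE lJ mul0r.
      move=> lJ; have /andP[al lb] : a < l < b by move: lJ; rewrite inE /J /= in_itv.
      have l12 : 2^-1 <= l <= 1 by rewrite (le_trans a2 (ltW al)) (le_trans (ltW lb) b1).
      apply: le_trans (moment_dil q l12 mF).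
      by rewrite /moment le_eqVlt; apply/orP; left; apply/eqP; apply: eq_integral => z _; rewrite /K /= indicE lJ mul1r.
  by rewrite int_cst muleC.
apply: (le_trans step1); apply: (@le_trans _ _ ((w `^ q / w)%:E * (w%:E * ((2 ^+ n)%:E * ((A `^ q)%:E * moment q f0))))%E).
  apply: lee_wpmul2l; first by rewrite lee_fin.
  apply: (le_trans step2); apply: lee_wpmul2l; first by rewrite lee_fin ltW.
  by apply: lee_wpmul2l; [rewrite lee_fin ltW|exact: HF].
rewrite !muleA -!EFinM divfK ?gt_eqF //; apply: lee_wpmul2r; first exact: moment_ge0.
rewrite lee_fin (@powRM _ (2 ^+ n * w) A q _ (ltW A0)); last by rewrite mulr_ge0 // ltW.
rewrite (@powRM _ (2 ^+ n) w q (ltW c0) (ltW w0)).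
apply: ler_wpM2r; first exact: powR_ge0.
rewrite mulrC; apply: ler_wpM2r; first exact: powR_ge0.
rewrite -{1}[2 ^+ n]powRr1 ?(ltW c0) //; apply: ler_powR => //.
by rewrite exprn_ege1 // ler1n.
Qed.

End average.

End domination.

(** * The error term *)

Section interior.
Context {R : realType}.

Lemma pospart_lipschitz (a b : R) : 0 <= a -> 0 <= b ->
  `|Num.max (1 - a ^+ 2) 0 - Num.max (1 - b ^+ 2) 0| <= 2 * `|a - b|.
Proof.
have H (x y : R) : 0 <= x -> x <= y -> `|Num.max (1 - x ^+ 2) 0 - Num.max (1 - y ^+ 2) 0| <= 2 * (y - x).
  move=> x0 xy; rewrite !expr2.
  have [x1|x1] := leP x 1; last first.
    rewrite !max_r ?subrr ?normr0 ?mulr_ge0 ?subr_ge0 //; nra.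
  rewrite max_l; last by nra.
  have [y1|y1] := leP y 1.
    by rewrite max_l ?ger0_norm; nra.
  by rewrite max_r ?subr0 ?ger0_norm; nra.
move=> a0 b0; have [ab|/ltW ba] := leP a b.
  by rewrite (distrC a) (ger0_norm (_ : 0 <= b - a)) ?subr_ge0 //; exact: H.
by rewrite distrC (ger0_norm (_ : 0 <= a - b)) ?subr_ge0 //; exact: H.
Qed.

Lemma enorm_lipschitz n (x y : 'rV[R]_n) : `|enorm x - enorm y| <= enorm (x - y).
Proof.
rewrite ler_norml; apply/andP; split.
  have := enormD (y - x) x; rewrite subrK -(enormN (y - x)) opprB; lra.
have := enormD (x - y) y; rewrite subrK; lra.
Qed.

Lemma is_derive_norm_le (u : R -> R) (u' t K del : R) : is_derive t (1 : R) u u' -> 0 < del ->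
  (forall s, `|s| < del -> `|u (s + t) - u t| <= K * `|s|) -> `|u'| <= K.
Proof.
move=> [du <-] del0 H.
have cl : closed [set y : R | `|y| <= K].
  rewrite (_ : [set y | _] = (fun y : R => `|y|) @^-1` [set z | z <= K]) //.
  by apply: closed_comp; [move=> y _; exact: norm_continuous|exact: closed_le].
have N : \forall s \near (0 : R)^', `|s^-1 *: ((u \o shift t) (s *: (1 : R)) - u t)| <= K.
  near=> s.
  have s0 : s != 0 by near: s; exact: nbhs_dnbhs_neq.
  have sd : `|s| < del by near: s; exact: dnbhs0_lt.
  rewrite /= /GRing.scale /= mulr1 normrM normfV mulrC ler_pdivrMr ?normr_gt0 //.
  exact: H.
exact: (closed_cvg _ cl N _ du).
Unshelve. all: end_near. Qed.

Context (n : nat) (Rad : R) (h : 'rV[R]_n -> R) (r : R).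
Hypothesis hH : harmonic_on (eball 0 Rad) h.
Hypothesis r0 : 0 < r.
Hypothesis rR : r < Rad / 2.
Notation I n f := (Rintegral (lam n) setT f).

Definition average : R := r ^- n * mass h r.

(** The inverse of the lower bound for the mass of the kernel of exponent one and radius [r/2], in
    units of [r^n]. *)
Definition Cint : R := 4 ^+ n * (4 / 3) / vball n.

Lemma Cint_gt0 : 0 < Cint.
Proof. by rewrite divr_gt0 ?vball_gt0 // mulr_gt0 ?exprn_gt0 // divr_gt0. Qed.

Lemma average_ge0 : 0 <= average.
Proof. by rewrite mulr_ge0 ?mass_ge0 // invr_ge0 exprn_ge0 // ltW. Qed.

Let rRad : r < Rad. Proof. by have := r0; have := rR; lra. Qed.

Let r2 : 0 < r / 2. Proof. by rewrite divr_gt0. Qed.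

Lemma kernel_mass_ge k : r ^+ n * (4 ^- n * (3 / 4) ^+ k.+1 * vball n) <= (r / 2) ^+ n * I n (@ebump R n k).
Proof.
have -> : r ^+ n * (4 ^- n * (3 / 4) ^+ k.+1 * vball n) = (r / 2) ^+ n * ((3 / 4) ^+ k.+1 * (2^-1 ^+ n * vball n)).
  have -> : (4 : R) ^- n = 2^-1 ^+ n * 2^-1 ^+ n.
    by rewrite -exprMn -exprVn; congr (_ ^+ _); field.
  rewrite (exprMn _ r); move: (r ^+ n) (2^-1 ^+ n) (_ ^+ k.+1) (vball n) => u v w x; ring.
by rewrite ler_wpM2l ?exprn_ge0 ?(ltW r2) //; exact: ebump_mass.
Qed.

Let cK := (r / 2) ^+ n * I n (@ebump R n 0).

Let cK0 : 0 < cK. Proof. by rewrite mulr_gt0 ?exprn_gt0 // ebump_mass_gt0. Qed.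

Let mass_div : mass h r / cK <= Cint * average.
Proof.
have := kernel_mass_ge 0; rewrite -/cK expr1 => H.
have rn : 0 < r ^+ n by exact: exprn_gt0.
have v0 := @vball_gt0 R n; have f0 : 0 < 4 ^+ n :> R by rewrite exprn_gt0.
rewrite ler_pdivrMr //.
apply: (@le_trans _ _ (Cint * average * (r ^+ n * (4 ^- n * (3 / 4) * vball n)))).
  rewrite /Cint /average le_eqVlt; apply/orP; left; apply/eqP.
  by field; rewrite !gt_eqF.
by apply: ler_wpM2l H; rewrite mulr_ge0 ?average_ge0 // ltW ?Cint_gt0.
Qed.

Let ker (x z : 'rV[R]_n) := ebump 0 ((r / 2)^-1 *: (z - x)) : R.

Let mker (x : 'rV[R]_n) : measurable_fun setT (ker x).
Proof.
apply: (measurableT_comp (nice_ebump n 0).1).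
apply: measurable_rV_scale; first exact: measurable_cst.
apply: measurable_rVP => k; under eq_fun do rewrite !mxE.
by apply: measurable_funB => //; exact: measurable_coord.
Qed.

Let rep x : enorm x < r / 2 -> cK * h x = I n (fun z => ker x z * cutoff h r z).
Proof. by move=> xr; apply: (kernel_rep hH) => //; lra. Qed.

Lemma interior_value x : enorm x < r / 2 -> `|h x| <= Cint * average.
Proof.
move=> xr; apply: le_trans mass_div; rewrite ler_pdivlMr // -[X in _ * X](gtr0_norm cK0) -normrM mulrC rep //.
rewrite -[leRHS]mul1r; apply: (I_mul_cutoff_le hH r0 rRad (mker x)) => z _.
by rewrite ger0_norm ?ebump_ge0 // ebump_le1.
Qed.

(** The bump of exponent one has a corner but is Lipschitz, so the representation is differenced and
    not differentiated; difference quotients then bound the gradient. *)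
Lemma interior_lipschitz x y : enorm x < r / 2 -> enorm y < r / 2 ->
  `|h x - h y| <= 4 / r * (Cint * average) * enorm (x - y).
Proof.
move=> xr yr.
pose D := 2 * ((r / 2)^-1 * enorm (x - y)).
have nk (w : 'rV[R]_n) : nice (fun z => ker w z * cutoff h r z).
  by apply: (nice_mul_cutoff hH r0 rRad (mker w) (D := 1)) => z _; rewrite ger0_norm ?ebump_ge0 // ebump_le1.
have : `|cK * (h x - h y)| <= D * mass h r.
  rewrite mulrBr !rep //.
  have -> : I n (fun z => ker x z * cutoff h r z) - I n (fun z => ker y z * cutoff h r z) =
      I n (fun z => (ker x z - ker y z) * cutoff h r z).
    rewrite -mulN1r -I_Z // -I_D //; last exact: niceZ.
    by apply: eq_Rintegral => z _; ring.
  apply: (I_mul_cutoff_le hH r0 rRad); first by apply: measurable_funB; exact: mker.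
  move=> z _; rewrite /ker /ebump !expr1; apply: le_trans (pospart_lipschitz (enorm_ge0 _) (enorm_ge0 _)) _.
  rewrite ler_wpM2l //; apply: le_trans (enorm_lipschitz _ _) _.
  rewrite -scalerBr enormZ gtr0_norm ?invr_gt0 //.
  have -> : z - x - (z - y) = - (x - y) by apply/rowP => k; rewrite !mxE; ring.
  by rewrite enormN.
rewrite normrM (gtr0_norm cK0) mulrC -ler_pdivlMr // => H; apply: le_trans H _.
rewrite -[leLHS]mulrA; apply: (@le_trans _ _ (D * (Cint * average))).
  by apply: ler_wpM2l mass_div; rewrite /D !mulr_ge0 ?enorm_ge0 // invr_ge0 ltW.
by rewrite /D le_eqVlt; apply/orP; left; apply/eqP; field; rewrite gt_eqF.
Qed.

Lemma interior_gradient x i : enorm x < r / 2 -> `|pd i h x| <= 4 / r * (Cint * average).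
Proof.
move=> xr.
have ei : enorm (evec R i : 'rV[R]_n) = 1.
  rewrite /enorm (bigD1 i) //= mxE eqxx expr1n big1 ?addr0 ?sqrtr1 // => k ki.
  by rewrite mxE eq_sym (negbTE ki) expr0n.
have D : is_derive (0 : R) (1 : R) (fun t : R => h (x + t *: evec R i)) (pd i h x).
  have := @is_derive_curve R n h (fun t : R => x + t *: evec R i) (evec R i) 0.
  rewrite scale0r addr0.
  have -> : \sum_k (evec R i : 'rV[R]_n) ord0 k * pd k h x = pd i h x.
    rewrite (bigD1 i) //= mxE eqxx mul1r big1 ?addr0 // => k ki.
    by rewrite mxE eq_sym (negbTE ki) mul0r.
  apply; last first.
    by have := hH (x := x); rewrite eball0E => /(_ _)[]//; have := rRad; have := r2; lra.
  move=> k; rewrite (_ : (fun s : R => _) = fun s : R => x ord0 k + (evec R i : 'rV[R]_n) ord0 k * s ^+ 1); last first.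
    by apply/funext => s; rewrite !mxE expr1 mulrC.
  have := is_derive_monomial ((evec R i : 'rV[R]_n) ord0 k) 0 0; rewrite expr0 !mulr1 => Dm.
  by apply: (is_derive_eq (is_deriveD (is_derive_cst (x ord0 k) _ _) Dm)); rewrite add0r.
have d0 : 0 < r / 2 - enorm x by lra.
apply: (is_derive_norm_le D d0) => s sd; rewrite addr0 scale0r addr0.
apply: le_trans (interior_lipschitz _ xr) _.
  by apply: le_lt_trans (enormD _ _) _; rewrite enormZ ei mulr1; lra.
by rewrite addrC addKr enormZ ei mulr1.
Qed.

End interior.

(** * Choice of the step against growth and kernel mass *)

Section error.
Context {R : realType} (n : nat) (Rad : R) (h : 'rV[R]_n -> R) (r : R) (m : nat).
Hypothesis n0 : (0 < n)%N.
Hypothesis hH : harmonic_on (eball 0 Rad) h.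
Hypothesis r0 : 0 < r.
Hypothesis rR : r < Rad / 2.
Hypothesis m0 : (0 < m)%N.
Hypothesis hfreq : forall t, 0 < t < Rad -> frequency h 0 t <= m%:R.
Notation I n f := (Rintegral (lam n) setT f).
Notation m1 := (average h r).
Notation C1 := (@Cint R n).

Lemma vol_interior : vol h (r / 2) <= (C1 * m1) ^+ 2 * ((r / 2) ^+ n * vball n).
Proof.
have r2 : 0 < r / 2 by rewrite divr_gt0.
have r2R : r / 2 < Rad by have := rR; have := r0; lra.
have nB : nice (fun y : 'rV[R]_n => \1_(eball (0 : 'rV[R]_n) (r / 2)) y : R).
  split; first by apply: measurable_indic; exact: measurable_eball.
  exists 1, (r / 2); split => // y; first by rewrite indicE; case: (_ \in _); rewrite ?normr1 ?normr0.
  by move=> y2; rewrite indicE memNset // eball0E; apply/negP; rewrite -leNgt.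
have IB : I n (fun y : 'rV[R]_n => \1_(eball (0 : 'rV[R]_n) (r / 2)) y) = (r / 2) ^+ n * vball n.
  rewrite /Rintegral integral_indic //; last exact: measurable_eball.
  by have := @lam_eball R n 0 (r / 2) r2; rewrite setIT => E; rewrite [X in fine X]E.
rewrite -IB -I_Z //; apply: I_le; [exact: (nice_sqr_cutoff hH r2 r2R)|exact: niceZ|].
move=> z; have [zr|zr] := ltP (enorm z) (r / 2); last first.
  by rewrite cutoff_out // expr0n /= mulr_ge0 ?sqr_ge0.
rewrite cutoff_in // indicE mem_set ?eball0E // [X in _ * X](_ : _ = 1) // mulr1.
rewrite -(real_normK (num_real (h z))); apply: lerXn2r; rewrite ?nnegrE //.
  by rewrite mulr_ge0 ?(average_ge0 _ r0) // ltW // (@Cint_gt0 R n).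
exact: (interior_value hH r0 rR zr).
Qed.

(** Doubling is available for [h^2], while means of [|h|] are to be compared. Outwards,
    Cauchy-Schwarz suffices; the reverse passage is made in [B(0,r/2)], where [h] is bounded
    pointwise by its mean over [B(0,r)]. So the growth is used from [r/2] to [3r/2]. *)
Lemma mass_growth : mass h (3 * (r / 2)) <= 2 ^+ (4 * (n + 4 * m)) * (C1 * m1 * (vball n * r ^+ n)).
Proof.
have r2 : 0 < r / 2 by rewrite divr_gt0.
have r3 : 0 < 3 * (r / 2) by rewrite mulr_gt0.
have r3R : 3 * (r / 2) < Rad by have := rR; have := r0; lra.
have v0 := @vball_gt0 R n; have rn : 0 < r ^+ n by exact: exprn_gt0.
have B0 : 0 <= C1 * m1 by rewrite mulr_ge0 ?(average_ge0 _ r0) // ltW // (@Cint_gt0 R n).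
rewrite -(ler_pXn2r (ltn0Sn 1)) ?nnegrE ?mass_ge0 //; last first.
  exact: (mulr_ge0 (exprn_ge0 _ (ler0n R 2)) (mulr_ge0 B0 (ltW (mulr_gt0 v0 rn)))).
apply: le_trans (sqr_mass_le hH r3 r3R) _.
have H1 := vol_growth n0 hH m0 hfreq r2 r3R.
have H2 := vol_interior.
have w0 : 0 <= (3 * (r / 2)) ^+ n * vball n by exact: (ltW (mulr_gt0 (exprn_gt0 n r3) v0)).
apply: (@le_trans _ _ (2 ^+ (8 * (n + 4 * m)) * ((C1 * m1) ^+ 2 * ((r / 2) ^+ n * vball n)) * ((3 * (r / 2)) ^+ n * vball n))).
  apply: ler_wpM2r => //; apply: le_trans H1 _; exact: ler_wpM2l.
have E : (2 ^+ (4 * (n + 4 * m)) * (C1 * m1 * (vball n * r ^+ n))) ^+ 2 =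
    2 ^+ (8 * (n + 4 * m)) * (C1 * m1) ^+ 2 * vball n ^+ 2 * (r ^+ 2) ^+ n.
  have -> : (2 : R) ^+ (8 * (n + 4 * m)) = (2 ^+ (4 * (n + 4 * m))) ^+ 2 by rewrite -exprM mulnAC.
  have -> : (r ^+ 2) ^+ n = (r ^+ n) ^+ 2 by rewrite -!exprM mulnC.
  move: (2 ^+ _) (C1 * m1) (vball n) (r ^+ n) => a b c d; ring.
have -> : 2 ^+ (8 * (n + 4 * m)) * ((C1 * m1) ^+ 2 * ((r / 2) ^+ n * vball n)) * ((3 * (r / 2)) ^+ n * vball n) =
    2 ^+ (8 * (n + 4 * m)) * (C1 * m1) ^+ 2 * vball n ^+ 2 * ((r / 2) * (3 * (r / 2))) ^+ n.
  rewrite (exprMn _ (r / 2) (3 * (r / 2))) (expr2 (vball n)).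
  move: ((r / 2) ^+ n) ((3 * (r / 2)) ^+ n) (2 ^+ _) (_ ^+ 2) (vball n) => a b c d e; ring.
rewrite E; apply: ler_wpM2l.
  exact: (mulr_ge0 (mulr_ge0 (exprn_ge0 _ (ler0n R 2)) (sqr_ge0 _)) (sqr_ge0 _)).
apply: lerXn2r; rewrite ?nnegrE; [exact: ltW (mulr_gt0 r2 r3)|exact: sqr_ge0|].
have := sqr_ge0 r; rewrite expr2; lra.
Qed.

(** [8 * 100 * expR 1] is the base of the error in [trig_numdiff] for [Q = 100]. The factor
    [2 ^+ 8], raised to the power [2m], is the growth [2^(16 m)] in [mass_growth], and the extra 2
    leaves [2^(-2m)], below the [(3/4)^(2m)] of the kernel mass. *)
Definition step0 : R := (8 * 100 * expR 1 * (2 * 2 ^+ 8))^-1.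

Lemma step0_gt0 : 0 < step0.
Proof.
rewrite invr_gt0; apply: mulr_gt0; last by rewrite mulr_gt0 // exprn_gt0.
by apply: mulr_gt0; rewrite ?expR_gt0 // mulr_gt0.
Qed.

(** [(4/3)^2] pays for the two exponents of the kernel beyond [2m], [2 ^+ (4 * n)] for the part of
    the growth that does not depend on [m], and [4 ^+ n] for the kernel mass. *)
Definition Cerr : R := 3 * 100 ^+ 2 / step0 * (4 / 3) ^+ 2 * 2 ^+ (4 * n) * 4 ^+ n * C1.

Lemma Cerr_gt0 : 0 < Cerr.
Proof.
rewrite /Cerr; apply: mulr_gt0; last exact: Cint_gt0.
apply: mulr_gt0; last by rewrite exprn_gt0.
apply: mulr_gt0; last by rewrite exprn_gt0.
apply: mulr_gt0; last by rewrite exprn_gt0 // divr_gt0.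
by apply: divr_gt0; [rewrite mulr_gt0 // exprn_gt0|exact: step0_gt0].
Qed.

(* [step0] is small enough for the accuracy of the difference scheme to beat both the growth of [h]
   up to radius [3r/2] and the smallness of the kernel mass. *)
Lemma error_le :
  3 * 100 ^+ 2 * (m%:R / step0) * (8 * step0 * 100 * expR 1) ^+ m.*2 * mass h (3 * (r / 2))
    / ((r / 2) ^+ n * I n (@ebump R n m.*2.+1)) <= Cerr * m%:R * m1.
Proof.
have r2 : 0 < r / 2 by rewrite divr_gt0.
have v0 := @vball_gt0 R n; have rn : 0 < r ^+ n by exact: exprn_gt0.
have s0 := step0_gt0; have C10 := @Cint_gt0 R n; have m10 := average_ge0 h r0.
have cK0 : 0 < (r / 2) ^+ n * I n (@ebump R n m.*2.+1) by rewrite mulr_gt0 ?exprn_gt0 // ebump_mass_gt0.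
rewrite ler_pdivrMr //.
set q := 8 * step0 * 100 * expR 1.
have b0 : 0 < (2 : R) ^+ 8 by rewrite exprn_gt0.
have qE : q = (2 * 2 ^+ 8)^-1.
  rewrite /q /step0; have := expR_gt0 (1 : R); move: b0; move: (expR 1) (2 ^+ 8 : R) => e t t0 e0.
  by field; rewrite !gt_eqF.
have q0 : 0 <= q by rewrite qE invr_ge0 ltW // mulr_gt0.
have pre0 : 0 <= 3 * 100 ^+ 2 * (m%:R / step0) * q ^+ m.*2 :> R.
  by rewrite !mulr_ge0 ?exprn_ge0 // invr_ge0 ltW.
apply: (le_trans (ler_wpM2l pre0 mass_growth)).
have CM0 : 0 <= Cerr * m%:R * m1 by exact: (mulr_ge0 (mulr_ge0 (ltW Cerr_gt0) (ler0n _ _)) m10).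
apply: le_trans (ler_wpM2l CM0 (@kernel_mass_ge R n r r0 m.*2.+1)).
have -> : 2 ^+ (4 * (n + 4 * m)) = 2 ^+ (4 * n) * (2 ^+ 8) ^+ m.*2 :> R.
  by rewrite -exprM -exprD mulnDr -mul2n !mulnA.
have small : q ^+ m.*2 * (2 ^+ 8) ^+ m.*2 <= (3 / 4) ^+ m.*2.
  have q2 : q * 2 ^+ 8 = 2^-1 by rewrite qE; move: b0; move: (2 ^+ 8 : R) => t t0; field; rewrite gt_eqF.
  by rewrite -exprMn q2; apply: lerXn2r; rewrite ?nnegrE ?invr_ge0 ?divr_ge0 //; lra.
have -> : Cerr * m%:R * m1 * (r ^+ n * (4 ^- n * (3 / 4) ^+ m.*2.+2 * vball n)) =
   3 * 100 ^+ 2 * (m%:R / step0) * 2 ^+ (4 * n) * (C1 * m1 * (vball n * r ^+ n)) * (3 / 4) ^+ m.*2.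
  rewrite /Cerr !exprS; have f0 : (4 : R) ^+ n != 0 by rewrite expf_neq0.
  move: f0; move: (4 ^+ n) (2 ^+ (4 * n)) ((3 / 4) ^+ m.*2) (r ^+ n) (m%:R) => a b c d e f0.
  by field; rewrite f0 gt_eqF.
have -> : 3 * 100 ^+ 2 * (m%:R / step0) * q ^+ m.*2 * (2 ^+ (4 * n) * (2 ^+ 8) ^+ m.*2 * (C1 * m1 * (vball n * r ^+ n))) =
   3 * 100 ^+ 2 * (m%:R / step0) * 2 ^+ (4 * n) * (C1 * m1 * (vball n * r ^+ n)) * (q ^+ m.*2 * (2 ^+ 8) ^+ m.*2).
  move: (q ^+ _) ((2 ^+ 8) ^+ _) (2 ^+ (4 * n)) (m%:R / _) (_ * (vball n * _)) => a b c d e; ring.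
apply: ler_wpM2l small; apply: mulr_ge0; last first.
  by apply: mulr_ge0; [exact: mulr_ge0 (ltW C10) m10|exact: ltW (mulr_gt0 v0 rn)].
apply: mulr_ge0; last by rewrite exprn_ge0.
by apply: mulr_ge0; [rewrite mulr_ge0 // exprn_ge0|rewrite divr_ge0 // ltW].
Qed.

End error.

(** * From moments to the norms, including the essential supremum *)

Section Lp_of_moments.
Context {R : realType} (n : nat) (r : R) (f g : 'rV[R]_n -> R).
Hypothesis r0 : 0 < r.
Notation chi z := (\1_(eball (0 : 'rV[R]_n) r) z : R).
Let f0 (z : 'rV[R]_n) := `|f z| * chi z.
Let g0 (z : 'rV[R]_n) := `|g z| * chi z.
Hypothesis mf0 : measurable_fun setT f0.
Hypothesis mg0 : measurable_fun setT g0.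

Lemma iint_moment q (u : 'rV[R]_n -> R) : measurable_fun setT (fun z => `|u z| * chi z) -> 0 < q ->
  iint (fun y => (chi y * (`|u y| `^ q))%:E) = moment r q (fun z => `|u z| * chi z).
Proof.
move=> mu q0.
have E : (fun y : 'rV[R]_n => (chi y * (`|u y| `^ q))%:E) = (fun y => ((`|u y| * chi y) `^ q * chi y)%:E).
  apply/funext => y; congr EFin; rewrite indicE; case: (_ \in _) => /=; rewrite ?mulr1 ?mul1r //.
  by rewrite mul0r mulr0.
by rewrite E iintE //; exact: measurable_moment.
Qed.

Lemma measurable_superlevel (u : 'rV[R]_n -> R) (M : R) : measurable_fun setT (fun z => `|u z| * chi z) ->
  measurable (eball (0 : 'rV[R]_n) r `&` [set z | M < `|u z|]).
Proof.
move=> mu.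
have -> : eball (0 : 'rV[R]_n) r `&` [set z | M < `|u z|] =
   eball (0 : 'rV[R]_n) r `&` (fun z => `|u z| * chi z) @^-1` `]M, +oo[%classic.
  apply/seteqP; split => z /= [Bz]; rewrite in_itv /= andbT indicE mem_set // mulr1 => H; by split.
apply: measurableI; first exact: measurable_eball.
by rewrite -[X in measurable X]setTI; apply: mu.
Qed.

Lemma superlevel_iint (u : 'rV[R]_n -> R) (M : R) : measurable_fun setT (fun z => `|u z| * chi z) ->
  iint (fun y : 'rV[R]_n => (\1_(eball 0 r `&` [set z | (M%:E < (`|u z|)%:E)%E]) y)%:E) =
  lam n (eball (0 : 'rV[R]_n) r `&` [set z | M < `|u z|]).
Proof.
move=> mu; have mS := measurable_superlevel M mu.
have -> : [set z | (M%:E < (`|u z|)%:E)%E] = [set z | M < `|u z|].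
  by apply/seteqP; split => z /=; rewrite lte_fin.
rewrite iintE; last by move=> y; rewrite lee_fin.
  by rewrite integral_indic // setIT.
by apply/measurable_EFinP; apply: measurable_indic.
Qed.

Variable A : R.
Hypothesis domA : dom r g0 A f0.

(** Chebyshev's inequality for large exponents: the measure of the superlevel set of [f] is at most
    [(A M / K)^q] times the volume of the ball, and the ratio is below one. *)
Lemma dom_superlevel (M K : R) : 0 <= M -> A * M < K ->
  lam n (eball (0 : 'rV[R]_n) r `&` [set z | M < `|g z|]) = 0%E ->
  lam n (eball (0 : 'rV[R]_n) r `&` [set z | K < `|f z|]) = 0%E.
Proof.
move=> M0 MK gM; have [_ _ A0 HA] := domA.
have AM0 : 0 <= A * M by rewrite mulr_ge0 // ltW.
have K0 : 0 < K by exact: le_lt_trans MK.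
set S := eball 0 r `&` _; have mS : measurable S by exact: measurable_superlevel.
set T := eball 0 r `&` [set z | M < `|g z|] in gM.
have mT : measurable T by exact: measurable_superlevel.
have b0 : 0 < r ^+ n * vball n by rewrite mulr_gt0 ?exprn_gt0 // vball_gt0.
have Sfin : (lam n S < +oo)%E.
  apply: (@le_lt_trans _ _ (lam n (eball (0 : 'rV[R]_n) r))); last by rewrite lam_eball // ltry.
  by apply: le_measure; rewrite ?inE //; [exact: measurable_eball|exact: subIsetl].
pose v := fine (lam n S).
have E : lam n S = v%:E by rewrite fineK // ge0_fin_numE.
have v0 : 0 <= v by rewrite fine_ge0.
pose b := r ^+ n * vball n; pose t := A * M / K.
have t0 : 0 <= t by rewrite divr_ge0 // ltW.
have t1 : t < 1 by rewrite ltr_pdivrMr // mul1r.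
have bound k : v <= t ^+ k.+1 * b.
  have q1 : 1 <= k.+1%:R :> R by rewrite ler1n.
  have mg : (moment r k.+1%:R g0 <= (M ^+ k.+1 * b)%:E)%E.
    apply: (@le_trans _ _ (\int[lam n]_z ((M ^+ k.+1)%:E * (chi z)%:E))%E); last first.
      rewrite lamZl; last 3 first.
      - by apply/measurable_EFinP; apply: measurable_indic; exact: measurable_eball.
      - by move=> z; rewrite lee_fin; exact: chi_ge0.
      - by rewrite lee_fin exprn_ge0.
      rewrite integral_indic //; last exact: measurable_eball.
      rewrite setIT EFinM; apply: lee_wpmul2l; first by rewrite lee_fin exprn_ge0.
      by rewrite le_eqVlt; apply/orP; left; apply/eqP; exact: lam_eball.
    apply: ae_ge0_le_integral => //.
    - by move=> z _; exact: (@moment_integrand_ge0 R n r _ g0).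
    - exact: measurable_moment.
    - by move=> z _; apply: mule_ge0; rewrite lee_fin ?exprn_ge0 //; exact: chi_ge0.
    - apply: emeasurable_funM; first exact: measurable_cst.
      by apply/measurable_EFinP; apply: measurable_indic; exact: measurable_eball.
    - exists T; split => // z /= Hz; apply: contrapT => Tz; apply: Hz => _.
      rewrite -EFinM lee_fin; have [zr|zr] := ltP (enorm z) r; last by rewrite (chi_out zr) !mulr0.
      rewrite /g0 (chi_in zr) !mulr1 powR_mulrn //; apply: lerXn2r; rewrite ?nnegrE //.
      by rewrite leNgt; apply/negP => H; apply: Tz; split => //; rewrite /eball /= subr0.
  have mf : ((K ^+ k.+1 * v)%:E <= moment r k.+1%:R f0)%E.
    rewrite EFinM -E.
    have -> : lam n S = (\int[lam n]_z (\1_S z)%:E)%E by rewrite integral_indic // setIT.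
    rewrite -lamZl; last 3 first.
    - by apply/measurable_EFinP; apply: measurable_indic.
    - by move=> z; rewrite lee_fin.
    - by rewrite lee_fin exprn_ge0 // ltW.
    apply: ge0_le_integral => //.
    - by move=> z _; apply: mule_ge0; rewrite lee_fin // exprn_ge0 // ltW.
    - apply: emeasurable_funM; first exact: measurable_cst.
      by apply/measurable_EFinP; apply: measurable_indic.
    - exact: measurable_moment.
    - move=> z _; rewrite -EFinM lee_fin [\1_S z]indicE; case: (boolP (z \in S)) => [|_]; last first.
        by rewrite mulr0; apply: mulr_ge0; [exact: powR_ge0|exact: chi_ge0].
      rewrite inE => -[Bz Kz]; rewrite mulr1 /f0.
      have zr : enorm z < r by move: Bz; rewrite /eball /= subr0.
      rewrite (chi_in zr) !mulr1 powR_mulrn //; apply: lerXn2r; rewrite ?nnegrE ?(ltW K0) //.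
      exact: ltW.
  have := le_trans mf (le_trans (HA _ q1) (lee_wpmul2l _ mg)).
  rewrite lee_fin powR_mulrn ?(ltW A0) // exprn_ge0 ?(ltW A0) // => /(_ isT).
  rewrite -EFinM lee_fin mulrA -exprMn => H.
  by rewrite /t expr_div_n mulrAC ler_pdivlMr ?exprn_gt0 // mulrC.
rewrite E; apply/eqP; rewrite eqe eq_le v0 andbT leNgt; apply/negP => vp.
have bb : 0 < b by [].
have [t00|tn0] := eqVneq t 0.
  by have := bound 0%N; rewrite t00 expr0n mul0r leNgt vp.
have tp : 0 < t by rewrite lt_def tn0.
(* Bernoulli's inequality for [1/t = 1 + x] makes [t^(k+1) b] smaller than [v] for some [k]. *)
pose x := t^-1 - 1; have x0 : 0 < x by rewrite subr_gt0 invf_gt1.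
have [k kb] : exists k : nat, b / v / x < k%:R by exists (Num.bound (b / v / x)); apply: archi_boundP; rewrite !divr_ge0 // ltW.
have := bound k.
have tk : 0 < t ^+ k.+1 by exact: exprn_gt0.
rewrite mulrC -ler_pdivrMr // -ler_pdivlMl // => H.
have : (1 + x) ^+ k.+1 <= b / v.
  rewrite /x addrC subrK exprVn; rewrite mulrC in H.
  by rewrite ler_pdivlMr // mulrC -ler_pdivlMr ?invr_gt0 // invrK mulrC; exact: bound.
apply/negP; rewrite -ltNge; apply: lt_le_trans (bernoulli_ineq k.+1 (ltW x0)).
move: kb; rewrite ltr_pdivrMr // => kb; apply: lt_le_trans kb _.
by apply: (@le_trans _ _ (k.+1%:R * x)); [rewrite ler_wpM2r ?ler_nat // ltW|rewrite lerDr].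
Qed.

(** For finite [p] it remains to take roots. For [p = +oo] every essential bound [M] of [g] makes
    [A M + e] one of [f], for each positive [e]. *)
Lemma Lp_ball_le (p : \bar R) : (1 <= p)%E -> (Lp_ball f 0 r p <= A%:E * Lp_ball g 0 r p)%E.
Proof.
have [_ _ A0 HA] := domA.
case: p => [q| |] //.
  rewrite lee_fin => q1; have q0 : 0 < q by exact: lt_le_trans q1.
  have qV : 0 <= q^-1 by rewrite invr_ge0 ltW.
  rewrite /Lp_ball !iint_moment //.
  have -> : A%:E = poweR (A `^ q)%:E q^-1.
    by rewrite poweR_EFin -powRrM divff ?gt_eqF // powRr1 // ltW.
  rewrite -poweRM ?lee_fin ?powR_ge0 ?moment_ge0 //.
  apply: gt0_ler_poweR => //; rewrite ?in_itv /= ?leey ?andbT ?moment_ge0 //.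
    by rewrite mule_ge0 ?lee_fin ?powR_ge0 ?moment_ge0.
  exact: HA.
move=> _; rewrite /Lp_ball.
rewrite -lee_pdivrMl //; apply: le_ereal_inf_tmp => M /= HM; rewrite lee_pdivrMl //.
have ball_pos : lam n (eball (0 : 'rV[R]_n) r) <> 0%E.
  by rewrite lam_eball // => -[] /eqP; rewrite gt_eqF // mulr_gt0 ?exprn_gt0 // vball_gt0.
(* The infimum ranges over all extended reals; a negative bound is excluded because the ball has
   positive measure. *)
have notneg (M' : \bar R) : (M' < 0)%E ->
    iint (fun y : 'rV[R]_n => (\1_(eball 0 r `&` [set z | (M' < (`|g z|)%:E)%E]) y)%:E) = 0%E -> False.
  move=> M'0; have -> : eball 0 r `&` [set z | (M' < (`|g z|)%:E)%E] = eball (0 : 'rV[R]_n) r.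
    by apply/setIidl => z _ /=; apply: lt_le_trans M'0 _; rewrite lee_fin.
  rewrite iintE; last by move=> y; rewrite lee_fin.
    by rewrite integral_indic ?setIT //; exact: measurable_eball.
  by apply/measurable_EFinP; apply: measurable_indic; exact: measurable_eball.
case: M HM => [M| |] HM.
- have [M0|M0] := ltP M 0; first by case: (notneg M%:E _ HM); rewrite lte_fin.
  rewrite superlevel_iint // in HM.
  apply/lee_addgt0Pr => e e0; apply: ereal_inf_lbound => /=.
  rewrite -EFinM -EFinD superlevel_iint //.
  by apply: (dom_superlevel M0 _ HM); rewrite ltrDl.
- by rewrite gt0_muley ?lte_fin // leey.
- by case: (notneg -oo%E _ HM).
Qed.

End Lp_of_moments.

(** * The radial derivative *)

Section radial.
Context {R : realType} (n : nat) (Rad : R) (h : 'rV[R]_n -> R).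
Hypothesis hH : harmonic_on (eball 0 Rad) h.
Notation mu := (@lebesgue_measure R).

Definition euler (y : 'rV[R]_n) : R := \sum_i y ord0 i * pd i h y.
Definition radial_hess (y : 'rV[R]_n) : R := \sum_i y ord0 i * \sum_j y ord0 j * pd j (pd i h) y.
(** Ordered pairs are summed, so this is twice the spherical part of the Laplacian; [euler] and
    [radial_hess] are its first and second order radial companions. *)
Definition angsum (y : 'rV[R]_n) : R := \sum_i \sum_(j | j != i) ang2 i j h y.

Lemma double_sum (a b c : 'I_n -> R) (H : 'I_n -> 'I_n -> R) :
  \sum_i \sum_j (- (a i + a j) + (b i * c j + b j * c i) - (H i j + H j i)) =
  - (2 * n%:R * \sum_i a i) + 2 * ((\sum_i b i) * \sum_j c j) - 2 * \sum_i \sum_j H i j.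
Proof.
have S1 : \sum_(i < n) \sum_(j < n) a i = n%:R * \sum_i a i.
  by rewrite mulr_sumr; apply: eq_bigr => i _; rewrite sumr_const card_ord mulr_natl.
have S2 : \sum_(i < n) \sum_(j < n) a j = n%:R * \sum_i a i.
  by rewrite sumr_const card_ord mulr_natl.
have S3 : \sum_(i < n) \sum_(j < n) b i * c j = (\sum_i b i) * \sum_j c j.
  by rewrite mulr_suml; apply: eq_bigr => i _; rewrite mulr_sumr.
have S4 : \sum_(i < n) \sum_(j < n) b j * c i = (\sum_i b i) * \sum_j c j by rewrite exchange_big.
have S5 : \sum_(i < n) \sum_(j < n) H j i = \sum_i \sum_j H i j by rewrite exchange_big.
transitivity (- (\sum_(i < n) \sum_(j < n) a i + \sum_(i < n) \sum_(j < n) a j)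
  + (\sum_(i < n) \sum_(j < n) b i * c j + \sum_(i < n) \sum_(j < n) b j * c i)
  - (\sum_(i < n) \sum_(j < n) H i j + \sum_(i < n) \sum_(j < n) H j i)).
  rewrite -!big_split /= -!sumrN -!big_split /=; apply: eq_bigr => i _.
  by rewrite -!big_split /= -!sumrN -!big_split /=.
rewrite S1 S2 S3 S4 S5; ring.
Qed.

(** The polar decomposition of [|y|^2] times the Laplacian, which vanishes: second radial
    derivatives are traded for angular ones and a first order term. *)
Lemma angsumE (y : 'rV[R]_n) : enorm y < Rad ->
  angsum y = - (2 * (n%:R - 1) * euler y) - 2 * radial_hess y.
Proof.
move=> yR; have lap : \sum_i pd i (pd i h) y = 0 by have := hH (x := y); rewrite eball0E => /(_ yR)[].
pose a i := y ord0 i * pd i h y; pose b i := y ord0 i ^+ 2; pose c i := pd i (pd i h) y.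
pose H i j := y ord0 i * (y ord0 j * pd j (pd i h) y).
(* With the diagonal included the double sums factor; [ang2 i i] is not zero but [-2 y_i pd i h],
   which is removed afterwards. *)
have full : \sum_i \sum_j ang2 i j h y = - (2 * n%:R * euler y) - 2 * radial_hess y.
  rewrite (eq_bigr (fun i => \sum_j (- (a i + a j) + (b i * c j + b j * c i) - (H i j + H j i)))); last first.
    move=> i _; apply: eq_bigr => j _; rewrite /ang2 /ang /a /b /c /H.
    move: (pd i (pd i h) y) (pd j (pd j h) y) (pd i (pd j h) y) (pd j (pd i h) y) (pd i h y) (pd j h y) (y ord0 i) (y ord0 j) => p q u v s t x z; ring.
  rewrite double_sum lap mulr0 mulr0 addr0 /euler /radial_hess.
  by congr (_ - 2 * _); apply: eq_bigr => i _; rewrite mulr_sumr.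
have diag : \sum_i \sum_j ang2 i j h y = - (2 * euler y) + angsum y.
  rewrite /euler /angsum mulr_sumr -sumrN -big_split /=; apply: eq_bigr => i _.
  rewrite (bigD1 i) //=; congr (_ + _); rewrite /ang2 /ang.
  move: (pd i (pd i h) y) (pd i h y) (y ord0 i) => p q u; ring.
move: full; rewrite diag => full; rewrite -[angsum y](addKr (- (2 * euler y))) full; ring.
Qed.

Let coef (w X l : R) : 0 <= w -> 0 < l -> l < 1 -> X <= w -> 0 <= X ->
  - (w + 4) <= 1 + (3 * (1 - l) - X) /\ 1 + (3 * (1 - l) - X) <= w + 4.
Proof. by move=> *; split; lra. Qed.

Variables (x : 'rV[R]_n) (r l0 : R).
Hypothesis r0 : 0 < r.
Hypothesis rR : r < Rad.
Hypothesis xr : enorm x < r.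
Hypothesis l02 : 2^-1 <= l0.
Hypothesis l01 : l0 < 1.

Let lxr l : l0 <= l <= 1 -> enorm (l *: x) < r.
Proof.
move=> /andP[l0l l1]; rewrite enormZ ger0_norm ?(le_trans _ l0l) ?(le_trans _ l02) ?invr_ge0 //.
apply: le_lt_trans xr; rewrite -[leRHS]mul1r; apply: ler_wpM2r => //; exact: enorm_ge0.
Qed.

Let lxR l : l0 <= l <= 1 -> enorm (l *: x) < Rad.
Proof. by move=> /lxr H; exact: lt_trans rR. Qed.

Let u l := h (l *: x).
Let U l := \sum_i x ord0 i * pd i h (l *: x).
Let V l := \sum_i x ord0 i * \sum_j x ord0 j * pd j (pd i h) (l *: x).

Let Dscale (f : 'rV[R]_n -> R) l : differentiable f (l *: x) ->
  is_derive l (1 : R) (fun l => f (l *: x)) (\sum_j x ord0 j * pd j f (l *: x)).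
Proof.
move=> df; apply: (@is_derive_curve R n f (fun t : R => t *: x)) => // i.
rewrite (_ : (fun u : R => _) = fun u : R => x ord0 i * u ^+ 1); last first.
  by apply/funext => t; rewrite mxE expr1 mulrC.
by have := is_derive_monomial (x ord0 i) l 0; rewrite expr0 !mulr1.
Qed.

Let Du l : l0 <= l <= 1 -> is_derive l (1 : R) u (U l).
Proof. by move=> /lxR lR; apply: Dscale; have := hH (x := l *: x); rewrite eball0E => /(_ lR)[]. Qed.

Let DU l : l0 <= l <= 1 -> is_derive l (1 : R) U (V l).
Proof.
move=> /lxR lR; have [_ dp _ _] : [/\ True, forall i, differentiable (pd i h) (l *: x), True & True].
  by split => //; have := hH (x := l *: x); rewrite eball0E => /(_ lR)[].
have D i : is_derive l (1 : R) (fun l => x ord0 i * pd i h (l *: x)) (x ord0 i * \sum_j x ord0 j * pd j (pd i h) (l *: x)).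
  exact: (is_deriveZ (x ord0 i) (Dscale (dp i))).
have -> : U = \sum_i (fun l => x ord0 i * pd i h (l *: x)) by apply/funext => t; rewrite /U fct_sumE.
exact: is_derive_sum.
Qed.

(** The weight [k] vanishes at [l0], so no derivative of [h] survives at that end. In the derivative
    of [k l^2 U - a u], once [l^2 V] is replaced by [- angsum / 2 - (n - 1) l U], the coefficient of
    [U] is [l^2 + 2 l k - (n - 1) l k - a]; the choice of [a] makes it zero. *)
Let k (l : R) : R := l - l0.
Let a (l : R) : R := l ^+ 2 + (3 - n%:R) * (l * k l).
Let da (l : R) : R := 2 * l + (3 - n%:R) * (k l + l).
Let Phi l := k l * l ^+ 2 * U l - a l * u l.
Let dPhi l := - (da l * u l) - k l * (angsum (l *: x) / 2).

Let DPhi l : l0 <= l <= 1 -> is_derive l (1 : R) Phi (dPhi l).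
Proof.
move=> ll.
have Dk : is_derive l (1 : R) k 1.
  apply: (is_derive_eq (is_deriveB (is_derive_id l (1 : R)) (is_derive_cst l0 l (1 : R)))); by rewrite subr0.
have Dl := is_derive_id l (1 : R).
have Dl2 : is_derive l (1 : R) (fun l : R => l ^+ 2) (2 * l).
  have := is_derive_monomial 1 l 1; rewrite expr1 mul1r.
  by rewrite (_ : (fun s0 : R => _) = fun s : R => s ^+ 2) //; apply/funext => t; rewrite mul1r.
have Dkl2 : is_derive l (1 : R) (fun l => k l * l ^+ 2) (l ^+ 2 + 2 * l * k l).
  apply: (is_derive_eq (is_deriveM Dk Dl2)); rewrite /GRing.scale /=.
  move: (k l) => w; ring.
have Da : is_derive l (1 : R) a (da l).
  have Dlk : is_derive l (1 : R) (fun l => l * k l) (k l + l).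
    apply: (is_derive_eq (is_deriveM Dl Dk)); rewrite /GRing.scale /=; ring.
  apply: (is_derive_eq (is_deriveD Dl2 (is_deriveZ (3 - n%:R) Dlk))); by rewrite /da /GRing.scale.
apply: (is_derive_eq (is_deriveB (is_deriveM Dkl2 (DU ll)) (is_deriveM Da (Du ll)))).
rewrite /dPhi (angsumE (lxR ll)).
have -> : euler (l *: x) = l * U l.
  by rewrite /euler /U mulr_sumr; apply: eq_bigr => i _; rewrite mxE mulrA.
have -> : radial_hess (l *: x) = l ^+ 2 * V l.
  rewrite /radial_hess /V mulr_sumr; apply: eq_bigr => i _; rewrite mxE.
  have -> : \sum_j (l *: x) ord0 j * pd j (pd i h) (l *: x) = l * \sum_j x ord0 j * pd j (pd i h) (l *: x).
    by rewrite mulr_sumr; apply: eq_bigr => j _; rewrite mxE mulrA.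
  by move: (\sum_j _) (x ord0 i) => s t; ring.
by rewrite /GRing.scale /= /a /da; move: (U l) (V l) (u l) (k l) (n%:R : R) => p q s t w; field.
Qed.

Let cscale (f : 'rV[R]_n -> R) l : {for l *: x, continuous f} -> {for l, continuous (fun l : R => f (l *: x))}.
Proof.
move=> cf; apply: (@continuous_comp _ _ _ (fun t : R => t *: x) f); [exact: scalel_continuous|exact: cf].
Qed.

Let ck (l : R) : {for l, continuous k}.
Proof. by apply: continuousB; [exact: cvg_id|exact: cst_continuous]. Qed.

Lemma continuous_ang2 i j y : enorm y < Rad -> {for y, continuous (ang2 i j h)}.
Proof.
move=> yR; have coordC i' : {for y, continuous (fun y : 'rV[R]_n => y ord0 i')} by exact: coord_continuous.
have cp i' := harmonic_continuous_pd hH (i := i') yR.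
have cpp i' j' : {for y, continuous (pd j' (pd i' h))}.
  by have := hH (x := y); rewrite eball0E => /(_ yR)[_ _ + _]; apply.
apply: continuousD.
  apply: continuousN; apply: continuousD; apply: continuousM; by [exact: coordC|exact: cp].
apply: continuousB; apply: continuousM; try exact: coordC.
  by apply: continuousB; apply: continuousM; by [exact: coordC|exact: cpp].
by apply: continuousB; apply: continuousM; by [exact: coordC|exact: cpp].
Qed.

Lemma continuous_ang i j y : enorm y < Rad -> {for y, continuous (ang i j h)}.
Proof.
move=> yR; have coordC i' : {for y, continuous (fun y : 'rV[R]_n => y ord0 i')} by exact: coord_continuous.
have cp i' := harmonic_continuous_pd hH (i := i') yR.
by apply: continuousB; apply: continuousM; by [exact: coordC|exact: cp].
Qed.

Let cdPhi l : l0 <= l <= 1 -> {for l, continuous dPhi}.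
Proof.
move=> ll; apply: continuousB.
  apply: continuousN; apply: continuousM.
    apply: continuousD.
      by apply: continuousM; [exact: cst_continuous|exact: cvg_id].
    apply: continuousM; first exact: cst_continuous.
    by apply: continuousD; [exact: ck|exact: cvg_id].
  by apply: cscale; exact: harmonic_continuous hH _ (lxR ll).
apply: continuousM; first exact: ck.
apply: continuousM; last exact: cst_continuous.
apply: cscale; apply: continuous_sum => i; apply: continuous_sum => j.
exact: continuous_ang2 (lxR ll).
Qed.

(* [Phi] is chosen so that neither [u'] nor [u''] is left in its derivative: the harmonicity of [h]
   expresses [u''] by [u'] and tangential derivatives. *)
Lemma radial_estimate (g : 'rV[R]_n -> R) : nice g -> (forall z, 0 <= g z) ->
  (forall y, enorm y < r ->
     (2 * n%:R + 8) * `|h y| + (1 - l0) / 2 * \sum_i \sum_(j | j != i) `|ang2 i j h y| <= g y) ->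
  (1 - l0) * `|euler x| <= (n%:R + 4) * `|h x| + `|h (l0 *: x)| + ray_average l0 1 g x.
Proof.
move=> ng g0 hg.
have nR : 0 <= n%:R :> R by [].
have l0p : 0 < l0 by apply: lt_le_trans l02; rewrite invr_gt0.
have mg : measurable_fun [set` `]l0, 1[] (fun l : R => g (l *: x)).
  apply: measurable_funTS; apply: (measurableT_comp ng.1).
  by apply: (measurable_rV_scale (a := fun t : R => t) (f := fun=> x)); [exact: measurable_id|exact: measurable_cst].
have bd l : l0 < l < 1 -> `|dPhi l| <= g (l *: x).
  move=> /andP[l0l l1]; apply: le_trans (hg _ (lxr _)); last by rewrite !ltW.
  apply: le_trans (ler_normB _ _) _; rewrite normrN !normrM; apply: lerD.
    apply: ler_wpM2r => //; rewrite /da /k ler_norml; apply/andP.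
    have : 0 <= n%:R * (l - l0 + l) by rewrite mulr_ge0 //; lra.
    have : n%:R * (l - l0 + l) <= n%:R * 2 by apply: ler_wpM2l => //; lra.
    move=> H1 H2; split; rewrite mulrBl; lra.
  rewrite /k ger0_norm ?subr_ge0 ?(ltW l0l) // -mulrA (ger0_norm (_ : 0 <= 2^-1)) ?invr_ge0 // [2^-1 * _]mulrC.
  apply: ler_pM => //; rewrite ?subr_ge0 ?(ltW l0l) ?mulr_ge0 ?invr_ge0 //; first by rewrite lerD2r ltW.
  apply: ler_wpM2r; first by rewrite invr_ge0.
  apply: le_trans (ler_norm_sum _ _ _) _; apply: ler_sum => i _; exact: ler_norm_sum.
have := FTC_le (ltW l01) DPhi cdPhi mg bd.
rewrite (ray_averageE l01 ng g0) lee_fin => F.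
have P1 : Phi 1 = (1 - l0) * euler x - (1 + (3 - n%:R) * (1 - l0)) * h x.
  have -> : euler x = U 1 by rewrite /U /euler scale1r.
  by rewrite /Phi /a /k /u scale1r expr1n !mulr1 mul1r.
have P0 : Phi l0 = - (l0 ^+ 2 * h (l0 *: x)).
  by rewrite /Phi /a /k /u subrr mulr0 mulr0 addr0 !mul0r sub0r.
have E : (1 - l0) * euler x = (Phi 1 - Phi l0) + (1 + (3 - n%:R) * (1 - l0)) * h x + - (l0 ^+ 2 * h (l0 *: x)).
  by rewrite P1 P0; ring.
rewrite -(ger0_norm (_ : 0 <= 1 - l0)) ?subr_ge0 ?(ltW l01) // -normrM E.
apply: le_trans (ler_normD _ _) _.
apply: (@le_trans _ _ (ray_average l0 1 g x + (n%:R + 4) * `|h x| + `|h (l0 *: x)|)); last lra.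
apply: lerD; last first.
  rewrite normrN normrM -[leRHS]mul1r; apply: ler_wpM2r => //.
  by rewrite ger0_norm ?sqr_ge0 // exprn_ile1 // ltW.
apply: le_trans (ler_normD _ _) _; apply: lerD => //.
rewrite normrM; apply: ler_wpM2r => //; rewrite ler_norml; apply/andP.
have : 0 <= n%:R * (1 - l0) by rewrite mulr_ge0 // subr_ge0 ltW.
have : n%:R * (1 - l0) <= n%:R * 1 by apply: ler_wpM2l => //; lra.
rewrite mulr1 [(3 - n%:R) * _]mulrBl => H1 H2; exact: coef.
Qed.

(** From [|x|^2 pd i h = x_i euler - sum_j x_j ang i j h]; dividing by [|x|] is harmless away from
    the centre. *)
Lemma gradient_split : r / 2 <= enorm x ->
  r * grad_norm h x <= 2 * \sum_i \sum_(j | j != i) `|ang i j h x| + 2 * n%:R * `|euler x|.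
Proof.
move=> rx; have x0 : 0 < enorm x by apply: lt_le_trans rx; rewrite divr_gt0.
have one i : r / 2 * `|pd i h x| <= \sum_(j | j != i) `|ang i j h x| + `|euler x|.
  have xx : enorm x ^+ 2 * pd i h x = - (\sum_(j | j != i) x ord0 j * ang i j h x) + x ord0 i * euler x.
    have -> : \sum_(j | j != i) x ord0 j * ang i j h x = \sum_j x ord0 j * ang i j h x.
      by rewrite [RHS](bigD1 i) //= {2}/ang subrr mulr0 add0r.
    rewrite sqr_enorm mulr_suml /euler mulr_sumr -sumrN -big_split /=; apply: eq_bigr => j _.
    by rewrite /ang; move: (x ord0 i) (x ord0 j) (pd i h x) (pd j h x) => p q s t; ring.
  have : enorm x ^+ 2 * `|pd i h x| <= enorm x * (\sum_(j | j != i) `|ang i j h x| + `|euler x|).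
    rewrite -{1}(ger0_norm (sqr_ge0 (enorm x))) -normrM xx; apply: le_trans (ler_normD _ _) _.
    rewrite mulrDr normrN; apply: lerD; last first.
      by rewrite normrM; apply: ler_wpM2r => //; exact: enorm_coord.
    apply: le_trans (ler_norm_sum _ _ _) _; rewrite mulr_sumr; apply: ler_sum => j _.
    by rewrite normrM; apply: ler_wpM2r => //; exact: enorm_coord.
  rewrite expr2 -mulrA ler_pM2l // => H; apply: le_trans H; exact: ler_wpM2r.
have gn : grad_norm h x <= \sum_i `|pd i h x|.
  by rewrite grad_normE; apply: le_trans (enorm_le_sum _) _; apply: ler_sum => i _; rewrite mxE.
apply: (@le_trans _ _ (2 * \sum_i r / 2 * `|pd i h x|)).
  rewrite -mulr_sumr mulrA (_ : 2 * (r / 2) = r); last by field.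
  by apply: ler_wpM2l gn; exact: ltW.
rewrite -mulrA -mulrDr; apply: ler_wpM2l => //.
have -> : n%:R * `|euler x| = \sum_(i < n) `|euler x| by rewrite sumr_const card_ord mulr_natl.
by rewrite -big_split /=; apply: ler_sum => i _; exact: one.
Qed.

End radial.

(** * The gradient estimate *)

Section assembly.
Context {R : realType} (n : nat) (Rad : R) (h : 'rV[R]_n -> R) (r : R) (m : nat).
Hypothesis n0 : (0 < n)%N.
Hypothesis hH : harmonic_on (eball 0 Rad) h.
Hypothesis r0 : 0 < r.
Hypothesis rR : r < Rad / 2.
Hypothesis m0 : (0 < m)%N.
Hypothesis hfreq : forall t, 0 < t < Rad -> frequency h 0 t <= m%:R.
Notation I n f := (Rintegral (lam n) setT f).
Notation chi z := (\1_(eball (0 : 'rV[R]_n) r) z : R).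
Notation f0 := (fun z : 'rV[R]_n => `|h z| * chi z).
Notation dom := (dom r f0).

Let rRad : r < Rad. Proof. by have := r0; have := rR; lra. Qed.

Let nice_abs (f : 'rV[R]_n -> R) : (forall x, enorm x < Rad -> {for x, continuous f}) ->
  nice (fun z => `|f z| * chi z).
Proof. by move=> cf; apply: (nice_restrict r0 rRad) => x xR; apply: continuous_normf; exact: cf. Qed.

Let abs_ge0 (f : 'rV[R]_n -> R) z : 0 <= `|f z| * chi z.
Proof. by apply: mulr_ge0 => //; exact: chi_ge0. Qed.

Let abs_in (f : 'rV[R]_n -> R) z : enorm z < r -> `|f z| * chi z = `|f z|.
Proof. by move=> zr; rewrite (chi_in zr) mulr1. Qed.

Let nf0 : nice f0.
Proof. by apply: nice_abs => x; exact: harmonic_continuous. Qed.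

Let f00 z : 0 <= f0 z. Proof. exact: abs_ge0. Qed.

Lemma dom_scale (k A : R) (F : 'rV[R]_n -> R) : 0 < k -> dom A F -> dom (k * A) (fun z => k * F z).
Proof.
move=> k0 dF; have [mF F0 A0 _] := dF; apply: (dom_le dF (c := k)) => //.
- by apply: measurable_funM => //; exact: measurable_cst.
- by move=> z; rewrite mulr_ge0 // ltW.
- exact: ltW.
- by rewrite mulr_gt0.
Qed.

(** Counting one more than the size keeps the constant positive for an empty sum. *)
Lemma dom_bigsum (T : Type) (s : seq T) (P : pred T) (A : R) (F : T -> 'rV[R]_n -> R) : 0 < A ->
  (forall i, P i -> dom A (F i)) -> dom (A * (size s).+1%:R) (fun z => \sum_(i <- s | P i) F i z).
Proof.
move=> A0 dF; elim: s => [|i s IH].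
  rewrite (_ : (fun z => \sum_(i <- [::] | P i) F i z) = fun=> 0); last by apply/funext => z; rewrite big_nil.
  by apply: (dom_zero r nf0 f00); rewrite mulr1.
have AE : A * (size (i :: s)).+1%:R = A + A * (size s).+1%:R.
  by rewrite [X in _ * X](_ : _ = 1 + (size s).+1%:R) ?mulrDr ?mulr1 // -natrD.
case Pi : (P i).
  rewrite (_ : (fun z => \sum_(i <- i :: s | P i) F i z) = fun z => F i z + \sum_(i <- s | P i) F i z); last first.
    by apply/funext => z; rewrite big_cons Pi.
  by rewrite AE; apply: dom_add IH; exact: dF.
rewrite (_ : (fun z => \sum_(i <- i :: s | P i) F i z) = fun z => \sum_(i <- s | P i) F i z); last first.
  by apply/funext => z; rewrite big_cons Pi.
have [mF F0 B0 _] := IH; apply: (dom_le IH (c := 1)) => //.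
- by move=> z _; rewrite mul1r.
- by rewrite mul1r AE lerDr ltW.
- by rewrite AE addr_gt0.
Qed.

Variables c a : nat -> R.
Hypothesis Hc : \sum_(k < m.*2) `|c k| <= 3.
Hypothesis Ha : forall k, (k < m.*2)%N -> `|a k| <= m.*2%:R.
Hypothesis Hex : forall l, (l < m.*2)%N -> \sum_(k < m.*2) c k * a k ^+ l = (l == 1%N)%:R.

Notation c0 := (@step0 R).
Notation tau k := (c0 / m%:R * a k).
Notation m1 := (average h r).
Notation mR := (m%:R : R).
Notation CE := (@Cerr R n).

Let c00 : 0 < c0. Proof. exact: step0_gt0. Qed.

Let mR0 : 0 < mR. Proof. by rewrite ltr0n. Qed.

Let mR1 : 1 <= mR. Proof. by rewrite ler1n. Qed.

Let CE0 : 0 < CE. Proof. exact: Cerr_gt0. Qed.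

Let v0 : 0 < vball n :> R. Proof. exact: vball_gt0. Qed.

Let averageE : r ^- n * I n (fun z => f0 z * chi z) = m1.
Proof.
congr (_ * _); apply: eq_Rintegral => z _; rewrite /cutoff normrM (ger0_norm (chi_ge0 r z)) -mulrA; congr (_ * _).
by rewrite indicE; case: (_ \in _); rewrite ?mulr1 ?mulr0.
Qed.

Let dom_average : dom (vball n) (fun=> m1).
Proof. by rewrite -averageE; exact: (dom_cst r0 nf0 f00). Qed.

Lemma tangential_bound (i j : 'I_n) z : i != j -> enorm z < r ->
  `|ang i j h z| <= mR / c0 * \sum_(k < m.*2) `|c k| * `|h (rot i j (tau k) z)| + CE * mR * m1 /\
  `|ang2 i j h z| <= mR / c0 * \sum_(k < m.*2) `|c k| * `|ang i j h (rot i j (tau k) z)| + 8 * mR * (CE * mR * m1).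
Proof.
(* Kernel radius [r/2] and outer radius [3r/2]: they meet the constraints of [tangential_estimate]
   for [|z| < r], and [3r/2 < Rad] follows from [r < Rad/2]. *)
move=> ij zr; have rho0 : 0 < r / 2 by rewrite divr_gt0.
have z1 : enorm z <= 2 * (r / 2) by lra.
have z2 : enorm z + r / 2 <= 3 * (r / 2) by lra.
have z3 : 3 * (r / 2) < Rad by have := rR; have := r0; lra.
have [H1 H2] := tangential_estimate hH ij rho0 z1 z2 (lexx _) z3 m0 c00 Hc Ha Hex.
have E := error_le n0 hH r0 rR m0 hfreq.
split; first by apply: (le_trans H1); rewrite lerD2l.
by apply: (le_trans H2); rewrite lerD2l; apply: ler_wpM2l E; rewrite mulr_ge0.
Qed.

Notation ANG i j := (fun z : 'rV[R]_n => `|ang i j h z| * chi z).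
Notation ANG2 i j := (fun z : 'rV[R]_n => `|ang2 i j h z| * chi z).

Let nANG i j : nice (ANG i j).
Proof. by apply: nice_abs => x; exact: continuous_ang. Qed.

Let nANG2 i j : nice (ANG2 i j).
Proof. by apply: nice_abs => x; exact: continuous_ang2. Qed.

Definition Cang : R := 4 / c0 + CE * vball n.

Lemma Cang_gt0 : 0 < Cang.
Proof. by rewrite addr_gt0 // ?divr_gt0 // mulr_gt0. Qed.

Let dom_rot_sum (i j : 'I_n) A (F : 'rV[R]_n -> R) : i != j -> 0 < A -> dom A F ->
  dom (mR / c0 * (4 * A)) (fun z => mR / c0 * \sum_(k < m.*2) `|c k| * F (rot i j (tau k) z)).
Proof.
move=> ij A0 dF; apply: dom_scale; first by rewrite divr_gt0.
have dS := dom_sum nf0 f00 (N := m.*2) (w := fun k => `|c k|) A0 A0 (fun k => normr_ge0 (c k))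
  (fun k _ => dom_rot (tau k) ij dF).
have [mS S0 _ _] := dS; apply: (dom_le dS (c := 1)) => //.
- by move=> z _; rewrite mul1r.
- by rewrite mul1r; have := ler_wpM2l (ltW A0) Hc; lra.
- by rewrite mulr_gt0.
Qed.

Lemma dom_ang (i j : 'I_n) : i != j -> dom (Cang * mR) (ANG i j).
Proof.
move=> ij; have d1 := dom_rot_sum ij ltr01 (dom_self r nf0 f00).
have CEm : 0 < CE * mR by rewrite mulr_gt0.
have d2 := dom_scale CEm dom_average.
have CA0 : 0 < Cang * mR by rewrite mulr_gt0 // Cang_gt0.
apply: (dom_le (dom_add d1 d2) (c := 1)) => //.
- exact: (nANG i j).1.
- move=> z zr; rewrite mul1r abs_in //; apply: le_trans (tangential_bound ij zr).1 _.
  rewrite lerD2r; apply: ler_wpM2l; first by rewrite divr_ge0 // ltW.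
  by apply: ler_sum => k _; rewrite abs_in // enorm_rot.
- by rewrite mul1r /Cang le_eqVlt; apply/orP; left; apply/eqP; field; rewrite gt_eqF.
Qed.

Definition Cang2 : R := 4 * Cang / c0 + 8 * CE * vball n.

Lemma Cang2_gt0 : 0 < Cang2.
Proof.
have := Cang_gt0 => CA; rewrite addr_gt0 //; first by rewrite divr_gt0 // mulr_gt0.
by rewrite mulr_gt0 // mulr_gt0.
Qed.

(** The scheme expresses [ang2] by values of [ang] at rotated points, which [dom_ang] already
    controls; each order of differentiation costs one factor [m]. *)
Lemma dom_ang2 (i j : 'I_n) : i != j -> dom (Cang2 * mR ^+ 2) (ANG2 i j).
Proof.
move=> ij; have CAm : 0 < Cang * mR by rewrite mulr_gt0 // Cang_gt0.
have d1 := dom_rot_sum ij CAm (dom_ang ij).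
have CEm : 0 < 8 * mR * (CE * mR) by rewrite mulr_gt0 // mulr_gt0.
have d2 := dom_scale CEm dom_average.
apply: (dom_le (dom_add d1 d2) (c := 1)) => //.
- exact: (nANG2 i j).1.
- move=> z zr; rewrite mul1r abs_in //; apply: le_trans (tangential_bound ij zr).2 _.
  rewrite mulrA lerD2r; apply: ler_wpM2l; first by rewrite divr_ge0 // ltW.
  by apply: ler_sum => k _; rewrite abs_in // enorm_rot.
- by rewrite mul1r /Cang2 le_eqVlt; apply/orP; left; apply/eqP; field; rewrite gt_eqF.
- by rewrite mulr_gt0 ?Cang2_gt0 // exprn_gt0.
Qed.

Notation nI := ((size (index_enum 'I_n)).+1%:R : R).

Let dom_double A (F : 'I_n -> 'I_n -> 'rV[R]_n -> R) : 0 < A -> (forall i j, i != j -> dom A (F i j)) ->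
  dom (A * nI * nI) (fun z => \sum_i \sum_(j | j != i) F i j z).
Proof.
move=> A0 dF; apply: dom_bigsum; first by rewrite mulr_gt0.
by move=> i _; apply: dom_bigsum => // j ji; apply: dF; rewrite eq_sym.
Qed.

(** A length of order [1/m] balances the radial estimate: second angular derivatives, of size [m^2],
    carry a weight [1/m] and are integrated over a length [1/m], while dividing by the length to
    isolate [euler] costs one factor [m]. Being at most [1/2], it also keeps the dilation factors
    above [1/2]. *)
Let kap : R := (2 * mR)^-1.
Let l0 : R := 1 - kap.
Let kap0 : 0 < kap. Proof. by rewrite invr_gt0 mulr_gt0. Qed.

Let kap1 : kap <= 2^-1. Proof. by rewrite lef_pV2 ?posrE ?mulr_gt0 // ler_peMr. Qed.

Let l02 : 2^-1 <= l0. Proof. by rewrite /l0; have := kap1; lra. Qed.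

Let l01 : l0 < 1. Proof. by rewrite /l0; have := kap0; lra. Qed.

(** The majorant asked for by [radial_estimate], cut off outside [B(0,r)] so as to be [nice]. *)
Let g z := (2 * n%:R + 8) * f0 z + kap / 2 * \sum_i \sum_(j | j != i) ANG2 i j z.

Definition Cray : R := 2 * n%:R + 8 + Cang2 * nI * nI / 4.

Let nR0 : 0 <= n%:R :> R. Proof. by []. Qed.

Let nI0 : 0 < nI. Proof. by rewrite ltr0n. Qed.

Let C80 : 0 < 2 * n%:R + 8 :> R. Proof. by have := nR0; lra. Qed.

Let CII : 0 < Cang2 * nI * nI. Proof. by rewrite !mulr_gt0 ?Cang2_gt0. Qed.

Let dom_g : dom (Cray * mR) g.
Proof.
have A2 : 0 < Cang2 * mR ^+ 2 by rewrite mulr_gt0 ?Cang2_gt0 // exprn_gt0.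
have d1 := dom_scale C80 (dom_self r nf0 f00).
have k2 : 0 < kap / 2 by rewrite divr_gt0.
have d2 := dom_scale k2 (dom_double A2 dom_ang2).
have [mg' g0' _ _] := dom_add d1 d2.
have CR : 0 < Cray by rewrite addr_gt0 // divr_gt0.
apply: (dom_le (dom_add d1 d2) (c := 1)) => //.
- by move=> z _; rewrite mul1r.
- rewrite mul1r mulr1 /Cray.
  have -> : kap / 2 * (Cang2 * mR ^+ 2 * nI * nI) = Cang2 * nI * nI / 4 * mR by rewrite /kap; field; rewrite gt_eqF.
  rewrite [leRHS]mulrDl lerD2r; have := ler_wpM2l (ltW C80) mR1; lra.
- exact: mulr_gt0.
Qed.

Let ng : nice g.
Proof.
apply: niceD; first exact: niceZ.
apply: niceZ; apply: nice_sum => i; apply: nice_sum => j; exact: nANG2.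
Qed.

Let g0 z : 0 <= g z.
Proof. by have [] := dom_g. Qed.

Let dom_avg : dom (2 ^+ n * Cray / 2) (ray_average l0 1 g).
Proof.
have -> : 2 ^+ n * Cray / 2 = 2 ^+ n * (1 - l0) * (Cray * mR).
  have -> : 1 - l0 = kap by rewrite /l0 opprB addrC subrK.
  by rewrite /kap; field; rewrite gt_eqF.
exact: (dom_ray_average l02 l01 (lexx 1) ng g0 dom_g).
Qed.

(** The bound of [radial_estimate] for [euler], after division by [1 - l0]. *)
Let W z := 2 * mR * ((n%:R + 4) * f0 z + f0 (l0 *: z) + ray_average l0 1 g z).

Definition Ceuler : R := 2 * (n%:R + 4 + 2 ^+ n + 2 ^+ n * Cray / 2).

Let dom_W : dom (Ceuler * mR) W.
Proof.
have n4 : 0 < n%:R + 4 :> R by have := nR0; lra.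
have l012 : 2^-1 <= l0 <= 1 by rewrite l02 ltW.
have d1 := dom_scale n4 (dom_self r nf0 f00).
have d2 := dom_dil l012 (dom_self r nf0 f00).
have m2 : 0 < 2 * mR by rewrite mulr_gt0.
have := dom_scale m2 (dom_add (dom_add d1 d2) dom_avg).
by rewrite !mulr1 (_ : 2 * mR * _ = Ceuler * mR) // /Ceuler; ring.
Qed.

Let euler_le z : enorm z < r -> `|euler h z| <= W z.
Proof.
move=> zr.
have l0z : enorm (l0 *: z) < r.
  have l0p : 0 < l0 by apply: lt_le_trans l02; rewrite invr_gt0.
  rewrite enormZ (gtr0_norm l0p); apply: le_lt_trans zr; rewrite -[leRHS]mul1r.
  by apply: ler_wpM2r; [exact: enorm_ge0|exact: ltW].
have k1 : 1 - l0 = kap by rewrite /l0 opprB addrC subrK.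
have hg y : enorm y < r -> (2 * n%:R + 8) * `|h y| + (1 - l0) / 2 * \sum_i \sum_(j | j != i) `|ang2 i j h y| <= g y.
  move=> yr; rewrite k1 /g abs_in // lerD2l; apply: ler_wpM2l; first by rewrite divr_ge0 // ltW.
  by apply: ler_sum => i _; apply: ler_sum => j _; rewrite abs_in.
have := radial_estimate hH rRad zr l02 l01 ng g0 hg.
rewrite k1 /W !abs_in // mulrC -ler_pdivlMr // /kap invrK => H; apply: (le_trans H).
by rewrite mulrC.
Qed.

Definition Cgrad : R := 2 * Cang * nI * nI + 2 * n%:R * Ceuler + 4 * n%:R * @Cint R n * vball n.

Lemma continuous_grad_norm x : enorm x < Rad -> {for x, continuous (grad_norm h)}.
Proof.
move=> xR; rewrite /grad_norm.
apply: (@continuous_comp _ _ _ (fun x => \sum_i pd i h x ^+ 2) (@Num.sqrt R)); last exact: sqrt_continuous.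
apply: continuous_sum => i.
apply: (@continuous_comp _ _ _ (pd i h) (fun t : R => t ^+ 2)); last exact: exprn_continuous.
exact: harmonic_continuous_pd xR.
Qed.

(** Near the centre angular and radial parts do not control the gradient, but there a fixed distance
    to the boundary is left and [interior_gradient] applies; beyond [r/2] [gradient_split] takes
    over. *)
Lemma dom_gradient : dom (Cgrad * mR / r) (fun z => `|grad_norm h z| * chi z).
Proof.
have nR1 : 0 < n%:R :> R by rewrite ltr0n.
have CI := @Cint_gt0 R n.
have CAm : 0 < Cang * mR by rewrite mulr_gt0 // Cang_gt0.
have n2 : 0 < 2 * n%:R :> R by rewrite mulr_gt0.
have nC : 0 < 4 * n%:R * @Cint R n by exact: (mulr_gt0 (mulr_gt0 (ltr0n R 4) nR1) CI).
have d1 := dom_scale (ltr0n R 2) (dom_double CAm dom_ang).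
have d2 := dom_scale n2 dom_W.
have d3 := dom_scale nC dom_average.
have d := dom_add (dom_add d1 d2) d3; have [_ _ D0 _] := d.
have W0 z : 0 <= W z by have [] := dom_W.
apply: (dom_le d (c := r^-1)).
- by apply: (nice_abs _).1 => x; exact: continuous_grad_norm.
- by move=> z; exact: abs_ge0.
- by rewrite invr_ge0 ltW.
- move=> z zr; rewrite abs_in // ler_pdivlMl //.
  have G0 : 0 <= grad_norm h z by rewrite grad_normE enorm_ge0.
  rewrite (ger0_norm G0).
  have S0 : 0 <= 2 * \sum_i \sum_(j | j != i) ANG i j z.
    by rewrite mulr_ge0 // sumr_ge0 // => i _; rewrite sumr_ge0 // => j _; exact: abs_ge0.
  have [z2|z2] := ltP (enorm z) (r / 2).
    apply: (@le_trans _ _ (4 * n%:R * @Cint R n * m1)); last first.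
      by rewrite lerDr addr_ge0 // mulr_ge0 // ltW.
    apply: (@le_trans _ _ (r * \sum_(i < n) (4 / r * (@Cint R n * m1)))).
      apply: ler_wpM2l; first exact: ltW.
      rewrite grad_normE; apply: le_trans (enorm_le_sum _) _; apply: ler_sum => i _; rewrite mxE.
      exact: (@interior_gradient R n Rad h r hH r0 rR z i z2).
    rewrite sumr_const card_ord -[_ *+ n]mulr_natl le_eqVlt; apply/orP; left; apply/eqP; field; rewrite gt_eqF //.
  apply: le_trans (gradient_split h r0 z2) _.
  apply: (@le_trans _ _ (2 * \sum_i \sum_(j | j != i) ANG i j z + 2 * n%:R * W z)).
    apply: lerD; last by apply: ler_wpM2l (euler_le zr); exact: ltW.
    by apply: ler_wpM2l => //; apply: ler_sum => i _; apply: ler_sum => j _; rewrite abs_in.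
  by rewrite lerDl mulr_ge0 ?average_ge0 // ltW.
- rewrite mulrC; apply: ler_wpM2r; first by rewrite invr_ge0 ltW.
  have aux (A M J N E P : R) : P * 1 <= P * M ->
      2 * (A * M * J * J) + 2 * N * (E * M) + P <= (2 * A * J * J + 2 * N * E + P) * M.
    rewrite mulr1 => H; apply: (@le_trans _ _ (2 * (A * M * J * J) + 2 * N * (E * M) + P * M)).
      by rewrite lerD2l.
    by rewrite le_eqVlt; apply/orP; left; apply/eqP; ring.
  exact: aux (ler_wpM2l (mulr_ge0 (ltW nC) (ltW v0)) mR1).
- apply: divr_gt0 => //; apply: mulr_gt0 => //.
  rewrite /Cgrad; apply: addr_gt0; last by rewrite mulr_gt0.
  apply: addr_gt0; first by rewrite !mulr_gt0 // Cang_gt0.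
  have Ce : 0 < Ceuler by have [_ _ + _] := dom_W; rewrite pmulr_lgt0.
  exact: mulr_gt0 n2 Ce.
Qed.

Lemma Lp_ball_gradient (A : R) (p : \bar R) : Cgrad * mR / r <= A -> (1 <= p)%E ->
  (Lp_ball (grad_norm h) 0 r p <= A%:E * Lp_ball h 0 r p)%E.
Proof.
move=> CA; have [mF F0 C0 _] := dom_gradient.
apply: (Lp_ball_le r0 mF nf0.1); apply: (dom_le dom_gradient (c := 1)) => //.
- by move=> z _; rewrite mul1r.
- by rewrite mul1r.
- exact: lt_le_trans CA.
Qed.

Lemma Cgrad_gt0 : 0 < Cgrad.
Proof.
have [_ _ + _] := dom_gradient.
by rewrite -mulrA pmulr_lgt0 // divr_gt0.
Qed.

End assembly.

Theorem theoremA2 (R : realType) (d : nat) : (2 <= d)%N ->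
  exists C : R,
  forall (Rad : R) (h : 'rV[R]_d -> R) (N : R),
    0 < Rad ->
    harmonic_on (eball 0 Rad) h ->
    1 <= N ->
    (forall rho : R, 0 < rho < Rad -> frequency h 0 rho <= N) ->
    forall (r : R) (p : \bar R), 0 < r -> r < Rad / 2 -> (1 <= p)%E ->
      (Lp_ball (grad_norm h) 0 r p
         <= (C * N / r)%:E * Lp_ball h 0 r p)%E.
Proof.
move=> d2; exists (2 * @Cgrad R d) => Rad h N Rad0 hH N1 hN r p r0 rR p1.
have d0 : (0 < d)%N by exact: ltnW.
(* An integer above [N] and at most [N + 1 <= 2 N]; this is the factor 2 in the constant. *)
pose m := (Num.trunc N).+1.
have N0 : 0 <= N by exact: le_trans N1.
have /andP[mN Nm] := truncn_itv N0.
have m0 : (0 < m)%N by [].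
have hfreq t : 0 < t < Rad -> frequency h 0 t <= m%:R.
  by move=> /hN H; apply: (le_trans H); exact: ltW.
have [c [a [Hc Ha Hex]]] := @numerical_differentiation R m m0.
have CG := Cgrad_gt0 d0 hH r0 rR m0 hfreq Hc Ha Hex.
apply: (Lp_ball_gradient d0 hH r0 rR m0 hfreq Hc Ha Hex) p1.
apply: ler_wpM2r; first by rewrite invr_ge0 ltW.
rewrite [2 * _]mulrC -mulrA; apply: ler_wpM2l; first exact: ltW.
by rewrite /m -natr1; have := mN; have := N1; lra.
Qed.
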